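(* For each real $a>0$, let $A_a$ be the self-adjoint operator on $L^2(-a,a)$ associated with the closed lower bounded quadratic form $Q_W^{\,a}$ (the localized Weil quadratic form), so that $Q_W^{\,a}(v)=\langle A_a v,v\rangle_{L^2}$ for $v\in\mathfrak D(A_a)$, and let $B_a=D^\ast G_a D$ be the symmetric operator on $L^2(-a,a)$ with domain $\mathfrak D(B_a)=H_0^1(-a,a)$. Then $A_a$ is the Friedrichs extension of $B_a$.
   Context: All function spaces are complex; $\langle v_1,v_2\rangle_{L^2}=\int v_1\overline{v_2}\,dx$; $L^2(-a,a)$ is viewed as a closed subspace of $L^2(\mathbb R)$ by extending functions by zero. Weil functional: with $\Lambda$ the von Mangoldt function and $C_0$ the Euler--Mascheroni constant, $$W(f)=\int_{-\infty}^{\infty} f(x)(e^{x/2}+e^{-x/2})\,dx-\sum_{n\ge1}\frac{\Lambda(n)}{\sqrt n}\bigl(f(\log n)+f(-\log n)\bigr)-(\log 4\pi+C_0)f(0)-\int_0^\infty\{f(x)+f(-x)-2e^{-x/2}f(0)\}\frac{e^{x/2}\,dx}{e^x-e^{-x}}.$$ With $\widetilde v(x)=\overline{v(-x)}$ and $*$ denoting convolution, put $Q_W(v_1,v_2)=W(v_1*\widetilde{v_2})$ and $Q_W(v)=Q_W(v,v)$. For $v\in L^2(-a,a)$ the function $f=v*\widetilde v$ is continuous with compact support and $\mathrm{Re}\,f(x)\le f(0)$, so $Q_W(v)\in(-\infty,+\infty]$ is well defined. $Q_W^{\,a}$ is the restriction of $Q_W$ to $L^2(-a,a)$, with form domain $\mathfrak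 D(Q_W^{\,a})=\{v\in L^2(-a,a): |Q_W^{\,a}(v)|<\infty\}$. It is known that $Q_W^{\,a}$ is a densely defined, lower bounded, closed symmetric form. $A_a$ is the self-adjoint operator associated with it: $v\in\mathfrak D(A_a)$ with $A_av=h$ iff $v\in\mathfrak D(Q_W^{\,a})$, $h\in L^2(-a,a)$ and $Q_W^{\,a}(v,w)=\langle h,w\rangle_{L^2}$ for all $w\in\mathfrak D(Q_W^{\,a})$. Screw function: $g:\mathbb R\to\mathbb R$ is the continuous even function $$g(t)=-4(e^{t/2}+e^{-t/2}-2)+\sum_{n\le e^{|t|}}\frac{\Lambda(n)}{\sqrt n}(|t|-\log n)-\frac{|t|}2(\psi(1/4)-\log\pi)-\frac14\bigl(\Phi(1,2,1/4)-e^{-|t|/2}\Phi(e^{-2|t|},2,1/4)\bigr),$$ where $\psi$ is the digamma function and $\Phi(z,s,\alpha)=\sum_{n\ge0}(n+\alpha)^{-s}z^n$. Operators: $L_0^2(-a,a)=\{u\in L^2(-a,a):\int_{-a}^a u\,dx=0\}$; $P_a:L^2(\mathbb R)\to L^2_0(-a,a)$ is the orthogonal projection, $(P_au)(x)=u(x)-\frac1{2a}\int_{-a}^a u(y)\,dy$ on $(-a,a)$ and $0$ elsewhere; $(Gu)(x)=\int_{-\infty}^\infty g(x-y)u(y)\,dy$; $G_a=P_aGP_a:L_0^2(-a,a)\to L_0^2(-a,a)$. $D=i\,d/dx$ on $L^2(-a,a)$ with domain $H_0^1(-a,a)$ (its range is $L_0^2(-a,a)$), and $D^\ast=i\,d/dx$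 is its adjoint, with domain $H^1(-a,a)$. For $u\in L_0^2(-a,a)$ one has $G_au\in H^1(-a,a)$, so $B_a=D^\ast G_aD$ is well defined on $H_0^1(-a,a)$. The Friedrichs extension of a densely defined lower bounded symmetric operator $B$ is the self-adjoint operator associated with the closure of the form $v\mapsto\langle Bv,v\rangle$ on $\mathfrak D(B)$. *)

(* Defs.v *)
From HB Require Import structures.
From mathcomp Require Import all_boot all_order all_algebra.
From mathcomp Require Import complex.
From mathcomp Require Import all_classical all_reals all_analysis.

Set Implicit Arguments.
Unset Strict Implicit.
Unset Printing Implicit Defensive.

Import Order.TTheory GRing.Theory Num.Theory.
Import numFieldNormedType.Exports.

Local Open Scope classical_set_scope.
Local Open Scope ring_scope.

(* Elements of L^2 are represented by measurable functions R -> R[i]. Domains of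
   forms and graphs of operators are invariant under a.e. equality of these. *)

Section Functions.
Context {R : realType}.
Local Notation C := R[i].
Local Notation mu := (@lebesgue_measure R).

Definition RtoC (x : R) : C := Complex x 0.

Definition sqmod (z : C) : R := complex.Re z ^+ 2 + complex.Im z ^+ 2.

Definition cmeasurable (v : R -> C) : Prop :=
  measurable_fun setT (fun x => complex.Re (v x)) /\
  measurable_fun setT (fun x => complex.Im (v x)).

Definition cintegral (D : set R) (f : R -> C) : C :=
  Complex (Rintegral mu D (fun x => complex.Re (f x)))
          (Rintegral mu D (fun x => complex.Im (f x))).

Definition inner (v w : R -> C) : C :=
  cintegral setT (fun x => v x * (w x)^*%C).

Definition normsq (v : R -> C) : \bar R :=
  (\int[mu]_(x in setT) (sqmod (v x))%:E)%E.

(* v belongs to L^2(-a,a), extended by zero to the real line *)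
Definition L2 (a : R) (v : R -> C) : Prop :=
  [/\ cmeasurable v, (normsq v < +oo)%E &
      {ae mu, forall x, ~ `]-a, a[%classic x -> v x = 0}].

Definition cvgL2 (u : nat -> R -> C) (v : R -> C) : Prop :=
  (normsq (fun x => u n x - v x)) @[n --> \oo] --> 0%E.

Definition dense_in_L2 (a : R) (D : set (R -> C)) : Prop :=
  forall v, L2 a v -> exists2 u : nat -> R -> C, (forall n, D (u n)) & cvgL2 u v.

End Functions.

Section FormsAndOperators.
Context {R : realType}.
Local Notation C := R[i].

(* The quadratic form is q(v) = fval q v v. *)
Record form := Form {
  fdom : set (R -> C);
  fval : (R -> C) -> (R -> C) -> C }.

(* The graph of an operator: [T v h] means v is in its domain and T v = h. *)
Definition operator := (R -> C) -> (R -> C) -> Prop.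

Definition odom (T : operator) : set (R -> C) := [set v | exists h, T v h].

Definition oapp (T : operator) (v : R -> C) : R -> C :=
  xget (fun=> 0) [set h | T v h].

Definition symmetric_op (T : operator) : Prop :=
  forall v h w k, T v h -> T w k -> inner h w = inner v k.

(* The order of R[i] is used: z <= z' iff Im z = Im z' and Re z <= Re z'. *)
Definition lower_bounded_op (T : operator) : Prop :=
  exists c : R, forall v h, T v h -> RtoC c * inner v v <= inner h v.

(* The operator in L^2(-a,a) associated with a form. *)
Definition form_operator (a : R) (q : form) : operator := fun v h =>
  [/\ fdom q v, L2 a h & forall w, fdom q w -> fval q v w = inner h w].

Definition op_form (T : operator) : form :=
  Form (odom T) (fun v w => inner (oapp T v) w).

(* Kato's q-convergence of u to v: u n --> v in L^2 and q(u n - u m) --> 0. *)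
Definition form_cvg (a : R) (q : form) (u : nat -> R -> C) (v : R -> C) : Prop :=
  [/\ forall n, fdom q (u n), L2 a v, cvgL2 u v &
      (let d (k : nat * nat) : R -> C := fun x => u k.1 x - u k.2 x in
       sqmod (fval q (d k) (d k))) @[k --> (\oo, \oo)] --> (0 : R)].

(* qbar is the closure of q; its existence includes that q is closable, since
   the limits below may not depend on the approximating sequences. *)
Definition is_form_closure (a : R) (q qbar : form) : Prop :=
  (forall v, fdom qbar v <-> exists u, form_cvg a q u v) /\
  (forall v w u u', form_cvg a q u v -> form_cvg a q u' w ->
     sqmod (fval q (u n) (u' n) - fval qbar v w) @[n --> \oo] --> (0 : R)).

Definition is_friedrichs_extension (a : R) (A B : operator) : Prop :=
  [/\ dense_in_L2 a (odom B), symmetric_op B, lower_bounded_op B &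
      exists2 qbar, is_form_closure a (op_form B) qbar &
        forall v h, A v h <-> form_operator a qbar v h].

End FormsAndOperators.
Arguments form : clear implicits.
Arguments operator : clear implicits.

Section WeilForm.
Context {R : realType}.
Local Notation C := R[i].
Local Notation mu := (@lebesgue_measure R).

Definition convolution (f g : R -> C) (x : R) : C :=
  cintegral setT (fun y => f y * g (x - y)).

Definition tilde (v : R -> C) (x : R) : C := ((v (- x))^*)%C.

Definition von_mangoldt (n : nat) : R :=
  if primes n is [:: p] then ln p%:R else 0.

Definition euler_mascheroni : R :=
  limn (fun n : nat => \sum_(1 <= k < n.+1) k%:R^-1 - ln n%:R : R).

(* the sum over n >= 1 *)
Definition cseries (z : nat -> C) : C :=
  Complex (limn (fun N : nat => \sum_(1 <= n < N) complex.Re (z n) : R))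
          (limn (fun N : nat => \sum_(1 <= n < N) complex.Im (z n) : R)).

Definition weil_finite_part (f : R -> C) : C :=
  cintegral setT (fun x => f x * RtoC (expR (x / 2) + expR (- x / 2)))
  - cseries (fun n => RtoC (von_mangoldt n / Num.sqrt n%:R) *
                      (f (ln n%:R) + f (- ln n%:R)))
  - RtoC (ln (4 * pi) + euler_mascheroni) * f 0.

Definition weil_arch (f : R -> C) (x : R) : C :=
  (f x + f (- x) - RtoC (2 * expR (- x / 2)) * f 0) *
  RtoC (expR (x / 2) / (expR x - expR (- x))).

Definition weil (f : R -> C) : C :=
  weil_finite_part f - cintegral `]0, +oo[%classic (weil_arch f).

Definition QW (v1 v2 : R -> C) : C := weil (convolution v1 (tilde v2)).

(* QW(v) for v in L^2(-a,a), valued in ]-oo, +oo]: for f = v * tilde v the terms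
   of the functional are real, and the archimedean integral may be -oo. *)
Definition QW_ext (v : R -> C) : \bar R :=
  let f := convolution v (tilde v) in
  ((complex.Re (weil_finite_part f))%:E
   - \int[mu]_(x in `]0%R, +oo[%classic) (complex.Re (weil_arch f x))%:E)%E.

Definition QWa (a : R) : form R :=
  Form [set v | L2 a v /\ (`|QW_ext v| < +oo)%E] QW.

Definition opA (a : R) : operator R := form_operator a (QWa a).

End WeilForm.

Section ScrewOperator.
Context {R : realType}.
Local Notation C := R[i].
Local Notation mu := (@lebesgue_measure R).

Definition Gamma (x : R) : R :=
  Rintegral mu `]0, +oo[%classic (fun t => t `^ (x - 1) * expR (- t)).

Definition digamma (x : R) : R := derive1 Gamma x / Gamma x.

Definition lerch (z s alpha : R) : R :=
  limn (series (fun n : nat => (n%:R + alpha) `^ (- s) * z ^+ n)).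

Definition screw (t : R) : R :=
  - 4 * (expR (t / 2) + expR (- t / 2) - 2)
  + \sum_(1 <= n < (Num.truncn (expR `|t|)).+1)
      von_mangoldt n / Num.sqrt n%:R * (`|t| - ln n%:R)
  - `|t| / 2 * (digamma (1 / 4) - ln pi)
  - 1 / 4 * (lerch 1 2 (1 / 4)
             - expR (- `|t| / 2) * lerch (expR (- (2 * `|t|))) 2 (1 / 4)).

Definition L20 (a : R) (u : R -> C) : Prop :=
  L2 a u /\ cintegral `]-a, a[%classic u = 0.

Definition projL20 (a : R) (u : R -> C) (x : R) : C :=
  if x \in `]-a, a[ then
    u x - RtoC (2 * a)^-1 * cintegral `]-a, a[%classic u
  else 0.

Definition opG (u : R -> C) (x : R) : C :=
  cintegral setT (fun y => RtoC (screw (x - y)) * u y).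

Definition opGa (a : R) (u : R -> C) : R -> C := projL20 a (opG (projL20 a u)).

Definition smooth (f : R -> R) : Prop :=
  forall (n : nat) (x : R), derivable (derive1n n f) x 1.

(* complex C_c^oo(-a,a) *)
Definition test_function (a : R) (phi : R -> C) : Prop :=
  [/\ smooth (fun x => complex.Re (phi x)),
      smooth (fun x => complex.Im (phi x)) &
      exists2 b, b < a & forall x, b < `|x| -> phi x = 0].

Definition cderive (phi : R -> C) (x : R) : C :=
  Complex (derive1 (fun y => complex.Re (phi y)) x)
          (derive1 (fun y => complex.Im (phi y)) x).

Definition weak_derivative (a : R) (v w : R -> C) : Prop :=
  [/\ L2 a v, L2 a w & forall phi, test_function a phi ->
      cintegral `]-a, a[%classic (fun x => v x * cderive phi x) =
      - cintegral `]-a, a[%classic (fun x => w x * phi x)].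

(* the closure of C_c^oo(-a,a) in H^1(-a,a) *)
Definition H10 (a : R) : set (R -> C) :=
  [set v | exists w, weak_derivative a v w /\
     exists phi : nat -> R -> C,
       [/\ forall n, test_function a (phi n), cvgL2 phi v &
           cvgL2 (fun n => cderive (phi n)) w]].

(* i d/dx with domain H^1(-a,a) *)
Definition opDstar (a : R) : operator R := fun v h =>
  exists2 w, weak_derivative a v w & h = (fun x => 'i%C * w x).

Definition opD (a : R) : operator R := fun v h => H10 a v /\ opDstar a v h.

Definition opB (a : R) : operator R := fun v h =>
  exists u, [/\ opD a v u, L20 a u & opDstar a (opGa a u) h].

End ScrewOperator.

(* Main.v *)
(** The Weil form is the sum of a form K bounded on L^2(-a,a) and of the archimedean energy
    E(v) = int_0^oo e^{b/2} / (e^b - e^{-b}) ||v - v(. - b)||^2 db >= 0. Since E is lower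
    semicontinuous in L^2 (Fatou), every sequence of finite energy that is Cauchy for E and
    converges in L^2 converges for E. Dilating a function of finite energy by a factor < 1, which
    almost does not increase E, and mollifying it, which does not increase E (Jensen), produces
    test functions converging to it in L^2 and for E.

    The series of the Lerch function in g sum to integrals of the archimedean kernel, which makes
    g a superposition of ramps max(0, |t| - b) over b. For w, w' of mean zero with primitives
    V, W in H^1_0, integrating such a ramp against the correlation of w and w' gives minus the
    sum of the values at b and -b of the correlation of V and W. Summing over the ramps gives
    <G w, w'> = Q_W(V, W), that is <B_a V, W> = Q_W(V, W). The form of B_a
    is thus the restriction of Q_W to H^1_0(-a,a), and its closure is Q_W^a. *)

Require Import Defs.
From HB Require Import structures.
From mathcomp Require Import all_boot all_order all_algebra.
From mathcomp Require Import complex.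
From mathcomp Require Import all_classical all_reals all_analysis.
From mathcomp Require Import measurable_realfun.
From mathcomp Require Import ring lra.

Set Implicit Arguments.
Unset Strict Implicit.
Unset Printing Implicit Defensive.

Import Order.TTheory GRing.Theory Num.Theory.
Import numFieldNormedType.Exports.

Local Open Scope classical_set_scope.
Local Open Scope ring_scope.

(** * Real integrals *)

(** The two sides are written with different special functions: [screw] has digamma(1/4) and Lerch
    series, the functional has log 4 pi, the Euler constant and the term 2 e^(-x/2) f(0). Both come
    from expanding the kernel into the terms e^(-2 (n + 1/4) b). Replacing e^(-b/2) f(0) by f(0) in
    the functional, which leaves an energy, costs an integral equal to (psi(1/2) - psi(1/4)) / 2,
    and psi(1/2) is explicit. As digamma is Gamma' / Gamma, its series has to be derived from the
    integral first. Near 0 the kernel behaves like 1 / (2 b). Functions of H^1_0, being Hoelder of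
    exponent 1/2, therefore have finite energy, and B_a v is bounded. The projection P_a changes G u
    by a constant on the interval, invisible when tested against derivatives. All kernels are real,
    so the analysis is done for real functions and carried to real and imaginary parts. Elements of
    L^2(-a,a) vanish only almost everywhere off the interval; [cut] provides representatives
    vanishing everywhere there, for which the sum over prime powers stops at any N >= e^(2a). *)

Section RealIntegral.
Context {R : realType}.
Local Notation mu := (@lebesgue_measure R).
Implicit Types f g h : R -> R.

(** A divergent integral gets the value 0, so the linearity rules below carry integrability
    hypotheses. Integrals over a set become integrals over the line with an indicator factor, so
    that this one notion serves everywhere. *)
Definition int f : R := \int[mu]_x f x.
Definition intg f : Prop := mu.-integrable setT (EFin \o f).

Lemma intg_mes f : intg f -> measurable_fun setT f.
Proof. by case/integrableP => /measurable_EFinP. Qed.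

Lemma int_EFin f : intg f -> (int f)%:E = (\int[mu]_x (f x)%:E)%E.
Proof. by move=> fi; rewrite fineK//; exact: integrable_fin_num. Qed.

Lemma intg_lty f : measurable_fun setT f -> (forall x, 0 <= f x) ->
  (\int[mu]_x (f x)%:E < +oo)%E <-> intg f.
Proof.
move=> mf f0; split=> [foo|/integrableP[_]].
  apply/integrableP; split; first exact/measurable_EFinP.
  by under eq_integral do rewrite /= ger0_norm//.
by under eq_integral do rewrite /= ger0_norm//.
Qed.

Lemma eq_intg f g : f =1 g -> intg f -> intg g.
Proof. by move=> /funext ->. Qed.

Lemma eq_int f g : f =1 g -> int f = int g.
Proof. by move=> /funext ->. Qed.

Lemma intg0 : intg (fun=> 0).
Proof. exact: integrable0. Qed.

Lemma intgD f g : intg f -> intg g -> intg (fun x => f x + g x).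
Proof. by move=> fi gi; exact: (@integrableD _ _ _ mu setT measurableT _ _ fi gi). Qed.

Lemma intgB f g : intg f -> intg g -> intg (fun x => f x - g x).
Proof. by move=> fi gi; exact: (@integrableB _ _ _ mu setT measurableT _ _ fi gi). Qed.

Lemma intgN f : intg f -> intg (fun x => - f x).
Proof. by move=> fi; exact: (@integrableN _ _ _ mu setT _ fi). Qed.

Lemma intgZ c f : intg f -> intg (fun x => c * f x).
Proof. by move=> fi; exact: (@integrableZl _ _ _ mu setT measurableT c _ fi). Qed.

Lemma intg_norm f : intg f -> intg (fun x => `|f x|).
Proof. exact: integrable_norm. Qed.

Lemma intg_dom f g : measurable_fun setT f -> (forall x, `|f x| <= g x) ->
  intg g -> intg f.
Proof.
move=> mf fg; apply: le_integrable => //; first exact/measurable_EFinP.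
by move=> x _ /=; rewrite lee_fin (le_trans (fg x))// ler_norm.
Qed.

Lemma intg_sum (I : Type) (s : seq I) (P : pred I) (F : I -> R -> R) :
  (forall i, P i -> intg (F i)) -> intg (fun x => \sum_(i <- s | P i) F i x).
Proof.
move=> Fi; elim: s => [|i s IH].
  by apply: eq_intg intg0 => x; rewrite big_nil.
have [Pi|Pi] := boolP (P i).
  by apply: eq_intg (intgD (Fi i Pi) IH) => x; rewrite big_cons Pi.
by apply: eq_intg IH => x; rewrite big_cons (negbTE Pi).
Qed.

Lemma int0 : int (fun=> 0) = 0.
Proof. by rewrite /int Rintegral_cst// mul0r. Qed.

Lemma intD f g : intg f -> intg g -> int (fun x => f x + g x) = int f + int g.
Proof. exact: RintegralD. Qed.

Lemma intB f g : intg f -> intg g -> int (fun x => f x - g x) = int f - int g.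
Proof. exact: RintegralB. Qed.

Lemma intZ c f : intg f -> int (fun x => c * f x) = c * int f.
Proof. by move=> fi; apply: RintegralZl. Qed.

Lemma intN f : intg f -> int (fun x => - f x) = - int f.
Proof.
by move=> fi; rewrite -mulN1r -intZ//; apply: eq_int => x; rewrite mulN1r.
Qed.

Lemma int_sum (I : Type) (s : seq I) (P : pred I) (F : I -> R -> R) :
  (forall i, P i -> intg (F i)) ->
  int (fun x => \sum_(i <- s | P i) F i x) = \sum_(i <- s | P i) int (F i).
Proof.
move=> Fi; elim: s => [|i s IH].
  by rewrite big_nil -[RHS]int0; apply: eq_int => x; rewrite big_nil.
rewrite big_cons; case: ifPn => Pi; last first.
  by rewrite -IH; apply: eq_int => x; rewrite big_cons (negbTE Pi).
rewrite -IH -intD//; [|exact: Fi|exact: intg_sum].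
by apply: eq_int => x; rewrite big_cons Pi.
Qed.

Lemma int_ge0 f : (forall x, 0 <= f x) -> 0 <= int f.
Proof. by move=> f0; apply: Rintegral_ge0. Qed.

Lemma int_le f g : intg f -> intg g -> (forall x, f x <= g x) -> int f <= int g.
Proof. by move=> fi gi fg; apply: le_Rintegral. Qed.

Lemma int_norm f : intg f -> `|int f| <= int (fun x => `|f x|).
Proof. by move=> fi; apply: le_normr_Rintegral. Qed.

Lemma intg_setT (D : set R) f : measurable D ->
  mu.-integrable D (EFin \o f) <-> intg (fun x => \1_D x * f x).
Proof.
move=> mD; rewrite integrable_mkcond// /intg.
suff -> : ((EFin \o f) \_ D) = (EFin \o (fun x => \1_D x * f x)) by [].
apply/funext => x; rewrite /patch /= indicE.
by case: (x \in D); rewrite ?mul1r ?mul0r.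
Qed.

Lemma Rintegral_setT (D : set R) f :
  \int[mu]_(x in D) f x = int (fun x => \1_D x * f x).
Proof.
rewrite Rintegral_mkcond; apply: eq_int => x; rewrite /patch indicE.
by case: (x \in D); rewrite ?mul1r ?mul0r.
Qed.

Lemma mes_indicM (D : set R) f : measurable D ->
  measurable_fun setT f -> measurable_fun setT (fun x => \1_D x * f x).
Proof. by move=> mD mf; apply: measurable_funM => //; exact: measurable_indic. Qed.

Lemma cvg_EFinW (u : nat -> R) (l : R) :
  u n @[n --> \oo] --> l -> (u n)%:E @[n --> \oo] --> l%:E.
Proof. by move=> ul; apply/fine_cvgP; split => //; exact: nearW. Qed.

Lemma dct (F : nat -> R -> R) f g :
  (forall n, measurable_fun setT (F n)) -> (forall x, F n x @[n --> \oo] --> f x) ->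
  (forall n x, `|F n x| <= g x) -> intg g ->
  [/\ intg f, int (F n) @[n --> \oo] --> int f &
      int (fun x => `|F n x - f x|) @[n --> \oo] --> 0].
Proof.
move=> mF Ff Fg gi.
have mf : measurable_fun setT f by apply: (@measurable_fun_cvg _ _ _ _ F f mF) => x _; exact: Ff.
have := @dominated_convergence _ _ R mu setT measurableT
  (fun n x => (F n x)%:E) (EFin \o f) (EFin \o g).
case=> //.
- by move=> n; apply/measurable_EFinP; exact: mF.
- exact/measurable_EFinP.
- by apply: aeW => x _; exact: cvg_EFinW.
- by apply: aeW => x n _; rewrite lee_fin.
move=> fi h1 h2; split => //.
  have {}h2 : (\int[mu]_x (F n x)%:E)%E @[n --> \oo] --> (int f)%:E.
    by rewrite int_EFin.
  exact: (fine_cvg h2).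
exact: (fine_cvg h1).
Qed.

(** Fatou's lemma with the lower limit replaced by the limit of a convergent majorant [c].
    Integrability of the limit is part of the conclusion: this is how an L^2 limit is shown to have
    finite energy. *)
Lemma fatou_le (F : nat -> R -> R) f (c : nat -> R) l :
  (forall n, intg (F n)) -> (forall n x, 0 <= F n x) ->
  (forall x, F n x @[n --> \oo] --> f x) ->
  (forall n, int (F n) <= c n) -> c n @[n --> \oo] --> l ->
  intg f /\ int f <= l.
Proof.
move=> Fi F0 Ff Fc cl.
have mF n : measurable_fun setT (F n) by exact: intg_mes.
have mf : measurable_fun setT f by apply: (@measurable_fun_cvg _ _ _ _ F f mF) => x _; exact: Ff.
have f0 x : 0 <= f x.
  by rewrite -(cvg_lim _ (Ff x))//; apply: limr_ge; [exact: cvgP (Ff x)|exact: nearW].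
have := @fatou _ _ R mu setT measurableT (fun n x => (F n x)%:E)
  (fun n => (measurable_EFinP _ _).2 (mF n)) _.
have -> : (\int[mu]_x limn_einf (fun n => (F n x)%:E) = \int[mu]_x (f x)%:E)%E.
  apply: eq_integral => x _; apply: (cvg_limn_einf_sup _).1.
  by exact: cvg_EFinW.
move=> /(_ _)/wrap[].
  by move=> n x _; rewrite lee_fin.
have -> : (fun n => \int[mu]_x (F n x)%:E)%E = EFin \o (fun n => int (F n)).
  by apply/funext => n /=; rewrite -int_EFin.
move=> h.
have {h} h : (\int[mu]_x (f x)%:E <= l%:E)%E.
  apply: (le_trans h).
  have cl' : (EFin \o c) n @[n --> \oo] --> l%:E.
    by exact: cvg_EFinW.
  (* The bound l is the lower limit of [c]; the two lower limits are compared through the infima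
     over tails. *)
  have [<- _] := cvg_limn_einf_sup cl'.
  rewrite !limn_einf_lim; apply: lee_lim; [exact: is_cvg_einfs..|].
  apply: nearW => n; apply: le_ereal_inf_tmp => _ [m /= nm <-].
  apply: le_trans (_ : (int (F m))%:E <= _)%E; last by rewrite lee_fin.
  by apply: ereal_inf_lbound; exists m.
have fi : intg f by apply/(intg_lty mf f0); apply: le_lt_trans h _; rewrite ltry.
by split=> //; rewrite -lee_fin int_EFin.
Qed.

End RealIntegral.

(** * Affine changes of variables *)

Section Affine.
Context {R : realType}.
Local Notation mu := (@lebesgue_measure R).
Implicit Types f g : R -> R.

Lemma mes_affine (s t : R) : measurable_fun setT (fun x : R => s * x + t).
Proof. by apply: measurable_funD => //; apply: measurable_funM. Qed.

Lemma mes_comp_affine (s t : R) f : measurable_fun setT f ->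
  measurable_fun setT (fun x => f (s * x + t)).
Proof. by move=> mf; exact: (measurableT_comp mf (mes_affine s t)). Qed.

(** Uniqueness of Lebesgue measure: |s| times the pushforward gives every interval ]a, b] its
    length. For s < 0 the preimage is closed at the other end, which has no effect on the length. *)
Lemma lebesgue_measure_affine (s t : R) (s0 : 0 < `|s|) (A : set R) : measurable A ->
  pushforward mu ((fun x : R => s * x + t) : _ -> measurableTypeR R) A =
  ((`|s|^-1)%:E * mu A)%E.
Proof.
move=> mA.
have sn : 0 <= `|s| by [].
pose g : measurableTypeR R -> measurableTypeR R := fun x => s * x + t.
have mg : measurable_fun setT g by exact: mes_affine.
pose nu := mscale (NngNum sn) (pushforward mu g).
have -> : mu A = nu mg A.
  apply: lebesgue_measure_unique => //= _ [[a b]] _ <-.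
  rewrite /nu /mscale/= /pushforward.
  have [s1|s1|s1] := ltgtP s 0; last by rewrite s1 normr0 ltxx in s0.
    have -> : g @^-1` `]a, b] = `[(b - t) / s, (a - t) / s[%classic.
      apply/seteqP; split => x /=; rewrite !in_itv/= /g.
        by move=> /andP[h1 h2]; rewrite ler_ndivrMr// ltr_ndivlMr//; apply/andP; split; lra.
      rewrite ler_ndivrMr// ltr_ndivlMr// => /andP[h1 h2]; apply/andP; split; lra.
    rewrite !lebesgue_measure_itv/= !lte_fin ltr_nM2r ?invr_lt0// ltrD2r.
    case: ifPn => _; last by rewrite mule0.
    rewrite -!EFinB -EFinM; congr EFin; rewrite ltr0_norm//.
    by field; rewrite lt_eqF.
  have -> : g @^-1` `]a, b] = `](a - t) / s, (b - t) / s]%classic.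
    apply/seteqP; split => x /=; rewrite !in_itv/= /g.
      by move=> /andP[h1 h2]; rewrite ltr_pdivrMr// ler_pdivlMr//; apply/andP; split; lra.
    rewrite ltr_pdivrMr// ler_pdivlMr// => /andP[h1 h2]; apply/andP; split; lra.
  rewrite !lebesgue_measure_itv/= !lte_fin ltr_pM2r ?invr_gt0// ltrD2r.
  case: ifPn => _; last by rewrite mule0.
  rewrite -!EFinB -EFinM; congr EFin; rewrite gtr0_norm//.
  by field; rewrite gt_eqF.
by rewrite /nu /mscale/= muleA -EFinM mulVf ?mul1e// gt_eqF.
Qed.

Lemma ge0_integral_affine (s t : R) f : s != 0 -> measurable_fun setT f ->
  (forall x, 0 <= f x) ->
  (\int[mu]_x (f (s * x + t))%:E = (`|s|^-1)%:E * \int[mu]_x (f x)%:E)%E.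
Proof.
move=> s0 mf f0; have sp : 0 < `|s| by rewrite normr_gt0.
have sn : 0 <= `|s|^-1 by rewrite invr_ge0.
pose g : measurableTypeR R -> measurableTypeR R := fun x => s * x + t.
have mg : measurable_fun setT g by exact: mes_affine.
transitivity (\int[pushforward mu g]_x (f x)%:E)%E.
  rewrite (@ge0_integral_pushforward _ _ _ _ _ g mg mu setT (EFin \o f))//.
    exact/measurable_EFinP.
  by move=> x _ /=; rewrite lee_fin.
transitivity (\int[mscale (NngNum sn) mu]_x (f x)%:E)%E.
  by apply: eq_measure_integral => A mA _; exact: lebesgue_measure_affine.
rewrite ge0_integral_mscale//; first exact/measurable_EFinP.
by move=> x _; rewrite lee_fin.
Qed.

Lemma intg_affine (s t : R) f : s != 0 -> intg f -> intg (fun x => f (s * x + t)).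
Proof.
move=> s0 fi; have mf := intg_mes fi.
apply/integrableP; split; first by apply/measurable_EFinP; exact: mes_comp_affine.
rewrite (@ge0_integral_affine s t (fun x => `|f x|))//; last exact: measurableT_comp.
by case/integrableP : fi => _ foo; rewrite lte_mul_pinfty// lee_fin.
Qed.

Lemma ge0_int_affine (s t : R) f : s != 0 -> measurable_fun setT f ->
  (forall x, 0 <= f x) -> int (fun x => f (s * x + t)) = `|s|^-1 * int f.
Proof.
move=> s0 mf f0; rewrite {1}/int /Rintegral ge0_integral_affine//.
have [fi|fi] := pselect (intg f); first by rewrite fineM//= -int_EFin.
rewrite /int /Rintegral.
have : (0 <= \int[mu]_x (f x)%:E)%E by apply: integral_ge0 => x _; rewrite lee_fin.
(* Without integrability both sides are 0: a positive multiple of +oo is +oo, and its finite part is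
   0. *)
move: fi; rewrite -intg_lty//; case: (\int[mu]_x _)%E => [r|_ _|] //=.
by rewrite gt0_muley/= ?mulr0// lte_fin invr_gt0 normr_gt0.
Qed.

Lemma int_posneg f : intg f ->
  int f = int (fun x => Num.max (f x) 0) - int (fun x => Num.max (- f x) 0).
Proof.
move=> fi; have mf := intg_mes fi.
have maxi g : intg g -> intg (fun x => Num.max (g x) 0).
  move=> gi; apply: intg_dom (intg_norm gi).
    by apply: measurable_maxr => //; exact: intg_mes.
  by move=> x; rewrite ger0_norm ?le_max ?lexx ?orbT// ge_max ler_norm/=.
rewrite -intB; [|exact: maxi|exact/maxi/intgN].
apply: eq_int => x; rewrite /Num.max; case: ifPn; case: ifPn; lra.
Qed.

Lemma int_affine (s t : R) f : s != 0 -> intg f ->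
  int (fun x => f (s * x + t)) = `|s|^-1 * int f.
Proof.
move=> s0 fi; have mf := intg_mes fi.
rewrite int_posneg; last exact: intg_affine.
rewrite (@ge0_int_affine s t (fun x => Num.max (f x) 0))//; last 2 first.
- exact: measurable_maxr.
- by move=> x; rewrite le_max lexx orbT.
rewrite (@ge0_int_affine s t (fun x => Num.max (- f x) 0))//; last 2 first.
- by apply: measurable_maxr => //; exact: measurableT_comp.
- by move=> x; rewrite le_max lexx orbT.
by rewrite -mulrBr -int_posneg.
Qed.

Lemma intg_shift (t : R) f : intg f -> intg (fun x => f (x + t)).
Proof. by move=> /(intg_affine t (oner_neq0 _)); apply: eq_intg => x; rewrite mul1r. Qed.

Lemma int_shift (t : R) f : intg f -> int (fun x => f (x + t)) = int f.
Proof.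
move=> fi; have := int_affine t (oner_neq0 _) fi.
by rewrite normr1 invr1 mul1r => <-; apply: eq_int => x; rewrite mul1r.
Qed.

Lemma intg_refl (t : R) f : intg f -> intg (fun x => f (t - x)).
Proof.
have n0 : (-1 : R) != 0 by rewrite oppr_eq0 oner_neq0.
by move=> /(intg_affine t n0); apply: eq_intg => x; rewrite mulN1r addrC.
Qed.

Lemma int_refl (t : R) f : intg f -> int (fun x => f (t - x)) = int f.
Proof.
have n0 : (-1 : R) != 0 by rewrite oppr_eq0 oner_neq0.
move=> fi; have := int_affine t n0 fi.
by rewrite normrN1 invr1 mul1r => <-; apply: eq_int => x; rewrite mulN1r addrC.
Qed.

End Affine.

(** * Product integrability and Fubini's theorem *)

Section RealFubini.
Context {R : realType}.
Local Notation mu := (@lebesgue_measure R).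
Implicit Types F : R * R -> R.

Definition intg2 F : Prop :=
  (mu \x mu)%E.-integrable setT (EFin \o F).

Lemma intg2_mes F : intg2 F -> measurable_fun setT F.
Proof. by case/integrableP => /measurable_EFinP. Qed.

Lemma mes_fst F : measurable_fun setT F -> forall x, measurable_fun setT (fun y => F (x, y)).
Proof. by move=> mF x; exact: measurableT_comp. Qed.

Lemma mes_snd F : measurable_fun setT F -> forall y, measurable_fun setT (fun x => F (x, y)).
Proof. by move=> mF y; exact: measurableT_comp. Qed.

Lemma mes_int F : measurable_fun setT F ->
  measurable_fun setT (fun x => int (fun y => F (x, y))).
Proof.
move=> mF; apply: (measurableT_comp (@fine_measurable R setT measurableT)).
have -> : (fun x => \int[mu]_y (F (x, y))%:E)%E =
  (fun x => \int[mu]_y (EFin \o F)^\+ (x, y) - \int[mu]_y (EFin \o F)^\- (x, y))%E.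
  apply/funext => x; rewrite integralE; by congr (_ - _)%E; apply: eq_integral => y _; rewrite ?funeposE ?funenegE.
have mE : measurable_fun setT (EFin \o F) by exact/measurable_EFinP.
apply: emeasurable_funB.
  apply: (@measurable_fun_fubini_tonelli_F _ _ _ _ _ mu (EFin \o F)^\+%E) => //.
  exact: measurable_funepos.
apply: (@measurable_fun_fubini_tonelli_F _ _ _ _ _ mu (EFin \o F)^\-%E) => //.
exact: measurable_funeneg.
Qed.

(** Tonelli: the iterated integral of |F| is finite because the inner one is dominated by [g]. *)
Lemma intg2_le F (g : R -> R) : measurable_fun setT F ->
  (forall x, intg (fun y => F (x, y))) ->
  (forall x, int (fun y => `|F (x, y)|) <= g x) -> intg g -> intg2 F.
Proof.
move=> mF Fi Fg gi; apply/integrable12ltyP; first exact/measurable_EFinP.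
have -> : (\int[mu]_x \int[mu]_y `|(EFin \o F) (x, y)| =
    \int[mu]_x (int (fun y => `|F (x, y)|))%:E)%E.
  by apply: eq_integral => x _; rewrite int_EFin//; exact: intg_norm.
have hg : forall x, 0 <= int (fun y => `|F (x, y)|) by move=> x; apply: int_ge0.
have mh : measurable_fun setT (fun x => int (fun y => `|F (x, y)|)).
  by apply: (@mes_int (fun z => `|F z|)); exact: measurableT_comp.
apply/intg_lty => //; apply: intg_dom gi => // x.
by rewrite ger0_norm.
Qed.

Lemma intg2_ge0 F : measurable_fun setT F -> (forall z, 0 <= F z) ->
  (forall x, intg (fun y => F (x, y))) ->
  intg (fun x => int (fun y => F (x, y))) -> intg2 F.
Proof.
move=> mF F0 Fi Gi; apply: intg2_le Gi => // x.
by under eq_int do rewrite ger0_norm//.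
Qed.

Lemma intg2_dom F G : measurable_fun setT F -> (forall z, `|F z| <= G z) ->
  intg2 G -> intg2 F.
Proof.
move=> mf fg; apply: le_integrable => //; first exact/measurable_EFinP.
by move=> x _ /=; rewrite lee_fin (le_trans (fg x))// ler_norm.
Qed.

Lemma intg2_prod (f g : R -> R) : intg f -> intg g -> intg2 (fun z => f z.1 * g z.2).
Proof.
move=> fi gi; have mf := intg_mes fi; have mg := intg_mes gi.
apply: (@intg2_le _ (fun x => `|f x| * int (fun y => `|g y|))).
- by apply: measurable_funM; exact: measurableT_comp.
- by move=> x /=; exact: intgZ.
- move=> x /=; rewrite -intZ; last exact: intg_norm.
  by under eq_int do rewrite normrM.
- by apply: eq_intg (intgZ (int (fun y => `|g y|)) (intg_norm fi)) => x; rewrite mulrC.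
Qed.

Lemma ae_eq_integrable (f g : R -> \bar R) : measurable_fun setT f ->
  ae_eq mu setT f g -> mu.-integrable setT g -> mu.-integrable setT f.
Proof.
move=> mf fg /integrableP[mg goo]; apply/integrableP; split => //.
rewrite (_ : \int[mu]_x `|f x| = \int[mu]_x `|g x|)%E//.
apply: ae_eq_integral => //; [exact: measurableT_comp..|].
by apply: filterS fg => x fgx _ /=; rewrite fgx.
Qed.

(* On a null set the inner integrals may diverge; [int] is then the junk value 0. *)
Lemma fubini F : intg2 F -> 
  [/\ intg (fun x => int (fun y => F (x, y))), intg (fun y => int (fun x => F (x, y))) &
   int (fun x => int (fun y => F (x, y))) = int (fun y => int (fun x => F (x, y)))].
Proof.
move=> Fi; have mF := intg2_mes Fi.
have i1 := integrable_fubini_F Fi.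
have aeq1 : ae_eq mu setT (fun x => (int (fun y => F (x, y)))%:E)
    (fun x => \int[mu]_y (EFin \o F) (x, y))%E.
  apply: filterS (ae_integrable1 Fi) => x Fx _.
  by rewrite int_EFin.
have aeq2 : ae_eq mu setT (fun y => (int (fun x => F (x, y)))%:E)
    (fun y => \int[mu]_x (EFin \o F) (x, y))%E.
  apply: filterS (ae_integrable2 Fi) => x Fx _.
  by rewrite int_EFin.
have m1 : measurable_fun setT (fun x => (int (fun y => F (x, y)))%:E).
  by apply/measurable_EFinP; exact: mes_int.
have m2 : measurable_fun setT (fun y => (int (fun x => F (x, y)))%:E).
  apply/measurable_EFinP; apply: (@mes_int (fun z => F (z.2, z.1))).
  exact: (measurableT_comp mF (measurable_fun_pair measurable_snd measurable_fst)).
have mi2 : measurable_fun setT (fun y => \int[mu]_x (EFin \o F) (x, y))%E.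
  exact: measurable_fubini_G Fi.
have i2 : mu.-integrable setT (fun y => \int[mu]_x (EFin \o F) (x, y))%E.
  apply/integrableP; split => //.
  have /integrable21ltyP h := measurable_int _ Fi.
  move/h : Fi; apply: le_lt_trans; apply: ge0_le_integral => //.
  - exact: measurableT_comp.
  - apply: (@measurable_fun_fubini_tonelli_G _ _ _ _ _ mu (fun z => `|(EFin \o F) z|%E)) => //.
    by apply: measurableT_comp => //; exact/measurable_EFinP.
  - by move=> y _; apply: le_abse_integral => //; apply/measurable_EFinP; exact: mes_snd.
have e1 : (\int[mu]_x (int (fun y => F (x, y)))%:E =
    \int[mu]_x \int[mu]_y (EFin \o F) (x, y))%E.
  apply: ae_eq_integral => //; exact: measurable_int i1.
have e2 : (\int[mu]_y (int (fun x => F (x, y)))%:E =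
    \int[mu]_y \int[mu]_x (EFin \o F) (x, y))%E.
  by apply: ae_eq_integral.
split.
- exact: ae_eq_integrable aeq1 i1.
- exact: ae_eq_integrable aeq2 i2.
- by rewrite /int /Rintegral e1 e2 Fubini.
Qed.

End RealFubini.

(** * Square-integrable functions and their correlations *)

Section RealL2.
Context {R : realType}.
Local Notation mu := (@lebesgue_measure R).
Implicit Types u v w : R -> R.

Definition L2r v : Prop := measurable_fun setT v /\ intg (fun x => v x ^+ 2).
Definition ip v w : R := int (fun x => v x * w x).
Definition nr v : R := int (fun x => v x ^+ 2).

Lemma nr_ip v : nr v = ip v v.
Proof. by apply: eq_int => x; rewrite expr2. Qed.

Lemma nr_ge0 v : 0 <= nr v.
Proof. by apply: int_ge0 => x; rewrite sqr_ge0. Qed.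

Lemma intg_ip v w : L2r v -> L2r w -> intg (fun x => v x * w x).
Proof.
move=> [mv v2] [mw w2]; apply: intg_dom (intgD v2 w2).
  exact: measurable_funM.
by move=> x; rewrite ler_norml; have := sqr_ge0 (v x + w x);
  have := sqr_ge0 (v x - w x); have := sqr_ge0 (v x); have := sqr_ge0 (w x);
  rewrite !expr2 => h1 h2 h3 h4; apply/andP; split; nra.
Qed.

Lemma ipC v w : ip v w = ip w v.
Proof. by apply: eq_int => x; rewrite mulrC. Qed.

Lemma L2r_dom v w : measurable_fun setT v -> (forall x, `|v x| <= `|w x|) ->
  L2r w -> L2r v.
Proof.
move=> mv vw [mw w2]; split => //; apply: intg_dom w2.
  exact: measurable_funX.
by move=> x; rewrite normrX -[w x ^+ 2]real_normK ?num_real// lerXn2r ?nnegrE.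
Qed.

Lemma L2r0 : L2r (fun=> 0).
Proof. by split=> //; apply: eq_intg intg0 => x; rewrite expr0n. Qed.

Lemma L2rD v w : L2r v -> L2r w -> L2r (fun x => v x + w x).
Proof.
move=> vL wL; have vw := intg_ip vL wL; case: vL wL => mv v2 [mw w2].
split; first exact: measurable_funD.
by apply: eq_intg (intgD (intgD v2 w2) (intgZ 2 vw)) => x; ring.
Qed.

Lemma L2rZ c v : L2r v -> L2r (fun x => c * v x).
Proof.
move=> [mv v2]; split; first exact: measurable_funM.
by apply: eq_intg (intgZ (c ^+ 2) v2) => x; ring.
Qed.

Lemma L2rN v : L2r v -> L2r (fun x => - v x).
Proof. by move=> /(L2rZ (-1)); congr L2r; apply/funext => x; rewrite mulN1r. Qed.

Lemma L2rB v w : L2r v -> L2r w -> L2r (fun x => v x - w x).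
Proof. by move=> vL /L2rN wL; exact: L2rD. Qed.

Lemma L2r_affine s t v : s != 0 -> L2r v -> L2r (fun x => v (s * x + t)).
Proof.
move=> s0 [mv v2]; split; first exact: mes_comp_affine.
exact: (intg_affine t s0 v2).
Qed.

Lemma L2r_shift t v : L2r v -> L2r (fun x => v (x + t)).
Proof.
move=> /(L2r_affine t (oner_neq0 _)); congr L2r; apply/funext => x.
by rewrite mul1r.
Qed.

Lemma L2r_refl t v : L2r v -> L2r (fun x => v (t - x)).
Proof.
have n0 : (-1 : R) != 0 by rewrite oppr_eq0 oner_neq0.
move=> /(L2r_affine t n0); congr L2r; apply/funext => x.
by rewrite mulN1r addrC.
Qed.

Lemma ipDl u v w : L2r u -> L2r v -> L2r w ->
  ip (fun x => u x + v x) w = ip u w + ip v w.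
Proof.
move=> uL vL wL; rewrite /ip -intD ?intg_ip//; try exact: intg_ip.
by apply: eq_int => x; ring.
Qed.

Lemma ipZl c v w : L2r v -> L2r w -> ip (fun x => c * v x) w = c * ip v w.
Proof.
move=> vL wL; rewrite /ip -intZ; last exact: intg_ip.
by apply: eq_int => x; ring.
Qed.

Lemma ipNl v w : L2r v -> L2r w -> ip (fun x => - v x) w = - ip v w.
Proof.
move=> vL wL; rewrite /ip -intN; last exact: intg_ip.
by apply: eq_int => x; ring.
Qed.

Lemma ipBl u v w : L2r u -> L2r v -> L2r w ->
  ip (fun x => u x - v x) w = ip u w - ip v w.
Proof. by move=> uL vL wL; rewrite ipDl ?ipNl//; exact: L2rN. Qed.

Lemma ipDr u v w : L2r u -> L2r v -> L2r w ->
  ip w (fun x => u x + v x) = ip w u + ip w v.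
Proof. by move=> *; rewrite !(ipC w) ipDl. Qed.

Lemma ipBr u v w : L2r u -> L2r v -> L2r w ->
  ip w (fun x => u x - v x) = ip w u - ip w v.
Proof. by move=> *; rewrite !(ipC w) ipBl. Qed.

Lemma ipZr c v w : L2r v -> L2r w -> ip w (fun x => c * v x) = c * ip w v.
Proof. by move=> *; rewrite !(ipC w) ipZl. Qed.

Lemma nrD v w : L2r v -> L2r w ->
  nr (fun x => v x + w x) = nr v + nr w + 2 * ip v w.
Proof.
move=> vL wL; rewrite !nr_ip ipDl ?ipDr//; try exact: L2rD.
by rewrite (ipC w v); ring.
Qed.

Lemma nrB v w : L2r v -> L2r w ->
  nr (fun x => v x - w x) = nr v + nr w - 2 * ip v w.
Proof.
move=> vL wL; rewrite !nr_ip ipBl ?ipBr//; try exact: L2rB.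
by rewrite (ipC w v); ring.
Qed.

Lemma nrZ c v : L2r v -> nr (fun x => c * v x) = c ^+ 2 * nr v.
Proof. by move=> vL; rewrite !nr_ip ipZl ?ipZr//; [ring|exact: L2rZ]. Qed.

Lemma ip_sqr_le v w : L2r v -> L2r w -> ip v w ^+ 2 <= nr v * nr w.
Proof.
move=> vL wL.
have h t : 0 <= nr v + t ^+ 2 * nr w - 2 * (t * ip v w).
  rewrite -nrZ// -ipZr// -nrB//; [exact: nr_ge0|exact: L2rZ].
have [w0|w0] := eqVneq (nr w) 0.
  rewrite w0 mulr0 leNgt; apply/negP => ip0.
  (* With [nr w] = 0 the quadratic in t is affine, and this t would give it the value -1. *)
  have := h ((nr v + 1) / 2 / ip v w); rewrite w0 mulr0 addr0.
  rewrite divfK; last by apply/eqP => e; rewrite e expr0n/= ltxx in ip0.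
  have := nr_ge0 v; lra.
have wp : 0 < nr w by rewrite lt_neqAle eq_sym w0 nr_ge0.
have := h (ip v w / nr w); rewrite -(pmulr_lge0 _ wp) => {}h.
rewrite -subr_ge0; apply: le_trans h _; rewrite le_eqVlt; apply/orP; left.
by apply/eqP; field.
Qed.

Lemma ip_le v w : L2r v -> L2r w ->
  `|ip v w| <= Num.sqrt (nr v) * Num.sqrt (nr w).
Proof.
move=> vL wL; rewrite -sqrtrM ?nr_ge0// -sqrtr_sqr.
by rewrite ler_wsqrtr// ip_sqr_le.
Qed.

(** Parallelogram law. As [nr] is the squared norm, this stands in for the triangle inequality,
    whence the factors 2 in all later estimates through an intermediate function. *)
Lemma nrD_le v w : L2r v -> L2r w ->
  nr (fun x => v x + w x) <= 2 * nr v + 2 * nr w.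
Proof. by move=> vL wL; have := nr_ge0 (fun x => v x - w x); rewrite nrB// nrD//; lra. Qed.

Lemma nrB_le v w : L2r v -> L2r w ->
  nr (fun x => v x - w x) <= 2 * nr v + 2 * nr w.
Proof. by move=> vL wL; have := nr_ge0 (fun x => v x + w x); rewrite nrB// nrD//; lra. Qed.

Lemma nr_subC v w : nr (fun x => v x - w x) = nr (fun x => w x - v x).
Proof. by apply: eq_int => x; ring. Qed.

Lemma nr_tri u v w : L2r u -> L2r v -> L2r w ->
  nr (fun x => u x - w x) <= 2 * nr (fun x => u x - v x) + 2 * nr (fun x => v x - w x).
Proof.
move=> uL vL wL; have := nrD_le (L2rB uL vL) (L2rB vL wL).
by congr (_ <= _); apply: eq_int => x; ring.
Qed.

Lemma nr0_ip v w : L2r v -> L2r w -> nr v = 0 -> ip v w = 0.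
Proof.
move=> vL wL v0; apply/eqP; rewrite -normr_le0; apply: le_trans (ip_le vL wL) _.
by rewrite v0 sqrtr0 mul0r.
Qed.

Lemma ip_shift t v w : L2r v -> L2r w ->
  ip (fun x => v (x + t)) (fun x => w (x + t)) = ip v w.
Proof. by move=> vL wL; apply: (@int_shift _ t (fun x => v x * w x)); exact: intg_ip. Qed.

Lemma nr_shift t v : L2r v -> nr (fun x => v (x + t)) = nr v.
Proof. by move=> vL; rewrite !nr_ip ip_shift. Qed.

Lemma sqrt_cvg0 (e : nat -> R) :
  e n @[n --> \oo] --> 0 -> Num.sqrt (e n) @[n --> \oo] --> 0.
Proof.
by move=> e0; rewrite -sqrtr0; apply: continuous_cvg e0; exact: sqrt_continuous.
Qed.

Lemma ip_cvg (u v : nat -> R -> R) u0 v0 :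
  (forall n, L2r (u n)) -> (forall n, L2r (v n)) -> L2r u0 -> L2r v0 ->
  nr (fun x => u n x - u0 x) @[n --> \oo] --> 0 ->
  nr (fun x => v n x - v0 x) @[n --> \oo] --> 0 ->
  ip (u n) (v n) @[n --> \oo] --> ip u0 v0.
Proof.
move=> uL vL u0L v0L uc vc; apply/subr_cvg0.
pose e n := Num.sqrt (nr (fun x => u n x - u0 x)).
pose d n := Num.sqrt (nr (fun x => v n x - v0 x)).
have e0 : e n @[n --> \oo] --> 0 by exact: sqrt_cvg0.
have d0 : d n @[n --> \oo] --> 0 by exact: sqrt_cvg0.
apply: norm_cvg0.
apply: (@squeeze_cvgr _ _ _ _ (fun=> 0)
  (fun n => e n * d n + e n * Num.sqrt (nr v0) + Num.sqrt (nr u0) * d n)).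
- apply: nearW => n; rewrite normr_ge0/=.
  have -> : ip (u n) (v n) - ip u0 v0 =
    ip (fun x => u n x - u0 x) (fun x => v n x - v0 x) +
    ip (fun x => u n x - u0 x) v0 + ip u0 (fun x => v n x - v0 x).
    rewrite !(ipBl _ _, ipBr _ _)//; try exact: L2rB.
    by ring.
  apply: le_trans (ler_normD _ _) _; apply: lerD; last by apply: ip_le => //; exact: L2rB.
  apply: le_trans (ler_normD _ _) _; apply: lerD; apply: ip_le => //; exact: L2rB.
- exact: cvg_cst.
- rewrite -[X in _ --> X](_ : 0 * 0 + 0 * Num.sqrt (nr v0) + Num.sqrt (nr u0) * 0 = 0).
    apply: cvgD; first apply: cvgD.
    + exact: cvgM.
    + by apply: cvgM => //; exact: cvg_cst.
    + by apply: cvgM => //; exact: cvg_cst.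
  by ring.
Qed.

Lemma nr_cvg (u : nat -> R -> R) u0 : (forall n, L2r (u n)) -> L2r u0 ->
  nr (fun x => u n x - u0 x) @[n --> \oo] --> 0 -> nr (u n) @[n --> \oo] --> nr u0.
Proof.
move=> uL u0L uc; rewrite nr_ip; under eq_fun do rewrite nr_ip.
exact: ip_cvg.
Qed.

Lemma nr_eq0 v : L2r v -> nr v = 0 <-> {ae mu, forall x, v x = 0}.
Proof.
move=> [mv v2].
have := @ae_eq_integral_abs _ _ R mu setT measurableT (fun x => (v x ^+ 2)%:E).
have -> : (\int[mu]_x `|(v x ^+ 2)%:E| = (nr v)%:E)%E.
  rewrite int_EFin//; apply: eq_integral => x _.
  by rewrite /= ger0_norm ?sqr_ge0.
move=> /(_ _)/wrap[|h].
  by apply/measurable_EFinP; exact: measurable_funX.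
split=> [v0|av].
  have /h : (nr v)%:E = 0%E :> \bar R by rewrite v0.
  apply: filterS => x /(_ I) [/eqP]; by rewrite sqrf_eq0 => /eqP.
suff /h [] : ae_eq mu setT (fun x => (v x ^+ 2)%:E) (cst 0%E) by [].
case: av => N [mN N0 sN]; exists N; split => // x /= hx.
by apply: sN => /= vx; apply: hx => _; rewrite vx expr0n.
Qed.

(* The convolution of v with x |-> w (- x). *)
Definition rr v w (x : R) : R := int (fun y => v y * w (y - x)).

Lemma rr_ip v w x : rr v w x = ip v (fun y => w (y - x)).
Proof. by []. Qed.

Lemma rr0 v w : rr v w 0 = ip v w.
Proof. by apply: eq_int => y; rewrite subr0. Qed.

Lemma rrC v w x : L2r v -> L2r w -> rr v w (- x) = rr w v x.
Proof.
move=> vL wL; rewrite rr_ip -(ip_shift (- x)) //; last exact: L2r_shift.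
by apply: eq_int => y; rewrite mulrC; congr (w _ * v _); ring.
Qed.

Lemma rr_le v w x : L2r v -> L2r w -> `|rr v w x| <= Num.sqrt (nr v) * Num.sqrt (nr w).
Proof.
by move=> vL wL; apply: le_trans (ip_le vL (L2r_shift (- x) wL)) _; rewrite nr_shift.
Qed.

Lemma mes_sub : measurable_fun setT (fun z : R * R => z.2 - z.1).
Proof. by apply: measurable_funB; [exact: measurable_snd|exact: measurable_fst]. Qed.

Lemma mes_comp_sub w : measurable_fun setT w ->
  measurable_fun setT (fun z : R * R => w (z.2 - z.1)).
Proof. by move=> mw; exact: (measurableT_comp mw mes_sub). Qed.

Lemma mes_comp_snd w : measurable_fun setT w ->
  measurable_fun setT (fun z : R * R => w z.2).
Proof. by move=> mw; exact: measurableT_comp. Qed.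

Lemma mes_comp_fst w : measurable_fun setT w ->
  measurable_fun setT (fun z : R * R => w z.1).
Proof. by move=> mw; exact: measurableT_comp. Qed.

Lemma mes_rr v w : measurable_fun setT v -> measurable_fun setT w ->
  measurable_fun setT (rr v w).
Proof.
move=> mv mw; apply: (@mes_int _ (fun z => v z.2 * w (z.2 - z.1))).
by apply: measurable_funM; [exact: mes_comp_snd|exact: mes_comp_sub].
Qed.

Lemma rrDl u v w x : L2r u -> L2r v -> L2r w ->
  rr (fun y => u y + v y) w x = rr u w x + rr v w x.
Proof. by move=> *; rewrite !rr_ip ipDl//; exact: L2r_shift. Qed.

Lemma rrBl u v w x : L2r u -> L2r v -> L2r w ->
  rr (fun y => u y - v y) w x = rr u w x - rr v w x.
Proof. by move=> *; rewrite !rr_ip ipBl//; exact: L2r_shift. Qed.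

Lemma rrBr u v w x : L2r u -> L2r v -> L2r w ->
  rr w (fun y => u y - v y) x = rr w u x - rr w v x.
Proof. by move=> *; rewrite !rr_ip ipBr//; exact: L2r_shift. Qed.

Lemma rrZl c v w x : L2r v -> L2r w ->
  rr (fun y => c * v y) w x = c * rr v w x.
Proof. by move=> *; rewrite !rr_ip ipZl//; exact: L2r_shift. Qed.

(** Vanishing is asked at every point off the open interval; elements of L^2(-a,a) are brought to
    this form by [cut]. *)
Definition suppin a v : Prop := forall x, ~~ (`|x| < a) -> v x = 0.

Lemma rr_supp a v w x : suppin a v -> suppin a w -> 2 * a <= `|x| -> rr v w x = 0.
Proof.
move=> va wa xa; rewrite -[RHS](@int0 R); apply: eq_int => y.
have [ya|ya] := boolP (`|y| < a); last by rewrite va// mul0r.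
rewrite wa ?mulr0// -leNgt; have := ler_normB y (y - x).
by rewrite opprB addrC subrK; lra.
Qed.

(** Polarization of the squared L^2 modulus of continuity ||v - v(. - x)||^2. Integrated against
    [kker] over x > 0 it gives the archimedean energy. *)
Definition NN v w (x : R) : R :=
  ip (fun y => v y - v (y - x)) (fun y => w y - w (y - x)).

Lemma L2r_diff x v : L2r v -> L2r (fun y => v y - v (y - x)).
Proof. by move=> vL; apply: L2rB => //; exact: L2r_shift. Qed.

(** With f = [rr v w] the right side is 2 f(0) - f(x) - f(-x), the combination that the archimedean
    term of the Weil functional contains up to sign and an integrable correction. *)
Lemma NN_rr v w x : L2r v -> L2r w ->
  NN v w x = 2 * ip v w - rr v w x - rr v w (- x).
Proof.
move=> vL wL; have vs := L2r_shift (- x) vL; have ws := L2r_shift (- x) wL.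
rewrite rrC// /NN !(ipBl _ _, ipBr _ _)//; try exact: L2rB.
by rewrite ip_shift// !rr_ip (ipC w); ring.
Qed.

Lemma NN_nr v x : NN v v x = nr (fun y => v y - v (y - x)).
Proof. by rewrite nr_ip. Qed.

Lemma NN_ge0 v x : 0 <= NN v v x.
Proof. by rewrite NN_nr nr_ge0. Qed.

Lemma NN_le v x : L2r v -> NN v v x <= 4 * nr v.
Proof.
move=> vL; rewrite NN_nr; apply: le_trans (nrB_le vL (L2r_shift (- x) vL)) _.
by rewrite nr_shift//; lra.
Qed.

Lemma NNC v w x : NN v w x = NN w v x.
Proof. exact: ipC. Qed.

Lemma NN_sqr_le v w x : L2r v -> L2r w -> NN v w x ^+ 2 <= NN v v x * NN w w x.
Proof. by move=> vL wL; rewrite !NN_nr; apply: ip_sqr_le; exact: L2r_diff. Qed.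

Lemma NN_abs_le v w x : L2r v -> L2r w -> `|NN v w x| <= (NN v v x + NN w w x) / 2.
Proof.
move=> vL wL; have h := NN_sqr_le x vL wL; have h1 := NN_ge0 v x; have h2 := NN_ge0 w x.
rewrite -(@ler_pXn2r _ 2)// ?nnegrE ?divr_ge0 ?addr_ge0// -normrX ger0_norm ?sqr_ge0//.
apply: (le_trans h); have := sqr_ge0 (NN v v x - NN w w x); rewrite !expr2; lra.
Qed.

Lemma mes_NN v w : L2r v -> L2r w -> measurable_fun setT (NN v w).
Proof.
move=> vL wL; have m := mes_rr vL.1 wL.1.
rewrite (_ : NN v w = fun x => 2 * ip v w - rr v w x - rr v w (- x)); last first.
  by apply/funext => x; rewrite NN_rr.
apply: measurable_funB; first by apply: measurable_funB.
exact: measurableT_comp.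
Qed.

Lemma NNDl u v w x : L2r u -> L2r v -> L2r w ->
  NN (fun y => u y + v y) w x = NN u w x + NN v w x.
Proof. by move=> *; rewrite !NN_rr ?rrDl ?ipDl//; [ring|exact: L2rD]. Qed.

Lemma NNBl u v w x : L2r u -> L2r v -> L2r w ->
  NN (fun y => u y - v y) w x = NN u w x - NN v w x.
Proof. by move=> *; rewrite !NN_rr ?rrBl ?ipBl//; [ring|exact: L2rB]. Qed.

Lemma NNZl c v w x : L2r v -> L2r w ->
  NN (fun y => c * v y) w x = c * NN v w x.
Proof. by move=> *; rewrite !NN_rr ?rrZl ?ipZl//; [ring|exact: L2rZ]. Qed.

End RealL2.

(** * Approximation by continuous functions; continuity of dilations and translations in L^2 *)

Section Approximation.
Context {R : realType}.
Local Notation mu := (@lebesgue_measure R).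
Implicit Types u v w g : R -> R.

Lemma intg_itv (a b : R) (l r : bool) :
  intg (\1_[set` Interval (BSide l a) (BSide r b)] : R -> R).
Proof. exact: integrable_indic_itv. Qed.

Lemma int_indic_itv (a b : R) : a <= b -> int (\1_(`[a, b]%classic) : R -> R) = b - a.
Proof.
move=> ab; have h : mu (`[a, b]%classic : set R) = (b - a)%:E.
  rewrite lebesgue_measure_itv/= lte_fin.
  have [_|ba] := ltP a b; first by rewrite -EFinB.
  by have -> : a = b; [apply/eqP; rewrite eq_le ab|rewrite subrr].
rewrite /int /Rintegral (integral_indic mu measurableT (measurable_itv _)).
by rewrite -[RHS]/(fine (b - a)%:E) -h; congr (fine (mu _)); exact: setIT.
Qed.

Lemma nr_cvg0_dom (F : nat -> R -> R) (G : R -> R) :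
  (forall n, measurable_fun setT (F n)) -> (forall x, F n x @[n --> \oo] --> 0) ->
  (forall n x, F n x ^+ 2 <= G x) -> intg G -> nr (F n) @[n --> \oo] --> 0.
Proof.
move=> mF F0 FG Gi.
have [] := @dct R (fun n x => F n x ^+ 2) (fun=> 0) G _ _ _ Gi.
- by move=> n; exact: measurable_funX.
- move=> x; rewrite (_ : 0 = 0 ^+ 2 :> R); last by rewrite expr0n.
  by under eq_fun do rewrite expr2; rewrite expr2; apply: cvgM.
- by move=> n x; rewrite ger0_norm// sqr_ge0.
- by move=> _; rewrite int0.
Qed.

Definition trunc (n : nat) v (x : R) : R :=
  if (`|x| < n%:R) && (`|v x| <= n%:R) then v x else 0.

Lemma mes_trunc n v : measurable_fun setT v -> measurable_fun setT (trunc n v).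
Proof.
move=> mv; apply: measurable_fun_ifT => //.
apply: measurable_and.
  by apply: measurable_fun_ltr => //; exact: measurableT_comp.
by apply: measurable_fun_ler => //; exact: measurableT_comp.
Qed.

Lemma trunc_cvg v : L2r v -> nr (fun x => trunc n v x - v x) @[n --> \oo] --> 0.
Proof.
move=> [mv v2]; apply: (nr_cvg0_dom _ _ _ v2).
- by move=> n; apply: measurable_funB => //; exact: mes_trunc.
- move=> x; apply/subr_cvg0; apply: cvg_near_cst.
  near=> n; rewrite /trunc ifT//; apply/andP; split.
    by near: n; exact: nbhs_infty_gtr.
  by near: n; exact: nbhs_infty_ger.
- move=> n x; rewrite /trunc; case: ifPn => _; first by rewrite subrr expr0n sqr_ge0.
  by rewrite sub0r sqrrN.
Unshelve. all: by end_near. Qed.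

Definition clamp (B y : R) : R := Num.max (- B) (Num.min B y).

Lemma clamp_le B y : 0 <= B -> `|clamp B y| <= B.
Proof.
move=> B0; rewrite /clamp ler_norml le_max lexx/= ge_max ge_min lexx/= andbT.
lra.
Qed.

Lemma clamp_contr (B y z : R) : `|z| <= B -> `|z - clamp B y| <= `|z - y|.
Proof.
rewrite ler_norml /clamp /Num.max /Num.min => /andP[h1 h2].
have [h3|h3] := ltP B y; [have [h4|h4] := ltP (- B) B|have [h4|h4] := ltP (- B) y];
  have [?|?] := ger0P (z - y); rewrite ?ler_norml ?lexx//; apply/andP; split; lra.
Qed.

Definition cutoff (M x : R) : R := Num.max 0 (Num.min 1 (M + 1 - `|x|)).

Lemma cutoff_ge0 M x : 0 <= cutoff M x.
Proof. by rewrite /cutoff le_max lexx. Qed.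

Lemma cutoff_le1 M x : cutoff M x <= 1.
Proof. by rewrite /cutoff ge_max ler01 ge_min lexx. Qed.

Lemma cutoff1 M x : `|x| <= M -> cutoff M x = 1.
Proof.
by move=> xM; rewrite /cutoff min_l; [rewrite max_r|lra].
Qed.

Lemma cutoff0 M x : M + 1 <= `|x| -> cutoff M x = 0.
Proof. by move=> xM; rewrite /cutoff max_l// ge_min; apply/orP; right; lra. Qed.

Lemma continuous_maxr (f g : R -> R) : continuous f -> continuous g ->
  continuous (fun x => Num.max (f x) (g x)).
Proof.
move=> cf cg x; rewrite /continuous_at.
under eq_fun => y do rewrite maxr_absE.
rewrite maxr_absE.
apply: cvgM; [|exact: cvg_cst]; apply: cvgD; first by apply: cvgD; [exact: cf|exact: cg].
by apply: cvg_norm; apply: cvgB; [exact: cf|exact: cg].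
Qed.

Lemma continuous_minr (f g : R -> R) : continuous f -> continuous g ->
  continuous (fun x => Num.min (f x) (g x)).
Proof.
move=> cf cg x; rewrite /continuous_at.
under eq_fun => y do rewrite minr_absE.
rewrite minr_absE.
apply: cvgM; [|exact: cvg_cst]; apply: cvgD; first by apply: cvgD; [exact: cf|exact: cg].
by apply: cvgN; apply: cvg_norm; apply: cvgB; [exact: cf|exact: cg].
Qed.

Lemma continuous_cutoff M : continuous (cutoff M).
Proof.
apply: continuous_maxr; first by move=> x; exact: cvg_cst.
apply: continuous_minr; first by move=> x; exact: cvg_cst.
by move=> x; apply: cvgB; [exact: cvg_cst|exact: norm_continuous].
Qed.

Lemma continuous_clamp B (f : R -> R) : continuous f -> continuous (fun x => clamp B (f x)).
Proof.
move=> cf; apply: continuous_maxr; first by move=> x; exact: cvg_cst.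
by apply: continuous_minr => // x; exact: cvg_cst.
Qed.

(** The starting point is L^1 approximation on a bounded interval. For a truncation [u] bounded by
    N, clamping the approximant to [-N, N] turns L^1 closeness into L^2 closeness, since then (u -
    g)^2 <= 2 N |u - g_k|. *)
Lemma L2_cont_approx v (e : R) : L2r v -> 0 < e -> exists g (B M : R),
  [/\ continuous g, suppin M g, forall x, `|g x| <= B, 0 <= B /\ 0 <= M &
    L2r g /\ nr (fun x => v x - g x) <= e].
Proof.
move=> vL e0.
have e40 : 0 < e / 4 by rewrite divr_gt0.
have /cvgr0Pnorm_le/(_ _ e40) [n _ /(_ _ (leqnn n))] := trunc_cvg vL.
rewrite ger0_norm ?nr_ge0// nr_subC => hn.
pose u := trunc n v; pose N : R := n%:R.
have N0 : 0 <= N by [].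
have mu_ : measurable_fun setT u by apply: mes_trunc; case: vL.
have uN x : `|u x| <= N by rewrite /u /trunc; case: ifPn => [/andP[_ ]//|_]; rewrite normr0.
have u0 x : N <= `|x| -> u x = 0.
  by move=> xN; rewrite /u /trunc ltNge xN.
have uL : L2r u.
  apply: L2r_dom vL => // x; rewrite /u /trunc; case: ifPn => // _.
  by rewrite normr0.
pose E : set R := `[- (N + 1), N + 1]%classic.
have mE : measurable E by exact: measurable_itv.
have muE : (mu E < +oo)%E by rewrite /E lebesgue_measure_itv; case: ifP => _; rewrite ?ltry// -EFinB ltry.
have ui : mu.-integrable E (EFin \o u).
  apply: measurable_bounded_integrable => //; first exact: measurable_funTS.
  by exists N; split; rewrite ?num_real// => y Ny x _; apply: le_trans (uN x) (ltW Ny).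
have [g_ [cg gi]] := approximation_continuous_integrable mE muE ui.
move=> /fine_cvg/= /cvgr0Pnorm_le.
(* Chosen so that 2 N times this is at most e / 4; the added 1 covers N = 0. *)
have e1 : 0 < e / 4 / (2 * N + 1) by rewrite divr_gt0// ltr_wpDl// mulr_ge0.
move=> /(_ _ e1) [k _ /(_ _ (leqnn k))].
rewrite (_ : (_ \o _) k = int (fun x => \1_E x * `|u x - g_ k x|)); last first.
  by rewrite -Rintegral_setT.
move=> hk.
(* The cutoff is 1 wherever [u] is nonzero, so it bounds the support without spoiling the
   estimate. *)
pose g x := clamp N (g_ k x) * cutoff N x.
have c_g : continuous g.
  by move=> x; apply: cvgM; [exact: continuous_clamp|exact: continuous_cutoff].
have mg : measurable_fun setT g by exact: continuous_measurable_fun.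
have gN x : `|g x| <= N.
  rewrite /g normrM (ger0_norm (cutoff_ge0 _ _)) -[leRHS]mulr1.
  by apply: ler_pM => //; [exact: cutoff_ge0|exact: clamp_le|exact: cutoff_le1].
have g0 : suppin (N + 1) g.
  by move=> x; rewrite -leNgt => xN; rewrite /g cutoff0 ?mulr0.
have iE : intg (\1_E : R -> R) by exact: intg_itv.
have gL : L2r g.
  split => //; apply: intg_dom (intgZ (N ^+ 2) iE); first exact: measurable_funX.
  move=> x; rewrite normrX.
  have [xE|xE] := boolP (`|x| < N + 1).
    rewrite indicE mem_set ?mulr1 ?lerXn2r ?nnegrE//.
    by rewrite /E /= in_itv/= -ler_norml ltW.
  by rewrite g0// normr0 expr0n mulr_ge0// sqr_ge0.
exists g, N, (N + 1); split => //; first by rewrite addr_ge0.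
split => //.
apply: le_trans (nr_tri vL uL gL) _.
suff : nr (fun x => u x - g x) <= e / 4 by move: hn; rewrite -/u; lra.
have gki : intg (fun x => \1_E x * `|u x - g_ k x|).
  have h1 := (intg_setT _ mE).1 ui; have h2 := (intg_setT _ mE).1 (gi k).
  apply: eq_intg (intg_norm (intgB h1 h2)) => x.
  by rewrite -mulrBr normrM indicE ger0_norm.
apply: le_trans (_ : 2 * N * int (fun x => \1_E x * `|u x - g_ k x|) <= _).
  rewrite -intZ//; apply: int_le; first by case: (L2rB uL gL).
    exact: intgZ.
  move=> x; have [xE|xE] := boolP (`|x| < N + 1); last first.
    rewrite g0// u0 ?subrr ?expr0n ?mulr_ge0//; last by rewrite -leNgt in xE; lra.
  rewrite indicE mem_set ?mul1r; last by rewrite /E /= in_itv/= -ler_norml ltW.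
  have -> : u x - g x = (u x - clamp N (g_ k x)) * cutoff N x.
    rewrite mulrBl; congr (_ - _).
    by have [xN|xN] := lerP `|x| N; [rewrite cutoff1// mulr1|rewrite u0 ?mul0r// ltW].
  rewrite exprMn -[leRHS]mulr1; apply: ler_pM; rewrite ?sqr_ge0//; last first.
    by rewrite expr_le1// ?cutoff_le1// cutoff_ge0.
  rewrite -real_normK ?num_real// expr2; apply: ler_pM => //; last exact: clamp_contr.
  by apply: le_trans (ler_normB _ _) _; rewrite mulr_natl mulr2n lerD// clamp_le.
have p0 : 0 < 2 * N + 1 by rewrite ltr_wpDl// mulr_ge0.
have i0 : 0 <= int (fun x => \1_E x * `|u x - g_ k x|).
  by apply: int_ge0 => x; rewrite mulr_ge0// indicE.
move: hk; rewrite ger0_norm// ler_pdivlMr//.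
by apply: le_trans; rewrite mulrC ler_wpM2l//; lra.
Qed.

(** Density argument: a continuous g of bounded support satisfies this by dominated convergence, and
    the substitution multiplies squared norms by 1 / s <= 2, uniformly in n. *)
Lemma affine_cvg v (s t : nat -> R) : L2r v ->
  (forall n, 2^-1 <= s n) -> (forall n, `|t n| <= 1) ->
  s n @[n --> \oo] --> (1 : R) -> t n @[n --> \oo] --> 0 ->
  nr (fun x => v (s n * x + t n) - v x) @[n --> \oo] --> 0.
Proof.
move=> vL s2 t1 sc tc; apply/cvgr0Pnorm_le => /= e e0.
(* Budget of the three pieces: 2 (2 e/16) + 2 (2 e/8 + 2 e/16) = e. *)
have e16 : 0 < e / 16 by rewrite divr_gt0.
have e8 : 0 < e / 8 by rewrite divr_gt0.
have [g [B [M [cg gM gB [B0 M0] [gL vg]]]]] := L2_cont_approx vL e16.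
have s0 n : 0 < s n by apply: lt_le_trans (s2 n); rewrite invr_gt0.
have sn0 n : s n != 0 by rewrite gt_eqF.
have gA n : L2r (fun x => g (s n * x + t n)) by exact: L2r_affine.
have vA n : L2r (fun x => v (s n * x + t n)) by exact: L2r_affine.
have : nr (fun x => g (s n * x + t n) - g x) @[n --> \oo] --> 0.
  (* Outside this interval |s x + t| >= (M + 1) - 1 = M, because s >= 1/2 and |t| <= 1, so both
     terms vanish. *)
  pose E : set R := `[- (2 * (M + 1)), 2 * (M + 1)]%classic.
  have iE : intg (\1_E : R -> R) by exact: intg_itv.
  apply: (nr_cvg0_dom _ _ _ (intgZ ((2 * B) ^+ 2) iE)).
  - by move=> n; case: (L2rB (gA n) gL).
  - move=> x; apply/subr_cvg0.
    have h : s n * x + t n @[n --> \oo] --> x.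
      rewrite -[X in _ --> X](_ : 1 * x + 0 = x); last by rewrite mul1r addr0.
      by apply: cvgD => //; apply: cvgM => //; exact: cvg_cst.
    exact: (cvg_comp _ _ h (cg x)).
  - move=> n x; have [xE|xE] := boolP (`|x| <= 2 * (M + 1)).
      rewrite indicE mem_set ?mulr1; last by rewrite /E /= in_itv/= -ler_norml.
      rewrite -real_normK ?num_real// lerXn2r ?nnegrE ?mulr_ge0//.
      by apply: le_trans (ler_normB _ _) _; rewrite mulr_natl mulr2n lerD.
    rewrite -ltNge in xE.
    rewrite !gM ?subrr ?expr0n/= ?mulr_ge0 ?sqr_ge0 ?indicE//.
      by rewrite -leNgt; lra.
    rewrite -leNgt.
    have : `|s n * x| <= `|s n * x + t n| + `|t n|.
      by rewrite -{1}[s n * x](addrK (t n)) ler_normB.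
    rewrite normrM (gtr0_norm (s0 n)) => h.
    have : 2^-1 * (2 * (M + 1)) <= s n * `|x|.
      by apply: ler_pM => //; [rewrite mulr_ge0// addr_ge0|exact: ltW].
    by have := t1 n; lra.
move=> /cvgr0Pnorm_le/(_ _ e8); apply: filterS => n.
rewrite !ger0_norm ?nr_ge0// => hn.
apply: le_trans (nr_tri (vA n) (gA n) vL) _.
have h1 : nr (fun x => v (s n * x + t n) - g (s n * x + t n)) <= 2 * (e / 16).
  rewrite /nr (@int_affine _ (s n) (t n) (fun x => (v x - g x) ^+ 2))//; last first.
    by case: (L2rB vL gL).
  apply: ler_pM => //; rewrite ?invr_ge0 ?gtr0_norm ?nr_ge0//.
  by rewrite -[leRHS]invrK lef_pV2 ?posrE ?invr_gt0.
have h2 := nr_tri (gA n) gL vL; rewrite nr_subC in vg.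
lra.
Qed.

Lemma shift_cvg v (t : nat -> R) : L2r v -> (forall n, `|t n| <= 1) ->
  t n @[n --> \oo] --> 0 ->
  NN v v (t n) @[n --> \oo] --> 0.
Proof.
move=> vL t1 t0; have := @affine_cvg v (fun=> 1) (fun n => - t n) vL.
move=> /(_ _ _ _ _)/wrap[].
- by move=> _; rewrite invf_le1// ler1n.
- by move=> n; rewrite normrN.
- exact: cvg_cst.
- by rewrite -oppr0; exact: cvgN.
apply: cvg_trans; apply: near_eq_cvg; apply: nearW => n.
by rewrite NN_nr nr_subC; apply: eq_int => x; rewrite mul1r.
Qed.

End Approximation.

(** * Integrals over the half-line, Gamma and digamma functions *)

Section HalfLine.
Context {R : realType}.
Local Notation mu := (@lebesgue_measure R).
Implicit Types f g F : R -> R.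

(** Restriction to the open half-line, extended by zero. All integrals stay on the whole line, while
    regularity of f is only asked at x > 0; the kernels below are singular at 0. *)
Definition hp f (x : R) : R := if 0 < x then f x else 0.

Lemma hp_gt0 f x : 0 < x -> hp f x = f x.
Proof. by rewrite /hp => ->. Qed.

Lemma hp_le0 f x : x <= 0 -> hp f x = 0.
Proof. by rewrite /hp ltNge => ->. Qed.

Lemma hp_ge0 f : (forall x : R, 0 < x -> 0 <= f x) -> forall x, 0 <= hp f x.
Proof. by move=> f0 x; rewrite /hp; case: ifPn => // /f0. Qed.

Lemma hp_indic f x : \1_(`]0, +oo[%classic) x * f x = hp f x.
Proof.
rewrite /hp indicE; case: ifPn => x0.
  by rewrite mem_set ?mul1r//= in_itv/= x0.
by rewrite memNset ?mul0r//= in_itv/= (negbTE x0).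
Qed.

Lemma Rintegral_hp f : \int[mu]_(x in `]0, +oo[) f x = int (hp f).
Proof. by rewrite Rintegral_setT; apply: eq_int => x; rewrite hp_indic. Qed.

Lemma mes_hp f : measurable_fun setT f -> measurable_fun setT (hp f).
Proof.
move=> mf; apply: measurable_fun_ifT => //; exact: measurable_fun_ltr.
Qed.

Lemma mes_hp_cont f : (forall x : R, 0 < x -> {for x, continuous f}) ->
  measurable_fun setT (hp f).
Proof.
move=> cf.
have mD : measurable (`]0, +oo[%classic : set R) by exact: measurable_itv.
have : measurable_fun (`]0, +oo[%classic : set R) f.
  apply: open_continuous_measurable_fun; first exact: interval_open.
  by move=> x /set_mem /=; rewrite in_itv/= andbT; exact: cf.
move/(measurable_restrictT f mD); congr measurable_fun; apply/funext => x.
rewrite -hp_indic indicE /patch.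
by case: (x \in _); rewrite ?mul1r ?mul0r.
Qed.

Lemma eq_hp f g : (forall x : R, 0 < x -> f x = g x) -> hp f =1 hp g.
Proof. by move=> fg x; rewrite /hp; case: ifPn => // /fg. Qed.

Lemma intg_hp_dom f g : measurable_fun setT (hp f) ->
  (forall x : R, 0 < x -> `|f x| <= g x) -> intg (hp g) -> intg (hp f).
Proof.
move=> mf fg; apply: intg_dom => // x; rewrite /hp; case: ifPn => [/fg//|_].
by rewrite normr0.
Qed.

Lemma near_natS (c : R) : \forall n \near \oo, c < n.+1%:R.
Proof.
near=> n; apply: lt_le_trans (_ : n%:R <= _); last by rewrite ler_nat.
by near: n; exact: nbhs_infty_gtr.
Unshelve. all: by end_near. Qed.

Lemma near_natSS (c : R) : \forall n \near \oo, c < n.+2%:R.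
Proof.
near=> n; apply: lt_le_trans (_ : n.+1%:R <= _); last by rewrite ler_nat.
by near: n; exact: near_natS.
Unshelve. all: by end_near. Qed.

(** Compact intervals exhausting the open half-line; the upper end n + 2 keeps the interval
    nondegenerate for n = 0. *)
Definition win (n : nat) : set R := `[n.+1%:R^-1, n.+2%:R]%classic.

Lemma win_gt0 n x : win n x -> 0 < x.
Proof. by rewrite /win/= in_itv/= => /andP[+ _]; apply: lt_le_trans; rewrite invr_gt0. Qed.

Lemma invS_lt n : (n.+1%:R^-1 : R) < n.+2%:R.
Proof.
apply: le_lt_trans (_ : 1 < _); first by rewrite invf_le1// ler1n.
by rewrite ltr1n.
Qed.

Lemma ftc_win f F n : (forall x : R, 0 < x -> is_derive x 1 F (f x)) ->
  (forall x : R, 0 < x -> {for x, continuous f}) ->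
  intg (fun x => \1_(win n) x * f x) /\
  int (fun x => \1_(win n) x * f x) = F n.+2%:R - F n.+1%:R^-1.
Proof.
move=> dF cf.
have wc : {within win n, continuous f}.
  apply: continuous_in_subspaceT => x /set_mem /win_gt0; exact: cf.
have i1 : mu.-integrable (win n) (EFin \o f).
  by apply: continuous_compact_integrable => //; exact: segment_compact.
have cF x : 0 < x -> {for x, continuous F}.
  by move=> x0; apply: differentiable_continuous; apply/derivable1_diffP; have := dF _ x0.
have n0 : (0 : R) < n.+1%:R^-1 by rewrite invr_gt0.
split; first exact/(intg_setT _ (measurable_itv _)).
rewrite -Rintegral_setT /Rintegral (continuous_FTC2 (invS_lt n) wc (F := F))//.
  split; first by move=> x; rewrite in_itv/= => /andP[/(lt_trans n0) /dF ? _].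
    by apply: cvg_at_right_filter; exact: cF.
  by apply: cvg_at_left_filter; apply: cF.
move=> x; rewrite in_itv/= => /andP[/(lt_trans n0) x0 _].
by rewrite derive1E; have := dF _ x0 => ?; rewrite derive_val.
Qed.

Lemma win_cvg f x : \1_(win n) x * f x @[n --> \oo] --> hp f x.
Proof.
apply: cvg_near_cst; have [x0|x0] := ltP 0 x; last first.
  near=> n; rewrite hp_le0// indicE memNset ?mul0r// => /win_gt0.
  by rewrite ltNge x0.
near=> n; rewrite hp_gt0// indicE mem_set ?mul1r// /win/= in_itv/=.
apply/andP; split; last by near: n; apply: filterS (near_natSS x) => n /ltW.
rewrite -[leRHS]invrK lef_pV2 ?posrE ?invr_gt0//.
by near: n; apply: filterS (near_natS x^-1) => n /ltW.
Unshelve. all: by end_near. Qed.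

(** A nonnegative derivative of a bounded function is integrable: its integrals over the windows are
    at most 2 C, and Fatou applies. *)
Lemma intg_hp_deriv f F C : (forall x : R, 0 < x -> is_derive x 1 F (f x)) ->
  (forall x : R, 0 < x -> {for x, continuous f}) ->
  (forall x : R, 0 < x -> 0 <= f x) -> (forall x : R, 0 < x -> `|F x| <= C) ->
  intg (hp f).
Proof.
move=> dF cf f0 FC.
have [] := @fatou_le _ (fun n x => \1_(win n) x * f x) (hp f) (fun=> C + C) (C + C).
- by move=> n; case: (ftc_win n dF cf).
- move=> n x; rewrite indicE; have [/set_mem/win_gt0 x0|_] := boolP (x \in win n).
    by rewrite mul1r f0.
  by rewrite mul0r.
- exact: win_cvg.
- move=> n; case: (ftc_win n dF cf) => _ ->.
  by apply: le_trans (ler_norm _) _; apply: le_trans (ler_normB _ _) _; rewrite lerD// FC.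
- exact: cvg_cst.
- by [].
Qed.

(** The fundamental theorem of calculus on the windows, passed to the limit by domination; the
    boundary limits are only needed along the endpoints of the windows. *)
Lemma int_hp_deriv f F (m l : R) : (forall x : R, 0 < x -> is_derive x 1 F (f x)) ->
  (forall x : R, 0 < x -> {for x, continuous f}) -> intg (hp f) ->
  F n.+1%:R^-1 @[n --> \oo] --> m -> F n.+2%:R @[n --> \oo] --> l ->
  int (hp f) = l - m.
Proof.
move=> dF cf fi Fm Fl.
have [] := @dct _ (fun n x => \1_(win n) x * f x) (hp f) (fun x => `|hp f x|).
- by move=> n; apply: intg_mes; case: (ftc_win n dF cf).
- exact: win_cvg.
- move=> n x; rewrite indicE; have [/set_mem/win_gt0 x0|_] := boolP (x \in win n).
    by rewrite mul1r hp_gt0.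
  by rewrite mul0r normr0.
- exact: intg_norm.
move=> _ h _; apply: cvg_unique h _ => //.
rewrite /=; under eq_fun => n do rewrite (ftc_win n dF cf).2.
exact: cvgB.
Qed.

Lemma continuous_expRl (l x : R) : {for x, continuous (fun x : R => expR (l * x))}.
Proof.
apply: continuous_comp; last exact: continuous_expR.
by apply: cvgM; [exact: cvg_cst|exact: cvg_id].
Qed.

Lemma expRN_natl_cvg0 (l : R) : 0 < l -> expR (- (l * n.+2%:R)) @[n --> \oo] --> 0.
Proof.
move=> l0; apply/cvgr0Pnorm_lt => e e0; near=> n.
rewrite gtr0_norm ?expR_gt0// expRN invf_plt ?posrE ?expR_gt0//.
apply: lt_le_trans (expR_ge1Dx _).
apply: lt_le_trans (_ : l * n.+2%:R <= _); last by lra.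
rewrite -ltr_pdivrMl//.
by near: n; exact: near_natSS.
Unshelve. all: by end_near. Qed.

Lemma hp_exp (l : R) : 0 < l ->
  intg (hp (fun x => expR (- (l * x)))) /\
  int (hp (fun x => expR (- (l * x)))) = l^-1.
Proof.
move=> l0; pose F x := - l^-1 * expR (- (l * x)).
have dF (x : R) : 0 < x -> is_derive x 1 F (expR (- (l * x))).
  move=> _; apply: is_derive_eq.
  by rewrite /GRing.scale/=; field; rewrite gt_eqF.
have cf (x : R) : 0 < x -> {for x, continuous (fun x => expR (- (l * x)))}.
  move=> _; have := @continuous_expRl (- l) x.
  by congr (continuous_at _ _); apply/funext => y; rewrite mulNr.
have i : intg (hp (fun x => expR (- (l * x)))).
  apply: (@intg_hp_deriv _ F l^-1 dF cf) => [x _|x x0]; first exact: expR_ge0.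
  rewrite /F normrM normrN !gtr0_norm ?invr_gt0 ?expR_gt0//.
  rewrite -[leRHS]mulr1 ler_wpM2l ?invr_ge0 ?(ltW l0)// expR_le1.
  by rewrite oppr_le0 mulr_ge0// ltW.
split=> //; rewrite (@int_hp_deriv _ F (- l^-1) 0)//; first by rewrite sub0r opprK.
- have -> : - l^-1 = - l^-1 * expR (- (l * 0)) by rewrite mulr0 oppr0 expR0 mulr1.
  apply: cvgM; first exact: cvg_cst.
  apply: continuous_cvg; first exact: continuous_expR.
  by apply: cvgN; apply: cvgM; [exact: cvg_cst|exact: cvg_harmonic].
- rewrite -[X in _ --> X](mulr0 (- l^-1)).
  by apply: cvgM; [exact: cvg_cst|exact: expRN_natl_cvg0].
Qed.

End HalfLine.

(** * The Gamma integral and its functional equation *)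

Section GammaFunction.
Context {R : realType}.
Implicit Types s x y h : R.

Definition gammaf s x : R := x `^ (s - 1) * expR (- x).

Lemma GammaE s : Gamma s = int (hp (gammaf s)).
Proof. exact: Rintegral_hp. Qed.

Lemma gammaf_gt0 s x : 0 < x -> 0 < gammaf s x.
Proof. by move=> x0; rewrite mulr_gt0 ?powR_gt0 ?expR_gt0. Qed.

Lemma continuous_powR_gt0 s x : 0 < x -> {for x, continuous (fun x => x `^ s)}.
Proof.
move=> x0; apply: differentiable_continuous; apply/derivable1_diffP.
by have := is_derive1_powR s x0.
Qed.

Lemma continuous_gammaf s x : 0 < x -> {for x, continuous (gammaf s)}.
Proof.
move=> x0; apply: cvgM; first exact: continuous_powR_gt0.
apply: continuous_comp; [exact: opp_continuous|exact: continuous_expR].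
Qed.

Lemma mes_gammaf s : measurable_fun setT (hp (gammaf s)).
Proof. by apply: mes_hp_cont => x; exact: continuous_gammaf. Qed.

Lemma sqr_le_exp x : 0 <= x -> (1 + x) ^+ 2 <= 4 * expR x.
Proof.
move=> x0; have h := expR_ge1Dx (x / 2).
have -> : expR x = expR (x / 2) ^+ 2 by rewrite -expRM_natl; congr expR; field.
rewrite (_ : 4 * _ = (2 * expR (x / 2)) ^+ 2); last by ring.
rewrite lerXn2r ?nnegrE ?mulr_ge0 ?expR_ge0//; lra.
Qed.

(** Comparison with an exact derivative: F = (x / (1 + x))^s is bounded by 1, and its derivative is
    s x^(s-1) / (1 + x)^(s+1). As (1 + x)^(s+1) <= (1 + x)^2 <= 4 e^x for s <= 1, the Gamma
    integrand is at most 4 / s times that derivative. *)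
Lemma intg_gammaf_le1 s : 0 < s -> s <= 1 -> intg (hp (gammaf s)).
Proof.
move=> s0 s1.
pose F (x : R) := expR (s * (ln x - ln (1 + x))).
pose f (x : R) := F x * (s * (x^-1 - (1 + x)^-1)).
have p1 x : 0 < x -> 0 < 1 + x by move=> x0; rewrite addr_gt0.
have dF x : 0 < x -> is_derive x 1 F (f x).
  move=> x0; have dl := is_derive1_ln x0; have dl1 := is_derive1_ln (p1 _ x0).
  have dl2 : is_derive x 1 (fun x => ln (1 + x)) (1 + x)^-1.
    have d1 : is_derive x 1 (fun x : R => 1 + x) 1 by rewrite -[X in is_derive _ _ _ X]add0r; apply: is_deriveD.
    by have := is_derive1_comp dl1 d1; rewrite mulr1.
  apply: is_derive_eq; rewrite /f /F /GRing.scale/=; ring.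
have cF x : 0 < x -> {for x, continuous F}.
  by move=> x0; apply: differentiable_continuous; apply/derivable1_diffP; have := dF _ x0.
have cf x : 0 < x -> {for x, continuous f}.
  move=> x0; apply: cvgM; first exact: cF.
  apply: cvgM; first exact: cvg_cst.
  apply: cvgB; first by apply: cvgV; rewrite ?gt_eqF.
  apply: cvgV; first by rewrite gt_eqF// p1.
  by apply: cvgD; [exact: cvg_cst|exact: cvg_id].
have fE x : 0 < x -> f x = s * F x / (x * (1 + x)).
  by move=> x0; rewrite /f; field; rewrite !gt_eqF ?p1.
have fi : intg (hp f).
  apply: (@intg_hp_deriv _ f F 1) => // x x0.
    by rewrite fE// divr_ge0 ?mulr_ge0 ?expR_ge0// ltW// p1.
  rewrite gtr0_norm ?expR_gt0// expR_le1 pmulr_rle0// subr_le0 ler_ln ?posrE ?p1//.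
  by rewrite lerDr.
apply: intg_hp_dom (mes_gammaf s) _ (_ : intg (hp (fun x => 4 / s * f x))); last first.
  apply: eq_intg (intgZ (4 / s) fi) => x.
  by rewrite /hp; case: ifPn => //; rewrite mulr0.
move=> x x0; rewrite gtr0_norm ?gammaf_gt0// fE// /gammaf.
have -> : x `^ (s - 1) = x `^ s / x by rewrite -(@mulr_powRB1 _ x s) ?(ltW x0)//; field; rewrite gt_eqF.
have -> : F x = x `^ s / (1 + x) `^ s.
  by rewrite /F mulrBr expRB /powR !gt_eqF ?p1.
have e0 := expR_gt0 x; have p0 := p1 _ x0.
rewrite expRN [leRHS](_ : _ = (x `^ s / x) * (4 / ((1 + x) `^ s * (1 + x)))); last first.
  by field; rewrite !gt_eqF ?powR_gt0.
apply: ler_wpM2l; first by rewrite divr_ge0 ?powR_ge0// ltW.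
rewrite -[leLHS]mul1r ler_pdivrMr// mulrAC ler_pdivlMr ?mulr_gt0 ?powR_gt0// mul1r.
apply: le_trans (sqr_le_exp (ltW x0)); rewrite expr2 ler_wpM2r// ?(ltW p0)//.
by apply: ler1_powR => //; rewrite lerDl ltW.
Qed.

Lemma intg_gammaf_half s : intg (hp (gammaf s)) ->
  intg (hp (fun x => x `^ (s - 1) * expR (- (x / 2)))).
Proof.
move=> gi; have h0 : (2^-1 : R) != 0 by rewrite invr_eq0.
apply: eq_intg (intgZ (2 `^ (s - 1)) (intg_affine 0 h0 gi)) => x.
rewrite addr0 /hp pmulr_rgt0//; case: ifPn => x0; last by rewrite mulr0.
rewrite /gammaf mulrA -powRM ?mulr_ge0 ?invr_ge0 ?(ltW x0)//.
by rewrite mulVKf// (mulrC 2^-1).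
Qed.

(** Half of the exponential decay pays for the extra factor x, as x e^(-x/2) <= 2. With the
    rescaling of [intg_gammaf_half] this raises the exponent by one in the induction for
    [intg_gammaf]. *)
Lemma gammaf_le s x : 0 < s -> 0 < x -> gammaf (s + 1) x <= 2 * (x `^ (s - 1) * expR (- (x / 2))).
Proof.
move=> s0 x0; rewrite /gammaf addrK.
have -> : x `^ s = x * x `^ (s - 1) by rewrite mulr_powRB1// ltW.
have -> : expR (- x) = expR (- (x / 2)) * expR (- (x / 2)) by rewrite -expRD; congr expR; field.
have h := expR_ge1Dx (x / 2); have e1 := expRxMexpNx_1 (x / 2).
have e0 := expR_gt0 (- (x / 2)); have p0 := powR_ge0 x (s - 1).
have : x * expR (- (x / 2)) <= 2 by nra.
move=> h2; rewrite [leLHS](_ : _ = (x * expR (- (x / 2))) * (x `^ (s - 1) * expR (- (x / 2)))); last ring.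
by apply: ler_wpM2r => //; rewrite mulr_ge0// ltW.
Qed.

Lemma intg_gammaf s : 0 < s -> intg (hp (gammaf s)).
Proof.
move=> s0; have [n] : exists n : nat, s <= n.+1%:R.
  exists (Num.truncn s); apply: ltW.
  by have := truncn_itv (ltW s0) => /andP[].
elim: n s s0 => [|n IH] s s0 sn; first exact: intg_gammaf_le1.
have [s1|s1] := leP s 1; first exact: intg_gammaf_le1.
have h : intg (hp (gammaf (s - 1))).
  by apply: IH; [rewrite subr_gt0|rewrite lerBlDr (le_trans sn)// -natr1].
apply: intg_hp_dom (mes_gammaf s) _ (_ : intg (hp (fun x => 2 * (x `^ (s - 1 - 1) * expR (- (x / 2)))))); last first.
  apply: eq_intg (intgZ 2 (intg_gammaf_half h)) => x.
  by rewrite /hp; case: ifPn => //; rewrite mulr0.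
move=> x x0; rewrite gtr0_norm ?gammaf_gt0//.
by have := @gammaf_le (s - 1) x; rewrite subrK subr_gt0 s1; apply.
Qed.

(** For an integer m >= s and y >= 1, y^(s+1) <= y^(m+1) <= (m+1)! e^y, so the quantity is at most
    (m+1)! / y. *)
Lemma powR_exp_cvg0 s : 0 < s -> n.+2%:R `^ s * expR (- n.+2%:R) @[n --> \oo] --> (0 : R).
Proof.
move=> s0; pose m := (Num.truncn s).+1.
have sm : s <= m%:R by apply: ltW; have := truncn_itv (ltW s0) => /andP[].
apply: (@squeeze_cvgr _ _ _ _ (fun=> 0) (fun n => (m.+1)`!%:R * n.+2%:R^-1)).
- apply: nearW => n; rewrite mulr_ge0 ?powR_ge0 ?expR_ge0//=.
  rewrite expRN ler_pdivrMr ?expR_gt0// mulrAC ler_pdivlMr ?ltr0n//.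
  have p1 : (1 : R) <= n.+2%:R by rewrite ler1n.
  have h : n.+2%:R `^ s * n.+2%:R <= n.+2%:R ^+ m.+1 :> R.
    rewrite exprSr ler_wpM2r// -powR_mulrn//; exact: ler_powR.
  apply: (le_trans h).
  have := @expR_ge1Dxn R n.+2%:R m (ler0n _ _).
  rewrite -ler_pdivrMl ?ltr0n ?fact_gt0// mulrC; apply: le_trans.
  by rewrite lerDr.
- exact: cvg_cst.
- rewrite -[X in _ --> X](mulr0 (m.+1)`!%:R); apply: cvgM; first exact: cvg_cst.
  have := @cvg_harmonic R; rewrite -(cvg_shiftS (@harmonic R)); exact.
Qed.

(** Integration by parts: x^s e^(-x) tends to 0 at both ends, so its derivative has integral 0. *)
Lemma Gamma_succ s : 0 < s -> Gamma (s + 1) = s * Gamma s.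
Proof.
move=> s0; have s10 : 0 < s + 1 by rewrite addr_gt0.
pose F x := x `^ s * expR (- x).
pose f x := s * gammaf s x - gammaf (s + 1) x.
have dF x : 0 < x -> is_derive x 1 F (f x).
  move=> x0; have d1 := is_derive1_powR s x0.
  apply: is_derive_eq; rewrite /f /gammaf addrK /GRing.scale/=; ring.
have i1 := intgZ s (intg_gammaf s0); have i2 := intg_gammaf s10.
have fE x : hp f x = s * hp (gammaf s) x - hp (gammaf (s + 1)) x.
  by rewrite /hp; case: ifPn => //; rewrite mulr0 subr0.
have fi : intg (hp f) by apply: eq_intg (intgB i1 i2) => x; rewrite fE.
have : int (hp f) = 0 - 0.
  apply: (int_hp_deriv dF) => //.
  - by move=> x x0; apply: cvgB; [apply: cvgM; [exact: cvg_cst|]|]; exact: continuous_gammaf.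
  - apply: (@squeeze_cvgr _ _ _ _ (fun=> 0) (fun n => n.+1%:R^-1 `^ s)).
    + apply: nearW => n; rewrite mulr_ge0 ?powR_ge0 ?expR_ge0//=.
      rewrite -[leRHS]mulr1 ler_wpM2l ?powR_ge0// expR_le1 oppr_le0 invr_ge0//.
    + exact: cvg_cst.
    + apply: ((cvg_at_rightP _ _ _).1 (powR_cvg0 s0)); split; last exact: cvg_harmonic.
      by move=> n; rewrite invr_gt0.
  - exact: powR_exp_cvg0.
rewrite (eq_int fE) intB// intZ; last exact: intg_gammaf.
by rewrite -!GammaE => /eqP; rewrite subr0 subr_eq0 => /eqP.
Qed.

Lemma Gamma_gt0 s : 0 < s -> 0 < Gamma s.
Proof.
move=> s0; rewrite GammaE; pose E := `[1, 2]%classic : set R.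
have iE : intg (\1_E : R -> R) by exact: intg_itv.
(* On [1, 2] one has x^(s-1) >= 1/x >= 1/2 and e^(-x) >= e^(-2). *)
have c0 : 0 < expR (- 2) / 2 :> R by rewrite divr_gt0// expR_gt0.
apply: lt_le_trans (_ : int (fun x => expR (- 2) / 2 * \1_E x) <= _).
  rewrite intZ// mulr_gt0//.
  rewrite int_indic_itv; lra.
apply: int_le; [exact: intgZ|exact: intg_gammaf|move=> x].
rewrite indicE; have [/set_mem/=|_] := boolP (x \in E); last first.
  by rewrite mulr0 hp_ge0// => y y0; rewrite ltW// gammaf_gt0.
rewrite /E/= in_itv/= mulr1 => /andP[x1 x2]; have x0 : 0 < x by apply: lt_le_trans x1.
rewrite hp_gt0// /gammaf mulrC; apply: ler_pM; rewrite ?expR_ge0 ?invr_ge0//; last first.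
  by rewrite ler_expR lerN2.
apply: le_trans (_ : x `^ (- 1) <= _); last by apply: ler_powR => //; rewrite lerBrDr addNr ltW.
by rewrite powR_inv1 ?(ltW x0)// lef_pV2 ?posrE.
Qed.

(* The tangent line of the concave function [t ^ h] at [t = s], integrated against the Gamma density. *)
Lemma Gamma_le s h : 0 < s -> 0 < h < 1 -> Gamma (s + h) <= s `^ h * Gamma s.
Proof.
move=> s0 /andP[h0 h1]; have sh0 : 0 < s + h by rewrite addr_gt0.
have s10 : 0 < s + 1 by rewrite addr_gt0.
have -> : s `^ h * Gamma s = s `^ h * (1 - h) * Gamma s + h * s `^ h / s * Gamma (s + 1).
  by rewrite Gamma_succ//; field; rewrite gt_eqF.
rewrite !GammaE -!intZ; try exact: intg_gammaf.
rewrite -intD; try by apply: intgZ; exact: intg_gammaf.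
apply: int_le; first exact: intg_gammaf.
  by apply: intgD; apply: intgZ; exact: intg_gammaf.
move=> x; rewrite /hp; case: ifPn => x0; last by rewrite !mulr0 addr0.
rewrite /gammaf addrK.
have -> : x `^ (s + h - 1) = x `^ (s - 1) * x `^ h.
  by rewrite -powRD ?(gt_eqF x0) ?implybT// addrAC.
have -> : x `^ s = x * x `^ (s - 1) by rewrite mulr_powRB1// ltW.
have key : x `^ h <= s `^ h * (1 - h) + h * s `^ h / s * x.
  have -> : x `^ h = s `^ h * (x / s) `^ h.
    by rewrite -powRM ?divr_ge0 ?ltW//; congr powR; field; rewrite gt_eqF.
  rewrite [leRHS](_ : _ = s `^ h * (1 + h * (x / s - 1))); last by field; rewrite gt_eqF.
  apply: ler_wpM2l; first exact: powR_ge0.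
  have y0 : 0 < x / s by rewrite divr_gt0.
  move: (x / s) y0 => y y0.
  have := @conjugate_powR R (y `^ h) 1 h^-1 (1 - h)^-1.
  rewrite powR_ge0 ler01 invr_gt0 h0 invr_gt0 subr_gt0 h1 !invrK.
  move=> /(_ isT isT isT isT) H.
  have {H} := H ltac:(ring).
  by rewrite -powRrM mulfV ?gt_eqF// powRr1 ?(ltW y0)// powR1 !mulr1 mul1r => H; apply: le_trans H _; lra.
have p0 := powR_ge0 x (s - 1); have e0 := expR_ge0 (- x).
have pe : 0 <= x `^ (s - 1) * expR (- x) by rewrite mulr_ge0.
have := ler_wpM2l pe key; congr (_ <= _); ring.
Qed.

End GammaFunction.

(** * The series of the digamma function *)

Section Digamma.
Context {R : realType}.
Implicit Types x y h : R.

(* Locked because [lra] would otherwise unfold the integral when comparing atoms. *)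
Definition lnGamma x : R := locked (ln (Gamma x)).
Local Notation L := lnGamma.

Lemma lnGammaE x : L x = ln (Gamma x).
Proof. by rewrite /lnGamma -lock. Qed.


Lemma lnGamma_succ x : 0 < x -> L (x + 1) = L x + ln x.
Proof.
by move=> x0; rewrite !lnGammaE Gamma_succ// lnM ?posrE ?Gamma_gt0// addrC.
Qed.

Lemma lnGamma_addn x n : 0 < x -> L (x + n%:R) = L x + \sum_(k < n) ln (x + k%:R).
Proof.
move=> x0; elim: n => [|n IH]; first by rewrite addr0 big_ord0 addr0.
by rewrite -natr1 addrA lnGamma_succ ?ltr_wpDr// IH big_ord_recr/= addrA.
Qed.

Lemma lnGamma_le x h : 0 < x -> 0 < h < 1 -> L (x + h) - L x <= h * ln x.
Proof.
move=> x0 h01; have := Gamma_le x0 h01; case/andP: h01 => h0 h1.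
rewrite -ler_ln ?posrE ?mulr_gt0 ?powR_gt0 ?Gamma_gt0 ?addr_gt0//.
by rewrite lnM ?posrE ?powR_gt0 ?Gamma_gt0// ln_powR -!lnGammaE -lerBlDr.
Qed.

Lemma ln_le_sub1 x : 0 < x -> ln x <= x - 1.
Proof. by move=> x0; have := @le_ln1Dx R (x - 1); rewrite (addrC 1) subrK; apply; lra. Qed.

Lemma lnB_le x y : 0 < x -> 0 < y -> ln x - ln y <= (x - y) / y.
Proof.
move=> x0 y0; rewrite -ln_div ?posrE//.
apply: le_trans (ln_le_sub1 (divr_gt0 x0 y0)) _.
by rewrite mulrBl mulfV ?gt_eqF.
Qed.

(** [lnGamma_le] at x + h with step 1 - h bounds L(x + 1) - L(x + h) from above, and L(x + 1) = L(x)
    + ln x. The loss is (1 - h)(ln(x + h) - ln x) <= h / x. *)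
Lemma lnGamma_ge x h : 0 < x -> 0 < h < 1 -> h * (ln x - x^-1) <= L (x + h) - L x.
Proof.
move=> x0 /andP[h0 h1]; have xh : 0 < x + h by rewrite addr_gt0.
have h' : 0 < 1 - h < 1 by apply/andP; split; lra.
have := lnGamma_le xh h'.
rewrite (_ : x + h + (1 - h) = x + 1); last ring.
rewrite lnGamma_succ// => H.
have H2 := lnB_le xh x0.
have : ln (x + h) - ln x <= h / x by move: H2; rewrite addrAC subrr add0r.
have H3 : ln x <= ln (x + h) by rewrite ler_ln ?posrE// lerDl ltW.
have p0 : 0 <= x^-1 by rewrite invr_ge0 ltW.
move: H H3 {H2}; move: (L _) (L _) (ln _) (ln _) (x^-1) p0 => A B C D p p0 H H3 H2.
have : (1 - h) * (C - D) <= (1 - h) * (h * p) by rewrite ler_wpM2l; lra.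
have : 0 <= h * (h * p) by rewrite !mulr_ge0// ltW.
lra.
Qed.

(** A bound on difference quotients, uniform in h, obtained before any differentiability is known.
    For h < 0 the two inequalities are applied at y + h with step -h. *)
Lemma lnGamma_quot y h : 1 < y -> h != 0 -> `|h| < 1 ->
  `|(L (y + h) - L y) / h - ln y| <= 2 / (y - 1).
Proof.
move=> y1 h0 hlt; have y0 : 0 < y by lra.
have y10 : 0 < y - 1 by lra.
have yi : y^-1 <= (y - 1)^-1 by rewrite lef_pV2 ?posrE//; lra.
have yi0 : 0 < (y - 1)^-1 by rewrite invr_gt0.
have [hp|hn|he] := ltgtP 0 h; last by rewrite -he eqxx in h0.
  have h01 : 0 < h < 1 by rewrite hp; rewrite gtr0_norm in hlt.
  have H1 := lnGamma_le y0 h01; have H2 := lnGamma_ge y0 h01.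
  have q1 : (L (y + h) - L y) / h <= ln y by rewrite ler_pdivrMr// mulrC.
  have q2 : ln y - y^-1 <= (L (y + h) - L y) / h by rewrite ler_pdivlMr// mulrC.
  move: q1 q2; move: (_ / h) (ln y) => A B q1 q2.
  by clear -q1 q2 yi yi0; rewrite ler_norml; apply/andP; split; lra.
have h01 : 0 < - h < 1 by rewrite ltr0_norm in hlt => //; apply/andP; split; lra.
have z0 : 0 < y + h by rewrite ltr0_norm// in hlt; clear -hlt y1; lra.
have H1 := lnGamma_le z0 h01; have H2 := lnGamma_ge z0 h01.
rewrite addrK in H1 H2.
have nh : 0 < - h by rewrite oppr_gt0.
have e (A : R) : A / h = (- A) / - h by rewrite invrN mulrNN.
rewrite e opprB.
have q1 : (L y - L (y + h)) / - h <= ln (y + h) by rewrite ler_pdivrMr// mulrC.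
have q2 : ln (y + h) - (y + h)^-1 <= (L y - L (y + h)) / - h by rewrite ler_pdivlMr// mulrC.
have l1 : ln (y + h) <= ln y by rewrite ler_ln ?posrE// gerDl ltW.
have l2 := lnB_le y0 z0.
have zi : (y + h)^-1 <= (y - 1)^-1.
  by rewrite lef_pV2 ?posrE//; rewrite ltr0_norm// in hlt; clear -hlt; lra.
have zp : 0 < (y + h)^-1 by rewrite invr_gt0.
have l3 : (y - (y + h)) / (y + h) <= (y - 1)^-1.
  rewrite (_ : y - (y + h) = - h); last ring.
  by case/andP: h01 => _ h1; clear -h1 zi zp nh; nra.
move: q1 q2 l1 l2 l3; move: (_ / - h) (ln y) (ln (y + h)) (_ / (y + h)) => A B C D.
move=> q1 q2 l1 l2 l3; clear -q1 q2 l1 l2 l3 zi zp yi0.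
by rewrite ler_norml; apply/andP; split; lra.
Qed.

(** The terms of the classical limit formula for psi(x). *)
Definition psin x (n : nat) : R := ln n%:R - \sum_(k < n) (x + k%:R)^-1.

Lemma cvg_sumr (T : Type) (F : set_system T) (FF : Filter F) (n : nat)
    (f : nat -> T -> R) (l : nat -> R) :
  (forall k, f k x @[x --> F] --> l k) ->
  (\sum_(k < n) f k x) @[x --> F] --> \sum_(k < n) l k.
Proof.
move=> fl; elim: n => [|n IH].
  by under eq_fun do rewrite big_ord0; rewrite big_ord0; exact: cvg_cst.
under eq_fun do rewrite big_ord_recr/=.
by rewrite big_ord_recr/=; exact: cvgD.
Qed.

Let quot x h := (L (x + h) - L x) / h.

(** The functional equation moves the quotient from x to y = x + n + 2, where [lnGamma_quot] says it
    is about ln y, at the cost of the difference quotients of the ln(x + k). The errors are 2/(n+1)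
    for the quotient at y, x/(n+1) for ln y against ln(n + 2), and 1/(2(n+1)) for the finite sum
    once h is small. *)
Lemma quot_psin x n : 0 < x -> \forall h \near (0 : R)^',
  `|quot x h - psin x n.+2| <= (4 + x) / n.+1%:R.
Proof.
move=> x0; pose N : R := n.+2%:R; pose y := x + N.
have n0 : 0 < n.+1%:R :> R by [].
have N1 : N = n.+1%:R + 1 by rewrite /N -natr1.
have y1 : 1 < y by rewrite /y; lra.
pose S h : R := \sum_(k < n.+2) (ln (x + k%:R + h) - ln (x + k%:R)) / h.
have Sc : S h @[h --> (0 : R)^'] --> \sum_(k < n.+2) (x + k%:R)^-1.
  apply: (@cvg_sumr _ _ _ n.+2
    (fun k h => (ln (x + k%:R + h) - ln (x + k%:R)) / h) (fun k => (x + k%:R)^-1)) => k.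
  have xk : 0 < x + k%:R by rewrite ltr_wpDr.
  have dl := is_derive1_ln xk; have [d1 d2] := dl.
  rewrite -d2 /derive; move: d1; rewrite /derivable.
  have -> : (fun h => h^-1 *: (ln (h *: 1 + (x + k%:R)) - ln (x + k%:R)))
    = (fun h => (ln (x + k%:R + h) - ln (x + k%:R)) / h).
    by apply/funext => h; rewrite /GRing.scale/= mulr1 mulrC (addrC h).
  exact.
have e0 : 0 < 2^-1 / n.+1%:R :> R by rewrite divr_gt0 ?invr_gt0.
have /cvgrPdist_le/(_ _ e0) Sn := Sc.
near=> h.
have h0 : h != 0 by near: h; exact: nbhs_dnbhs_neq.
have h1 : `|h| < 1 by near: h; apply: dnbhs0_lt.
have hS : `|\sum_(k < n.+2) (x + k%:R)^-1 - S h| <= 2^-1 / n.+1%:R by near: h.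
have xh : 0 < x + h.
  have : `|h| < x by near: h; exact: dnbhs0_lt.
  by rewrite ltr_norml => /andP[]; lra.
have -> : quot x h = (L (y + h) - L y) / h - S h.
  rewrite /quot /y /N (addrAC x) !lnGamma_addn//.
  have -> : S h = (\sum_(k < n.+2) ln (x + h + k%:R) - \sum_(k < n.+2) ln (x + k%:R)) / h.
    rewrite /S -mulr_suml -sumrB; congr (_ * _); apply: eq_bigr => k _.
    by rewrite addrAC.
  move: (\sum_(k < n.+2) ln (x + h + k%:R)) (\sum_(k < n.+2) ln (x + k%:R)) (L (x + h)) (L x).
  by clear -h0 => A B C D; field.
have Q := lnGamma_quot y1 h0 h1.
have y2 : (2 / (y - 1)) <= 2 / n.+1%:R.
  by rewrite ler_pM2l// lef_pV2 ?posrE//; rewrite /y; lra.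
have N0 : 0 < N by [].
have ly : `|ln y - ln N| <= x / n.+1%:R.
  have l1 : ln N <= ln y by rewrite ler_ln ?posrE//; rewrite /y; lra.
  have l2 := @lnB_le y N ltac:(lra) N0.
  rewrite ger0_norm ?subr_ge0//; apply: (le_trans l2).
  rewrite /y addrK ler_pM2l// lef_pV2 ?posrE//; lra.
have -> : (L (y + h) - L y) / h - S h - psin x n.+2 =
  ((L (y + h) - L y) / h - ln y) + (ln y - ln N) +
  (\sum_(k < n.+2) (x + k%:R)^-1 - S h).
  rewrite /psin -/N; move: (_ / h) (ln y) (ln N) (\sum_(_ < _) _) (S h).
  by clear => A B C D E; ring.
apply: le_trans (ler_normD _ _) _; apply: le_trans (_ : 2 / n.+1%:R + x / n.+1%:R + 2^-1 / n.+1%:R <= _).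
  apply: lerD => //; apply: le_trans (ler_normD _ _) _; apply: lerD => //.
  exact: le_trans Q y2.
by rewrite -!mulrDl ler_pM2r ?invr_gt0//; lra.
Unshelve. all: by end_near. Qed.

Let eps x n : R := (4 + x) / n.+1%:R.

(** Both terms approximate the difference quotient of ln Gamma at one common h. *)
Lemma psin_dist x n m : 0 < x -> `|psin x n.+2 - psin x m.+2| <= eps x n + eps x m.
Proof.
move=> x0.
have [h [h1 h2]] : exists h, `|quot x h - psin x n.+2| <= eps x n /\
    `|quot x h - psin x m.+2| <= eps x m.
  apply: (@filter_ex _ (0 : R)^'); apply: filterI; exact: quot_psin.
rewrite (_ : _ - _ = (quot x h - psin x m.+2) - (quot x h - psin x n.+2)); last ring.
by apply: le_trans (ler_normB _ _) _; rewrite addrC lerD.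
Qed.

Lemma psin_lim x : 0 < x -> exists A : R, forall n, `|psin x n.+2 - A| <= eps x n.
Proof.
(* Completeness through a supremum: by [psin_dist] each [psin] + [eps] bounds every [psin] - [eps]
   from above, so the supremum is within [eps x n] of the n-th term. *)
move=> x0; pose E := [set psin x n.+2 - eps x n | n in setT].
have ub m : ubound E (psin x m.+2 + eps x m).
  move=> _ [n _ <-]; have := psin_dist n m x0.
  by rewrite ler_norml => /andP[_]; lra.
have En : E !=set0 by exists (psin x 2 - eps x 0), 0.
exists (sup E) => n; rewrite ler_norml; apply/andP; split.
  have := ge_sup En (ub n); lra.
have := @ub_le_sup _ E (ex_intro _ _ (ub n)) (psin x n.+2 - eps x n) _.
move=> /(_ _)/wrap[|]; first by exists n.
lra.
Qed.

Lemma eps_cvg0 x : eps x n @[n --> \oo] --> 0.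
Proof.
rewrite -[X in _ --> X](mulr0 (4 + x)).
by apply: cvgM; [exact: cvg_cst|exact: cvg_harmonic].
Qed.

(** The limit A of the sequence is also the limit of the difference quotients of ln Gamma.
    Differentiability of Gamma at x thus comes out together with the value, since Gamma = exp(ln
    Gamma) near x. *)
Theorem digamma_cvg x : 0 < x -> psin x n @[n --> \oo] --> digamma x.
Proof.
move=> x0; have [A hA] := psin_lim x0.
have psiA : psin x n @[n --> \oo] --> A.
  rewrite -(cvg_shiftn 2); apply/subr_cvg0; apply: norm_cvg0.
  apply: (@squeeze_cvgr _ _ _ _ (fun=> 0) (eps x)).
  - by apply: nearW => n; rewrite normr_ge0/= addn2.
  - exact: cvg_cst.
  - exact: eps_cvg0.
suff -> : digamma x = A by [].
have qA : quot x h @[h --> (0 : R)^'] --> A.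
  apply/cvgrPdist_le => e e0.
  have e20 : 0 < e / 2 by rewrite divr_gt0.
  have /cvgrPdist_le/(_ _ e20)[n _ /(_ _ (leqnn n))] := eps_cvg0 x.
  rewrite sub0r normrN => hn; have {}hn := le_trans (ler_norm _) hn.
  apply: filterS (quot_psin n x0) => h hq.
  rewrite (_ : A - _ = (psin x n.+2 - quot x h) - (psin x n.+2 - A)); last ring.
  apply: le_trans (ler_normB _ _) _.
  rewrite (distrC (psin _ _) (quot _ _)).
  have := hA n; move: hq; rewrite -/(eps x n); lra.
have dL : is_derive x 1 L A.
  have hE : (fun h => h^-1 *: (L (h *: 1 + x) - L x)) = quot x.
    by apply/funext => h; rewrite /quot /GRing.scale/= mulr1 mulrC (addrC h).
  split; first by rewrite /derivable hE; exact: cvgP qA.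
  by rewrite /derive hE; exact/cvg_lim.
have dG : is_derive x 1 (fun x => expR (L x)) (expR (L x) * A).
  by have := is_derive1_comp (is_derive_expR (L x)) dL.
have nearG : \near x, expR (L x) = Gamma x.
  near=> z; rewrite lnGammaE lnK// posrE Gamma_gt0//.
  by near: z; exact: lt_nbhsr.
rewrite /digamma derive1E -(near_eq_derive _ nearG)//.
have [_ ->] := dG; rewrite lnGammaE lnK ?posrE ?Gamma_gt0// mulrAC mulfV ?mul1r//.
by rewrite gt_eqF// Gamma_gt0.
Unshelve. all: by end_near. Qed.

End Digamma.

(** * The archimedean kernel and the screw function *)

Section ArchimedeanKernel.
Context {R : realType}.
Implicit Types b s t x y : R.

Definition kker x : R := expR (x / 2) / (expR x - expR (- x)).

Lemma expRB_gt0 x : 0 < x -> 0 < expR x - expR (- x).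
Proof. by move=> x0; rewrite subr_gt0 ltr_expR gtrN. Qed.

Lemma expR2N_lt1 x : 0 < x -> 0 < 1 - expR (- (2 * x)).
Proof. by move=> x0; rewrite subr_gt0 expR_lt1 oppr_lt0 mulr_gt0. Qed.

Lemma kkerE x : 0 < x -> kker x = expR (- (x / 2)) / (1 - expR (- (2 * x))).
Proof.
move=> x0; have e : expR x - expR (- x) = expR x * (1 - expR (- (2 * x))).
  by rewrite mulrBr mulr1 -expRD; congr (_ - expR _); ring.
by rewrite /kker e invfM mulrA -expRN -expRD; congr (expR _ / _); field.
Qed.

Lemma kker_gt0 x : 0 < x -> 0 < kker x.
Proof. by move=> x0; rewrite divr_gt0 ?expR_gt0 ?expRB_gt0. Qed.

Lemma continuous_kker x : 0 < x -> {for x, continuous kker}.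
Proof.
move=> x0; apply: cvgM.
  apply: continuous_comp; last exact: continuous_expR.
  by apply: cvgM; [exact: cvg_id|exact: cvg_cst].
apply: cvgV; first by rewrite gt_eqF// expRB_gt0.
apply: cvgB; first exact: continuous_expR.
by apply: continuous_comp; [exact: opp_continuous|exact: continuous_expR].
Qed.

Lemma mes_kker : measurable_fun setT (hp kker).
Proof. by apply: mes_hp_cont => x; exact: continuous_kker. Qed.

Lemma hpM (f g : R -> R) x : hp (fun x => f x * g x) x = hp f x * g x.
Proof. by rewrite /hp; case: ifPn => //; rewrite mul0r. Qed.

Lemma mes_kkerM (g : R -> R) : measurable_fun setT g ->
  measurable_fun setT (hp (fun x => kker x * g x)).
Proof.
move=> mg; rewrite (_ : hp _ = fun x => hp kker x * g x); last first.
  by apply/funext => x; rewrite hpM.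
by apply: measurable_funM => //; exact: mes_kker.
Qed.

(** The factor x cancels the simple pole of the kernel. Since 1 - e^(-2x) >= 2x / (1 + 2x), one half
    of the decay e^(-x/2) has to absorb 1 + 2x, which e^(-x/4) <= 1 / (1 + x/4) does with the
    constant 8. *)
Lemma mul_kker_le x : 0 < x -> x * kker x <= 4 * expR (- (4^-1 * x)).
Proof.
move=> x0; rewrite kkerE//; have d1 := expR2N_lt1 x0.
have h1 := expR_ge1Dx (2 * x); have h2 := expR_ge1Dx (x / 4).
have e2 : expR (- (2 * x)) * expR (2 * x) = 1 by rewrite mulrC expRxMexpNx_1.
have p2 := expR_gt0 (- (2 * x)).
have d2 : 2 * x / (1 + 2 * x) <= 1 - expR (- (2 * x)).
  rewrite ler_pdivrMr; last by rewrite addr_gt0// mulr_gt0.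
  by move: (expR (- _)) (expR (2 * x)) e2 p2 h1 => A B e2 p2 h1; clear -e2 p2 h1 x0; nra.
rewrite mulrA ler_pdivrMr//.
apply: le_trans (_ : 4 * expR (- (4^-1 * x)) * (2 * x / (1 + 2 * x)) <= _); last first.
  by rewrite ler_wpM2l// mulr_ge0// expR_ge0.
have -> : expR (- (x / 2)) = expR (- (4^-1 * x)) * expR (- (4^-1 * x)).
  by rewrite -expRD; congr expR; field.
have e4 : expR (- (4^-1 * x)) * expR (x / 4) = 1.
  by rewrite mulrC -[RHS](expRxMexpNx_1 (x / 4)); congr (_ * expR _); field.
have p4 := expR_gt0 (- (4^-1 * x)).
move: (expR (- _)) (expR (x / 4)) e4 p4 h2 => A B e4 p4 h2.
rewrite [leRHS]mulrA ler_pdivlMr; last by rewrite addr_gt0// mulr_gt0.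
have : A * (1 + x / 4) <= 1 by apply: le_trans (_ : A * B <= 1); [rewrite ler_wpM2l// ltW|rewrite e4].
clear -p4 x0 => h.
have -> : x * (A * A) * (1 + 2 * x) = (A * x) * (A * (1 + 2 * x)) by ring.
have -> : 4 * A * (2 * x) = (A * x) * 8 by ring.
rewrite ler_wpM2l ?mulr_ge0 ?(ltW p4) ?(ltW x0)//.
nra.
Qed.

Lemma intg_kker_mul : intg (hp (fun x => kker x * x)).
Proof.
apply: (intg_hp_dom _ _ (_ : intg (hp (fun x => 4 * expR (- (4^-1 * x)))))).
- exact: mes_kkerM.
- move=> x x0; rewrite ger0_norm; last by rewrite mulr_ge0 ?ltW ?kker_gt0.
  by rewrite mulrC mul_kker_le.
- have [i _] := @hp_exp R 4^-1 ltac:(by []).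
  by apply: eq_intg (intgZ 4 i) => x; rewrite /hp; case: ifPn => //; rewrite mulr0.
Qed.

Lemma intg_kker_le (g : R -> R) C : measurable_fun setT g ->
  (forall x, 0 < x -> `|g x| <= C * x) -> intg (hp (fun x => kker x * g x)).
Proof.
move=> mg gx; apply: (intg_hp_dom _ _ (_ : intg (hp (fun x => C * (kker x * x))))).
- exact: mes_kkerM.
- move=> x x0; rewrite normrM gtr0_norm ?kker_gt0// mulrCA.
  by rewrite ler_wpM2l ?gx// ltW// kker_gt0.
- apply: eq_intg (intgZ C intg_kker_mul) => x.
  by rewrite /hp; case: ifPn => //; rewrite mulr0.
Qed.

(** By [mul_kker_le] the integrand is at most 4 e^(-x/4) / sqrt x, a rescaled Gamma(1/2) integrand.
    This makes the kernel integrable against increments of Hoelder-1/2 functions. *)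
Lemma intg_kker_sqrt : intg (hp (fun x => kker x * Num.sqrt x)).
Proof.
have q0 : (4^-1 : R) != 0 by rewrite invr_eq0.
have gi := intg_affine 0 q0 (@intg_gammaf R 2^-1 ltac:(by rewrite invr_gt0)).
apply: intg_dom (intgZ 2 gi).
  by apply: mes_kkerM; apply: continuous_measurable_fun; exact: sqrt_continuous.
move=> x; rewrite addr0 /hp pmulr_rgt0 ?invr_gt0//; case: ifPn => x0; last first.
  by rewrite normr0 mulr0.
rewrite ger0_norm; last by rewrite mulr_ge0 ?sqrtr_ge0 ?ltW ?kker_gt0.
rewrite /gammaf.
have x4 : 0 < 4^-1 * x by rewrite mulr_gt0// invr_gt0.
have -> : (4^-1 * x) `^ (2^-1 - 1) = 2 / Num.sqrt x.
  rewrite (_ : 2^-1 - 1 = - 2^-1); last by field.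
  rewrite powRN powR12_sqrt ?(ltW x4)// sqrtrM ?invr_ge0// invfM; congr (_ * _).
  rewrite (_ : 4^-1 = 2^-1 ^+ 2 :> R); last by field.
  by rewrite sqrtr_sqr ger0_norm ?invr_ge0// invrK.
have s0 : 0 < Num.sqrt x by rewrite sqrtr_gt0.
have xs : x = Num.sqrt x ^+ 2 by rewrite sqr_sqrtr// ltW.
have h := mul_kker_le x0; set A := expR _ in h *.
have si : 0 <= (Num.sqrt x)^-1 by rewrite invr_ge0 ltW.
have := ler_wpM2l si h.
rewrite [X in _ * (X * kker x)]xs.
rewrite (_ : _ * (Num.sqrt x ^+ 2 * kker x) = kker x * Num.sqrt x); last by field; rewrite gt_eqF.
congr (_ <= _); field; rewrite gt_eqF//.
Qed.

(** Partial sums of the geometric expansion of [kker], written as e^(-b/2) / (1 - e^(-2b)). This is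
    the origin of the parameter 1/4 in the digamma and Lerch terms. *)
Definition kpart (N : nat) b : R := \sum_(n < N) expR (- (2 * (n%:R + 1 / 4) * b)).

Lemma kpartE N b : 0 < b -> kpart N b = kker b * (1 - expR (- (2 * b) * N%:R)).
Proof.
move=> b0; rewrite kkerE//; have d := expR2N_lt1 b0.
elim: N => [|N IH]; first by rewrite /kpart big_ord0 mulr0 expR0 subrr mulr0.
rewrite /kpart big_ord_recr/= -/(kpart N b) IH.
have -> : expR (- (2 * (N%:R + 1 / 4) * b)) = expR (- (b / 2)) * expR (- (2 * b) * N%:R).
  by rewrite -expRD; congr expR; field.
have -> : expR (- (2 * b) * N.+1%:R) = expR (- (2 * b) * N%:R) * expR (- (2 * b)).
  by rewrite -expRD; congr expR; rewrite -natr1; ring.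
move: (expR (- (b / 2))) (expR (_ * _)) (expR (- (2 * b))) d => A B C d.
by clear -d; field; rewrite gt_eqF.
Qed.

Lemma kpart_ge0 N b : 0 <= kpart N b.
Proof. by apply: sumr_ge0 => n _; exact: expR_ge0. Qed.

Lemma kpart_le N b : 0 < b -> kpart N b <= kker b.
Proof.
by move=> b0; rewrite kpartE// -[leRHS]mulr1 ler_wpM2l ?(ltW (kker_gt0 b0)).
Qed.

Lemma kpart_cvg b : 0 < b -> kpart N b @[N --> \oo] --> kker b.
Proof.
move=> b0; under eq_fun do rewrite kpartE//.
suff h : kker b * (1 - expR (- (2 * b) * N%:R)) @[N --> \oo] --> kker b * (1 - 0).
  by move: h; rewrite subr0 mulr1.
apply: cvgM; first exact: cvg_cst.
apply: cvgB; first exact: cvg_cst.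
rewrite -(cvg_shiftn 2).
have := @expRN_natl_cvg0 R (2 * b) ltac:(by rewrite mulr_gt0).
by apply: cvg_trans; apply: near_eq_cvg; apply: nearW => n /=; rewrite addn2 mulNr.
Qed.

(** Termwise integration by dominated convergence: the partial sums lie between 0 and [kker], and
    the bound C x on g absorbs the pole at 0. *)
Lemma kker_series (g : R -> R) C : measurable_fun setT g ->
  (forall x, 0 < x -> `|g x| <= C * x) ->
  (forall n, intg (hp (fun b => expR (- (2 * (n%:R + 1 / 4) * b)) * g b))) ->
  (\sum_(n < N) int (hp (fun b => expR (- (2 * (n%:R + 1 / 4) * b)) * g b)))
    @[N --> \oo] --> int (hp (fun b => kker b * g b)).
Proof.
move=> mg gx gi.
have e N b : hp (fun b => kpart N b * g b) b =
   \sum_(n < N) hp (fun b => expR (- (2 * (n%:R + 1 / 4) * b)) * g b) b.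
  rewrite /hp; case: ifPn => _; last by rewrite big1.
  by rewrite /kpart mulr_suml.
have iN N : intg (hp (fun b => kpart N b * g b)).
  have := @intg_sum R _ (index_enum 'I_N) xpredT (fun n => hp (fun b => expR (- (2 * (n%:R + 1 / 4) * b)) * g b)) (fun n _ => gi n).
  by apply: eq_intg => b; rewrite e.
have [] := @dct R (fun N => hp (fun b => kpart N b * g b)) (hp (fun b => kker b * g b))
  (fun b => `|hp (fun b => kker b * g b) b|).
- by move=> n; exact: intg_mes.
- move=> x; have [x0|x0] := ltP 0 x; last first.
    by rewrite hp_le0//; under eq_fun do rewrite hp_le0//; exact: cvg_cst.
  rewrite hp_gt0//; under eq_fun do rewrite hp_gt0//.
  by apply: cvgM; [exact: kpart_cvg|exact: cvg_cst].
- move=> n x; rewrite /hp; case: ifPn => x0; last by rewrite normr0.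
  rewrite 2!normrM ler_wpM2r// (ger0_norm (kpart_ge0 _ _)) (gtr0_norm (kker_gt0 x0)).
  exact: kpart_le.
- by apply: intg_norm; exact: intg_kker_le gx.
move=> _ h _; apply: cvg_trans h; apply: near_eq_cvg; apply: nearW => N.
rewrite (eq_int (e N)) int_sum// => n _; exact: gi.
Qed.

Lemma hp_mul_exp l : 0 < l ->
  intg (hp (fun b => expR (- (l * b)) * b)) /\
  int (hp (fun b => expR (- (l * b)) * b)) = l^-1 ^+ 2.
Proof.
move=> l0; have l1 : l != 0 by rewrite gt_eqF.
have g2 : intg (hp (@gammaf R 2)) by exact: intg_gammaf.
have e b : hp (gammaf 2) (l * b + 0) = l * hp (fun b => expR (- (l * b)) * b) b.
  rewrite addr0 /hp pmulr_rgt0//; case: ifPn => b0; last by rewrite mulr0.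
  rewrite /gammaf (_ : 2 - 1 = 1 :> R); last ring.
  by rewrite powRr1 ?mulr_ge0 ?ltW//; ring.
have i1 := intg_affine 0 l1 g2; have i2 := int_affine 0 l1 g2.
have i3 : intg (hp (fun b => expR (- (l * b)) * b)).
  by apply: eq_intg (intgZ l^-1 i1) => b; rewrite e mulKf.
split => //; apply: (mulfI l1); rewrite -intZ// -(eq_int e) i2 gtr0_norm//.
rewrite -GammaE (_ : 2 = 1 + 1 :> R); last ring.
rewrite Gamma_succ// mul1r GammaE.
have -> : int (hp (gammaf 1)) = 1 :> R.
  have [_ h1] := @hp_exp R 1 ltac:(by []); rewrite -[RHS]invr1 -[RHS]h1.
  by apply: eq_int; apply: eq_hp => x x0; rewrite /gammaf subrr powRr0 !mul1r.
by rewrite mulr1 expr2 mulVKf.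
Qed.

(** On the half-line min(b, t) is b minus the ramp max(0, b - t), and e^(-lb) times that ramp is
    e^(-lt) times a translate by t of the integrand of [hp_mul_exp]. *)
Lemma hp_exp_min l t : 0 < l -> 0 <= t ->
  intg (hp (fun b => expR (- (l * b)) * Num.min b t)) /\
  int (hp (fun b => expR (- (l * b)) * Num.min b t)) = (1 - expR (- (l * t))) * l^-1 ^+ 2.
Proof.
move=> l0 t0; have [i1 e1] := hp_mul_exp l0.
have i2 := intgZ (expR (- (l * t))) (intg_shift (- t) i1).
have e b : hp (fun b => expR (- (l * b)) * Num.min b t) b =
    hp (fun b => expR (- (l * b)) * b) b -
    expR (- (l * t)) * hp (fun b => expR (- (l * b)) * b) (b - t).
  rewrite /hp subr_gt0; have [bt|bt] := ltP t b.
    rewrite (le_lt_trans t0 bt) mulrA -expRD (_ : - (l * t) + _ = - (l * b)); last ring.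
    by ring.
  by rewrite mulr0 subr0; case: ifPn.
split; first by apply: eq_intg (intgB i1 i2) => b; rewrite e.
rewrite (eq_int e) intB// intZ ?int_shift//; last exact: intg_shift.
by rewrite e1; ring.
Qed.

(** The n-th term integrates to 1/(2(n + 1/4)) - 1/(2(n + 1/2)). The partial sums are differences of
    two [psin], in which the logarithms cancel. *)
Lemma int_kker_one : 
  int (hp (fun b => kker b * (1 - expR (- (b / 2))))) = (digamma (1 / 2) - digamma (1 / 4)) / 2.
Proof.
have me : measurable_fun setT (fun b : R => 1 - expR (- (b / 2))).
  apply: measurable_funB => //; apply: measurableT_comp => //.
  by apply: measurableT_comp => //; exact: measurable_funM.
have n4 n : 0 < 2 * (n%:R + 1 / 4) :> R by rewrite mulr_gt0// ltr_wpDl.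
have n2 n : 0 < 2 * (n%:R + 1 / 2) :> R by rewrite mulr_gt0// ltr_wpDl.
have e n b : hp (fun b => expR (- (2 * (n%:R + 1 / 4) * b)) * (1 - expR (- (b / 2)))) b =
   hp (fun b => expR (- (2 * (n%:R + 1 / 4) * b))) b - hp (fun b => expR (- (2 * (n%:R + 1 / 2) * b))) b.
  rewrite /hp; case: ifPn => _; last by rewrite subrr.
  by rewrite mulrBr mulr1 -expRD; congr (_ - expR _); field.
have hN (n : nat) : intg (hp (fun b => expR (- (2 * (n%:R + 1 / 4) * b)) * (1 - expR (- (b / 2))))).
  by apply: eq_intg (intgB (hp_exp (n4 n)).1 (hp_exp (n2 n)).1) => b; rewrite e.
have := @kker_series (fun b => 1 - expR (- (b / 2))) 1 me _ hN.
move=> /(_ _)/wrap[|h].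
  move=> x x0; rewrite ger0_norm; last by rewrite subr_ge0 expR_le1 oppr_le0 divr_ge0// ltW.
  by have := expR_ge1Dx (- (x / 2)); lra.
apply: cvg_unique h _ => //.
have p4 : 0 < (1 / 4 : R) by []. have p2 : 0 < (1 / 2 : R) by [].
have h2 : (psin (1 / 2 : R) N - psin (1 / 4) N) / 2 @[N --> \oo] -->
    ((digamma (1 / 2) - digamma (1 / 4)) / 2 : R).
  by apply: cvgM; [apply: cvgB; exact: digamma_cvg|exact: cvg_cst].
apply: cvg_trans h2; apply: near_eq_cvg; apply: nearW => N.
rewrite /psin [X in X * _](_ : _ = \sum_(n < N) ((1 / 4 + n%:R)^-1 - (1 / 2 + n%:R)^-1)); last first.
  by rewrite sumrB; ring.
rewrite mulr_suml; apply: eq_bigr => n _.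
rewrite (eq_int (e n)) intB; [|exact: (hp_exp (n4 n)).1|exact: (hp_exp (n2 n)).1].
rewrite (hp_exp (n4 n)).2 (hp_exp (n2 n)).2 !invfM mulrBl mulrC (mulrC _ 2^-1).
by congr (_ * _^-1 - _ * _^-1); rewrite addrC.
Qed.

End ArchimedeanKernel.

(** * The screw function as a superposition of ramps *)

Section ScrewFormula.
Context {R : realType}.
Implicit Types b s t x y L : R.

Lemma cvg_extn (u v : nat -> R) (l : R) : u =1 v ->
  v n @[n --> \oo] --> l -> u n @[n --> \oo] --> l.
Proof. by move=> /funext ->. Qed.

Let H (n : nat) : R := \sum_(k < n) (1 + k%:R)^-1.

Lemma euler_mascheroniE : euler_mascheroni = - digamma (1 : R).
Proof.
rewrite /euler_mascheroni; apply: cvg_lim => //.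
apply: cvg_extn (cvgN (@digamma_cvg R 1 ltac:(by []))) => n.
rewrite /psin/= -[RHS]/(- (_ - _)) opprB; congr (_ - _).
rewrite big_add1 big_mkord; apply: eq_bigr => k _.
by rewrite /= -natr1 addrC.
Qed.

(** The terms are 2 / (2k + 1): twice the harmonic sum up to 2N, without its even denominators. *)
Lemma sum_half_odd N : \sum_(k < N) (1 / 2 + k%:R)^-1 = 2 * H N.*2 - H N.
Proof.
elim: N => [|N IH]; first by rewrite /H !big_ord0 mulr0 subrr.
rewrite big_ord_recr/= IH /H doubleS !big_ord_recr/= -addnn natrD.
have : 0 <= N%:R :> R by [].
rewrite -[(N + N).+1%:R]natr1 natrD.
move: (\sum_(_ < N) _) (\sum_(_ < (N + N)%N) _) (N%:R) => A B x x0; field.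
by rewrite !gt_eqF//; lra.
Qed.

Lemma digamma_half : digamma (1 / 2 : R) = digamma 1 - 2 * ln 2.
Proof.
have h1 : psin (1 : R) N @[N --> \oo] --> digamma 1 by exact: digamma_cvg.
have h2 : psin (1 : R) N.*2 @[N --> \oo] --> digamma 1.
  apply: (@cvg_comp _ _ _ double (psin 1) _ \oo) => //.
  move=> P [n _ nP]; exists n => // m nm; apply: nP => /=.
  by rewrite (leq_trans nm)// -addnn leq_addr.
have h3 : psin (1 / 2 : R) N @[N --> \oo] --> digamma (1 / 2).
  by apply: digamma_cvg; rewrite divr_gt0.
apply: cvg_unique h3 _ => //.
have h4 : 2 * psin (1 : R) N.*2 - psin 1 N - 2 * ln 2 @[N --> \oo] -->
    (2 * digamma 1 - digamma 1 - 2 * ln 2 : R).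
  apply: cvgB; last exact: cvg_cst.
  by apply: cvgB => //; apply: cvgM => //; exact: cvg_cst.
rewrite (_ : digamma 1 - _ = 2 * digamma 1 - digamma 1 - 2 * ln 2); last ring.
apply: cvg_trans h4; apply: near_eq_cvg; near=> N.
have N0 : 0 < N%:R :> R by rewrite ltr0n; near: N; exact: nbhs_infty_gt.
rewrite /psin sum_half_odd -/(H _) -/(H _) -muln2 natrM lnM ?posrE//.
by move: (ln _) (ln _) (H _) (H _) => A B C D; ring.
Unshelve. all: by end_near. Qed.

(** The added integral is the coefficient of f(0) that appears when 2 e^(-x/2) f(0) is replaced by 2
    f(0) under the archimedean integral. With it the constant of the functional becomes the one in
    the linear term of [screw]. *)
Lemma weil_constant :
  ln (4 * pi) + euler_mascheroni + 2 * int (hp (fun b => kker b * (1 - expR (- (b / 2)))))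
  = ln pi - digamma (1 / 4) :> R.
Proof.
rewrite int_kker_one digamma_half euler_mascheroniE lnM ?posrE ?pi_gt0//.
have -> : ln 4 = 2 * ln 2 :> R.
  by rewrite (_ : 4 = 2 ^+ 2) ?lnXn//; [ring|ring].
by move: (digamma _) (digamma _) (ln _) (ln _) => A B C D; field.
Qed.

Lemma kker_min_cvg t : 0 <= t ->
  (\sum_(n < N) (1 - expR (- (2 * (n%:R + 1 / 4) * t))) * (2 * (n%:R + 1 / 4))^-1 ^+ 2)
   @[N --> \oo] --> int (hp (fun b => kker b * Num.min b t)).
Proof.
move=> t0; have n4 n : 0 < 2 * (n%:R + 1 / 4) :> R by rewrite mulr_gt0// ltr_wpDl.
have := @kker_series R (fun b => Num.min b t) 1 _ _ (fun n => (hp_exp_min (n4 n) t0).1).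
move=> /(_ _ _)/wrap[| |h].
- by apply: measurable_minr.
- move=> x x0; rewrite mul1r ger0_norm ?ge_min ?lexx//.
  by rewrite le_min t0 ltW.
apply: cvg_trans h; apply: near_eq_cvg; apply: nearW => N.
by apply: eq_bigr => n _; rewrite (hp_exp_min (n4 n) t0).2.
Qed.

Lemma kker_id_cvg :
  (\sum_(n < N) (2 * (n%:R + 1 / 4))^-1 ^+ 2) @[N --> \oo] -->
  (int (hp (fun b => kker b * b)) : R).
Proof.
have n4 n : 0 < 2 * (n%:R + 1 / 4) :> R by rewrite mulr_gt0// ltr_wpDl.
have := @kker_series R id 1 _ _ (fun n => (hp_mul_exp (n4 n)).1).
move=> /(_ _ _)/wrap[| |h].
- by [].
- by move=> x x0; rewrite mul1r gtr0_norm.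
apply: cvg_trans h; apply: near_eq_cvg; apply: nearW => N.
by apply: eq_bigr => n _; rewrite (hp_mul_exp (n4 n)).2.
Qed.

(** Up to the factor 4, the n-th terms of the two series combine into (1 - e^(-2(n + 1/4)t)) / (2(n
    + 1/4))^2, which is the integral of e^(-2(n + 1/4)b) min(b, t). *)
Lemma lerch_kker t : 0 <= t ->
  1 / 4 * (lerch 1 2 (1 / 4) - expR (- t / 2) * lerch (expR (- (2 * t))) 2 (1 / 4))
  = int (hp (fun b => kker b * Num.min b t)).
Proof.
move=> t0.
have n4 n : 0 < n%:R + 1 / 4 :> R by rewrite ltr_wpDl.
have pw n z : (n%:R + 1 / 4) `^ (- 2) * z = 4 * ((2 * (n%:R + 1 / 4))^-1 ^+ 2 * z) :> R.
  rewrite (powR_invn 2 (ltW (n4 n))); field.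
  by rewrite gt_eqF.
have l1 : lerch 1 2 (1 / 4) = 4 * int (hp (fun b => kker b * b)) :> R.
  apply: cvg_lim => //.
  apply: cvg_extn (cvgM (cvg_cst (4 : R)) kker_id_cvg) => N.
  rewrite /series/= big_mkord mulr_sumr; apply: eq_bigr => n _.
  by rewrite pw expr1n mulr1.
have l2 : lerch (expR (- (2 * t))) 2 (1 / 4) = expR (t / 2) * 4 *
    (int (hp (fun b => kker b * b)) - int (hp (fun b => kker b * Num.min b t))) :> R.
  apply: cvg_lim => //.
  apply: (@cvg_extn _ (fun N => expR (t / 2) * 4 * (\sum_(n < N) (2 * (n%:R + 1 / 4))^-1 ^+ 2 -
    \sum_(n < N) (1 - expR (- (2 * (n%:R + 1 / 4) * t))) * (2 * (n%:R + 1 / 4))^-1 ^+ 2))); last first.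
    by apply: cvgM; [exact: cvg_cst|apply: cvgB; [exact: kker_id_cvg|exact: kker_min_cvg]].
  move=> N; rewrite /series/= big_mkord -sumrB mulr_sumr; apply: eq_bigr => n _.
  rewrite pw -expRM_natr.
  (* The shift of n by 1/4 costs e^(t/2), which the prefactor e^(-t/2) of the second Lerch series
     removes at the end. *)
  rewrite (_ : - (2 * t) * n%:R = - (2 * (n%:R + 1 / 4) * t) + t / 2); last by field.
  by rewrite expRD; ring.
have e : expR (- t / 2) * expR (t / 2) = 1 by rewrite mulNr mulrC expRxMexpNx_1.
rewrite l1 l2; move: (expR _) (expR _) (int _) (int _) e => A B C D e.
have -> : B * (A * 4 * (D - C)) = (B * A) * 4 * (D - C) by ring.
by rewrite e; field.
Qed.

Definition TT b t : R := Num.max 0 (`|t| - b).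

Definition cosh2 b : R := expR (b / 2) + expR (- b / 2).

Lemma continuous_cosh2 : continuous cosh2.
Proof.
move=> x; apply: cvgD; apply: continuous_comp; try exact: continuous_expR.
  by apply: cvgM; [exact: cvg_id|exact: cvg_cst].
by apply: cvgM; [apply: cvgN; exact: cvg_id|exact: cvg_cst].
Qed.

Lemma mes_cosh2 : measurable_fun setT cosh2.
Proof. by apply: continuous_measurable_fun; exact: continuous_cosh2. Qed.

Lemma TT_le0 b t : `|t| <= b -> TT b t = 0.
Proof. by move=> tb; rewrite /TT max_l// subr_le0. Qed.

Lemma TT_ge0 b t : b <= `|t| -> TT b t = `|t| - b.
Proof. by move=> tb; rewrite /TT max_r// subr_ge0. Qed.

(** Taylor's formula at 0 with integral remainder, for the function 4 [cosh2], whose second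
    derivative is [cosh2] and whose slope at 0 is 0. *)
Lemma int_cosh2_TT L t : `|t| <= L ->
  int (fun b => \1_(`[0, L]%classic) b * (cosh2 b * TT b t)) =
  4 * (expR (t / 2) + expR (- t / 2) - 2).
Proof.
move=> tL; have -> : expR (t / 2) + expR (- t / 2) = expR (`|t| / 2) + expR (- `|t| / 2).
  by have [t0|t0] := ger0P t => //; rewrite opprK addrC.
have : 0 <= `|t| by []. move: tL; rewrite /TT; move: `|t| => {}t tL; rewrite le_eqVlt => /predU1P[<-|t0].
  rewrite oppr0 mul0r expR0 -[2](natrD R 1 1) subrr mulr0 -[RHS](@int0 R).
  apply: eq_int => b; rewrite indicE; have [/set_mem/=|_] := boolP (b \in _); last by rewrite mul0r.
  by rewrite in_itv/= => /andP[b0 _]; rewrite max_l ?mulr0// sub0r oppr_le0.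
have -> : int (fun b => \1_(`[0, L]%classic) b * (cosh2 b * Num.max 0 (t - b))) =
    int (fun b => \1_(`[0, t]%classic) b * (cosh2 b * (t - b))).
  apply: eq_int => b; rewrite !indicE.
  have [/set_mem/=|bt] := boolP (b \in (`[0, t]%classic : set R)).
    rewrite in_itv/= => /andP[b0 bt]; rewrite mem_set/= ?in_itv/= ?b0 ?(le_trans bt)//.
    by rewrite max_r// subr_ge0.
  rewrite mul0r; have [/set_mem/=|_] := boolP (b \in (`[0, L]%classic : set R)); last by rewrite mul0r.
  rewrite in_itv/= => /andP[b0 _]; rewrite max_l ?mulr0// subr_le0 leNgt; apply/negP => bt'.
  by move/negP: bt; apply; rewrite mem_set//= in_itv/= b0 ltW.
rewrite -Rintegral_setT /Rintegral.
pose F b := (t - b) * (2 * (expR (b / 2) - expR (- b / 2))) + 4 * cosh2 b.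
have dF b : is_derive b 1 F (cosh2 b * (t - b)).
  by apply: is_derive_eq; rewrite /GRing.scale/= /cosh2; field.
have cF : continuous F.
  by move=> b; apply: differentiable_continuous; apply/derivable1_diffP; have := dF b.
rewrite (@continuous_FTC2 _ (fun b => cosh2 b * (t - b)) F)//=.
- by rewrite /F /cosh2 subrr mul0r !mul0r oppr0 mul0r expR0 subrr; ring.
- apply: continuous_subspaceT => b; apply: cvgM; first exact: continuous_cosh2.
  by apply: cvgB; [exact: cvg_cst|exact: cvg_id].
- split; first by move=> x _; have := dF x.
  + by apply: cvg_at_right_filter; exact: cF.
  + by apply: cvg_at_left_filter; exact: cF.
- by move=> x _; rewrite derive1E; have := dF x => ?; rewrite derive_val.
Qed.

(** The ramp at ln n vanishes once ln n >= |t|, so the range of summation can be made independent of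
    t. *)
Lemma screw_primes L t (N : nat) : `|t| <= L -> expR L <= N%:R ->
  \sum_(1 <= n < (Num.truncn (expR `|t|)).+1)
      von_mangoldt n / Num.sqrt n%:R * (`|t| - ln n%:R) =
  \sum_(1 <= n < N.+1) von_mangoldt n / Num.sqrt n%:R * TT (ln n%:R) t.
Proof.
move=> tL LN; have := truncn_itv (expR_ge0 `|t|); set m := Num.truncn _ => /andP[m1 m2].
have mN : (m <= N)%N.
  by rewrite -(ler_nat R) (le_trans m1)// (le_trans _ LN)// ler_expR.
rewrite [RHS](@big_cat_nat _ _ _ m.+1)//= [X in _ = _ + X]big1_seq ?addr0; last first.
  move=> n; rewrite mem_index_iota => /andP[_ /andP[mn _]].
  rewrite TT_le0 ?mulr0//.
  have n0 : 0 < n%:R :> R by rewrite ltr0n (leq_trans _ mn).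
  rewrite -ler_expR lnK ?posrE// (le_trans (ltW m2))// ler_nat//.
apply: eq_big_seq => n; rewrite mem_index_iota => /andP[n1 nm].
rewrite TT_ge0// -ler_expR lnK ?posrE ?ltr0n//.
by apply: le_trans m1; rewrite ler_nat.
Qed.

Lemma screwE L t (N : nat) : `|t| <= L -> expR L <= N%:R ->
  screw t = - int (fun b => \1_(`[0, L]%classic) b * (cosh2 b * TT b t))
   + \sum_(1 <= n < N.+1) von_mangoldt n / Num.sqrt n%:R * TT (ln n%:R) t
   - (digamma (1 / 4) - ln pi) / 2 * `|t|
   - int (hp (fun b => kker b * Num.min b `|t|)).
Proof.
move=> tL LN; rewrite /screw lerch_kker// (screw_primes tL LN) int_cosh2_TT//.
by move: (int _) (\sum_(_ <= _ < _) _) (digamma _) (ln pi) => A B C D; field.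
Qed.

End ScrewFormula.

(** * The archimedean energy *)

Definition enI {R : realType} (v w : R -> R) : R -> R := hp (fun x => kker x * NN v w x).

(* The unbounded part of the Weil form. Sealed: unification would otherwise unfold
   the integral when comparing energies. *)
HB.lock Definition EE {R : realType} (v w : R -> R) : R := int (enI v w).

Section Energy.
Context {R : realType}.
Implicit Types u v w : R -> R.

Definition dE v : Prop := intg (enI v v).

Lemma EE_int v w : EE v w = int (enI v w).
Proof. by rewrite EE.unlock. Qed.

Lemma enI_ge0 v x : 0 <= enI v v x.
Proof. by rewrite /enI; apply: hp_ge0 => y y0; rewrite mulr_ge0 ?NN_ge0// ltW// kker_gt0. Qed.

Lemma EE_ge0 v : 0 <= EE v v.
Proof. by rewrite EE_int; apply: int_ge0 => x; exact: enI_ge0. Qed.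

Lemma mes_enI v w : L2r v -> L2r w -> measurable_fun setT (enI v w).
Proof. by move=> vL wL; apply: mes_kkerM; exact: mes_NN. Qed.

Lemma intg_enI v w : L2r v -> L2r w -> dE v -> dE w -> intg (enI v w).
Proof.
move=> vL wL vE wE; apply: intg_dom (intgZ 2^-1 (intgD vE wE)); first exact: mes_enI.
move=> x; rewrite /enI /hp; case: ifPn => x0; last by rewrite normr0 addr0 mulr0.
rewrite normrM (gtr0_norm (kker_gt0 x0)) -mulrDr mulrCA ler_wpM2l ?(ltW (kker_gt0 x0))//.
by have := NN_abs_le x vL wL; rewrite mulrC.
Qed.

Lemma enIC v w : enI v w = enI w v.
Proof. by apply/funext => x; rewrite /enI; apply: eq_hp => y _; rewrite NNC. Qed.

Lemma EEC v w : EE v w = EE w v.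
Proof. by rewrite !EE_int enIC. Qed.

Lemma enIDl u v w x : L2r u -> L2r v -> L2r w ->
  enI (fun y => u y + v y) w x = enI u w x + enI v w x.
Proof.
move=> uL vL wL; rewrite /enI /hp; case: ifPn => _; last by rewrite addr0.
by rewrite NNDl// mulrDr.
Qed.

Lemma enIBl u v w x : L2r u -> L2r v -> L2r w ->
  enI (fun y => u y - v y) w x = enI u w x - enI v w x.
Proof.
move=> uL vL wL; rewrite /enI /hp; case: ifPn => _; last by rewrite subr0.
by rewrite NNBl// mulrBr.
Qed.

Lemma enIZl c v w x : L2r v -> L2r w ->
  enI (fun y => c * v y) w x = c * enI v w x.
Proof.
move=> vL wL; rewrite /enI /hp; case: ifPn => _; last by rewrite mulr0.
by rewrite NNZl// mulrCA.
Qed.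

Lemma dED v w : L2r v -> L2r w -> dE v -> dE w -> dE (fun x => v x + w x).
Proof.
move=> vL wL vE wE; have vwL := L2rD vL wL.
have i1 := intg_enI vL wL vE wE.
apply: eq_intg (intgD (intgD vE wE) (intgZ 2 i1)) => x.
rewrite enIDl// !(enIC _ (fun _ => _ + _)) !enIDl// (enIC w v); ring.
Qed.

Lemma dEZ c v : L2r v -> dE v -> dE (fun x => c * v x).
Proof.
move=> vL vE; have cL := L2rZ c vL; apply: eq_intg (intgZ (c ^+ 2) vE) => x.
by rewrite enIZl// enIC enIZl//; ring.
Qed.

Lemma dEB v w : L2r v -> L2r w -> dE v -> dE w -> dE (fun x => v x - w x).
Proof.
move=> vL wL vE wE; have := dED vL (L2rZ (-1) wL) vE (dEZ (-1) wL wE).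
by congr dE; apply/funext => x; rewrite mulN1r.
Qed.

Lemma EEDl u v w : L2r u -> L2r v -> L2r w -> dE u -> dE v -> dE w ->
  EE (fun x => u x + v x) w = EE u w + EE v w.
Proof.
move=> uL vL wL uE vE wE; rewrite !EE_int -intD; try exact: intg_enI.
by apply: eq_int => x; exact: enIDl.
Qed.

Lemma EEBl u v w : L2r u -> L2r v -> L2r w -> dE u -> dE v -> dE w ->
  EE (fun x => u x - v x) w = EE u w - EE v w.
Proof.
move=> uL vL wL uE vE wE; rewrite !EE_int -intB; try exact: intg_enI.
by apply: eq_int => x; exact: enIBl.
Qed.

Lemma EEZl c v w : L2r v -> L2r w -> dE v -> dE w ->
  EE (fun x => c * v x) w = c * EE v w.
Proof.
move=> vL wL vE wE; rewrite !EE_int -intZ; try exact: intg_enI.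
by apply: eq_int => x; exact: enIZl.
Qed.

Lemma EED v w : L2r v -> L2r w -> dE v -> dE w ->
  EE (fun x => v x + w x) (fun x => v x + w x) = EE v v + EE w w + 2 * EE v w.
Proof.
move=> vL wL vE wE; have sL := L2rD vL wL; have sE := dED vL wL vE wE.
by rewrite EEDl// !(EEC _ (fun x => v x + w x)) !EEDl// (EEC w v); ring.
Qed.

Lemma EEB v w : L2r v -> L2r w -> dE v -> dE w ->
  EE (fun x => v x - w x) (fun x => v x - w x) = EE v v + EE w w - 2 * EE v w.
Proof.
move=> vL wL vE wE; have sL := L2rB vL wL; have sE := dEB vL wL vE wE.
by rewrite EEBl// !(EEC _ (fun x => v x - w x)) !EEBl// (EEC w v); ring.
Qed.

Lemma quadratic_discr (A B C : R) : 0 <= A -> 0 <= B ->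
  (forall t, 0 <= A + t ^+ 2 * B - 2 * (t * C)) -> C ^+ 2 <= A * B.
Proof.
move=> A0 B0 h; have [w0|w0] := eqVneq B 0.
  rewrite w0 mulr0 leNgt; apply/negP => ip0.
  have := h ((A + 1) / 2 / C); rewrite w0 mulr0 addr0.
  rewrite divfK; last by apply/eqP => e; rewrite e expr0n/= ltxx in ip0.
  lra.
have wp : 0 < B by rewrite lt_neqAle eq_sym w0 B0.
have := h (C / B); rewrite -(pmulr_lge0 _ wp) => {}h.
rewrite -subr_ge0; apply: le_trans h _; rewrite le_eqVlt; apply/orP; left.
by apply/eqP; field.
Qed.

Lemma EE_sqr_le v w : L2r v -> L2r w -> dE v -> dE w ->
  EE v w ^+ 2 <= EE v v * EE w w.
Proof.
move=> vL wL vE wE; apply: quadratic_discr; [exact: EE_ge0|exact: EE_ge0|move=> t].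
have tL := L2rZ t wL; have tE := dEZ t wL wE.
have := EE_ge0 (fun x => v x - t * w x).
by rewrite EEB// EEZl// !(EEC _ (fun x => t * w x)) !EEZl// (EEC w v); congr (_ <= _); ring.
Qed.

Lemma EE_cvg (u u' : nat -> R -> R) v w :
  (forall n, L2r (u n)) -> (forall n, L2r (u' n)) -> L2r v -> L2r w ->
  (forall n, dE (u n)) -> (forall n, dE (u' n)) -> dE v -> dE w ->
  EE (fun x => u n x - v x) (fun x => u n x - v x) @[n --> \oo] --> 0 ->
  EE (fun x => u' n x - w x) (fun x => u' n x - w x) @[n --> \oo] --> 0 ->
  EE (u n) (u' n) @[n --> \oo] --> EE v w.
Proof.
move=> uL u'L vL wL uE u'E vE wE uc vc; apply/subr_cvg0.
pose a n : R -> R := fun x => u n x - v x; pose b n : R -> R := fun x => u' n x - w x.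
have aL n : L2r (a n) by exact: L2rB.
have bL n : L2r (b n) by exact: L2rB.
have aE n : dE (a n) by exact: dEB.
have bE n : dE (b n) by exact: dEB.
have le x y : L2r x -> L2r y -> dE x -> dE y ->
    `|EE x y| <= Num.sqrt (EE x x) * Num.sqrt (EE y y).
  move=> xL yL xE yE; rewrite -sqrtrM ?EE_ge0// -sqrtr_sqr.
  by rewrite ler_wsqrtr// EE_sqr_le.
pose e n := Num.sqrt (EE (a n) (a n)); pose d n := Num.sqrt (EE (b n) (b n)).
have e0 : e n @[n --> \oo] --> 0 by exact: sqrt_cvg0.
have d0 : d n @[n --> \oo] --> 0 by exact: sqrt_cvg0.
apply: norm_cvg0.
apply: (@squeeze_cvgr _ _ _ _ (fun=> 0)
  (fun n => e n * d n + e n * Num.sqrt (EE w w) + Num.sqrt (EE v v) * d n)).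
- apply: nearW => n; rewrite normr_ge0/=.
  have -> : EE (u n) (u' n) - EE v w = EE (a n) (b n) + EE (a n) w + EE v (b n).
    rewrite (EEBl (uL n) vL (bL n))// (EEBl (uL n) vL wL)// !(EEC _ (b n)).
    by rewrite !(EEBl (u'L n) wL)// (EEC (u' n) (u n)) (EEC w (u n)) (EEC w v); ring.
  apply: le_trans (ler_normD _ _) _; apply: lerD; last exact: le.
  by apply: le_trans (ler_normD _ _) _; apply: lerD; exact: le.
- exact: cvg_cst.
- rewrite -[X in _ --> X](_ : 0 * 0 + 0 * Num.sqrt (EE w w) + Num.sqrt (EE v v) * 0 = 0).
    apply: cvgD; first apply: cvgD.
    + exact: cvgM.
    + by apply: cvgM => //; exact: cvg_cst.
    + by apply: cvgM => //; exact: cvg_cst.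
  by ring.
Qed.

Lemma NN_cvg (u : nat -> R -> R) v x : (forall n, L2r (u n)) -> L2r v ->
  nr (fun y => u n y - v y) @[n --> \oo] --> 0 ->
  NN (u n) (u n) x @[n --> \oo] --> NN v v x.
Proof.
move=> uL vL uc; rewrite NN_nr; under eq_fun do rewrite NN_nr.
apply: nr_cvg => [n||]; try exact: L2r_diff.
apply: (@squeeze_cvgr _ _ _ _ (fun=> 0) (fun n => 4 * nr (fun y => u n y - v y))).
- apply: nearW => n; rewrite nr_ge0/=.
  have dL : L2r (fun y => u n y - v y) by exact: L2rB.
  have := NN_le x dL; rewrite NN_nr; congr (_ <= _).
  by apply: eq_int => y; ring.
- exact: cvg_cst.
- by rewrite -[X in _ --> X](mulr0 4); apply: cvgM => //; exact: cvg_cst.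
Qed.

Lemma enI_cvg (u : nat -> R -> R) v x : (forall n, L2r (u n)) -> L2r v ->
  nr (fun y => u n y - v y) @[n --> \oo] --> 0 ->
  enI (u n) (u n) x @[n --> \oo] --> enI v v x.
Proof.
move=> uL vL uc; rewrite /enI /hp; case: ifPn => _; last exact: cvg_cst.
by apply: cvgM; [exact: cvg_cst|exact: NN_cvg].
Qed.

Lemma energy_lsc (u : nat -> R -> R) v (c : nat -> R) l :
  (forall n, L2r (u n)) -> L2r v -> (forall n, dE (u n)) ->
  nr (fun y => u n y - v y) @[n --> \oo] --> 0 ->
  (forall n, EE (u n) (u n) <= c n) -> c n @[n --> \oo] --> l ->
  dE v /\ EE v v <= l.
Proof.
move=> uL vL uE uc uc' cl; rewrite EE_int; apply: (@fatou_le _ _ _ c l uE) => //.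
- by move=> n x; exact: enI_ge0.
- by move=> x; exact: enI_cvg.
- by move=> n; rewrite -EE_int.
Qed.

Lemma energy_cauchy (u : nat -> R -> R) v :
  (forall n, L2r (u n)) -> L2r v -> (forall n, dE (u n)) ->
  nr (fun y => u n y - v y) @[n --> \oo] --> 0 ->
  (forall e, 0 < e -> exists N : nat, forall n m, (N <= n)%N -> (N <= m)%N ->
    EE (fun x => u n x - u m x) (fun x => u n x - u m x) <= e) ->
  dE v /\ EE (fun x => u n x - v x) (fun x => u n x - v x) @[n --> \oo] --> 0.
Proof.
move=> uL vL uE uc C.
have key e : 0 < e -> exists N : nat, forall n, (N <= n)%N ->
    dE (fun x => u n x - v x) /\ EE (fun x => u n x - v x) (fun x => u n x - v x) <= e.
  move=> e0; have [N hN] := C e e0; exists N => n nN.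
  (* Here n is fixed and the index m tends to infinity, so the Cauchy bound passes to u n - v. *)
  apply: (@energy_lsc (fun m x => u n x - u (m + N)%N x) _ (fun=> e)).
  - by move=> m; exact: L2rB.
  - exact: L2rB.
  - by move=> m; exact: dEB.
  - have := uc; rewrite -(cvg_shiftn N).
    apply: cvg_trans; apply: near_eq_cvg; apply: nearW => m /=.
    by apply: eq_int => y; ring.
  - by move=> m; apply: hN => //; rewrite leq_addl.
  - exact: cvg_cst.
split.
  have [N /(_ _ (leqnn N))[dN _]] := key 1 ltac:(by []).
  have := dEB (uL N) (L2rB (uL N) vL) (uE N) dN.
  by congr dE; apply/funext => x; ring.
apply/cvgr0Pnorm_le => e e0; have [N hN] := key e e0.
exists N => // n /= nN; rewrite ger0_norm ?EE_ge0//.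
by case: (hN n nN).
Qed.

(** The minima min(F n, f) are dominated by f and converge to f; their integrals give Fatou's lower
    bound as a convergent minorant. *)
Lemma fatou_near (F : nat -> R -> R) f : (forall n, intg (F n)) ->
  (forall n x, 0 <= F n x) -> (forall x, F n x @[n --> \oo] --> f x) -> intg f ->
  exists2 c : nat -> R, (forall n, c n <= int (F n)) & c n @[n --> \oo] --> int f.
Proof.
move=> Fi F0 Ff fi; exists (fun n => int (fun x => Num.min (F n x) (f x))).
  move=> n; apply: int_le => //; last by move=> x; rewrite ge_min lexx.
  apply: intg_dom (intgD (intg_norm (Fi n)) (intg_norm fi)).
    by apply: measurable_minr; apply: intg_mes.
  by move=> x; rewrite /Num.min; case: ifPn => _; rewrite ?lerDl ?lerDr.
have f0 x : 0 <= f x.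
  by rewrite -(cvg_lim _ (Ff x))//; apply: limr_ge; [exact: cvgP (Ff x)|exact: nearW].
have [] := @dct R (fun n x => Num.min (F n x) (f x)) f f.
- by move=> n; apply: measurable_minr; apply: intg_mes.
- move=> x; apply: (@squeeze_cvgr _ _ _ _ (fun n => f x - `|F n x - f x|) (fun=> f x)).
  + apply: nearW => n; rewrite ge_min lexx orbT andbT /Num.min; case: ifPn => _.
      by rewrite lerBlDr distrC -lerBlDl ler_norm.
    by rewrite gerBl.
  + rewrite -[X in _ --> X]subr0; apply: cvgB; first exact: cvg_cst.
    by rewrite -(@normr0 _ R); apply: cvg_norm; apply/subr_cvg0; exact: Ff.
  + exact: cvg_cst.
- move=> n x; rewrite ger0_norm; first by rewrite ge_min lexx orbT.
  by rewrite le_min F0 f0.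
- by [].
- by [].
Qed.

(** Convergence of the norms forces strong convergence: E(u - v) = 2 E(u) + 2 E(v) - E(u + v), where
    E(u + v) is asymptotically at least E(2v) = 4 E(v) by Fatou. *)
Lemma energy_strong (u : nat -> R -> R) v (c : nat -> R) :
  (forall n, L2r (u n)) -> L2r v -> (forall n, dE (u n)) -> dE v ->
  nr (fun y => u n y - v y) @[n --> \oo] --> 0 ->
  (forall n, EE (u n) (u n) <= c n) -> c n @[n --> \oo] --> EE v v ->
  EE (fun x => u n x - v x) (fun x => u n x - v x) @[n --> \oo] --> 0.
Proof.
move=> uL vL uE vE uc uc' cl.
have sL n : L2r (fun x => u n x + v x) by exact: L2rD.
have sE n : dE (fun x => u n x + v x) by exact: dED.
have v2L := L2rD vL vL; have v2E := dED vL vL vE vE.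
have h x : enI (fun y => u n y + v y) (fun y => u n y + v y) x @[n --> \oo] -->
    enI (fun y => v y + v y) (fun y => v y + v y) x.
  apply: enI_cvg => //.
  apply: cvg_trans uc; apply: near_eq_cvg; apply: nearW => n.
  by apply: eq_int => y; ring.
have [d d1 d2] := fatou_near sE (fun n x => enI_ge0 _ x) h v2E.
apply: (@squeeze_cvgr _ _ _ _ (fun=> 0) (fun n => 2 * c n + 2 * EE v v - d n)).
- apply: nearW => n; rewrite EE_ge0/=.
  have := d1 n; rewrite -EE_int EED// EEB//; have := uc' n.
  by move: (EE _ _) (EE _ _) (EE _ _) => *; lra.
- exact: cvg_cst.
- rewrite -EE_int EED// in d2.
  rewrite -[X in _ --> X](_ : 2 * EE v v + 2 * EE v v - (EE v v + EE v v + 2 * EE v v) = 0).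
    apply: cvgB => //; apply: cvgD; last exact: cvg_cst.
    by apply: cvgM => //; exact: cvg_cst.
  by ring.
Qed.

(** Concavity of 1 - e^(-x) gives s k(s y) <= e^((1-s)y/2) k(y), and e^z - 1 <= z e^z bounds the
    excess. The hypothesis 1 - s <= 1/4 makes e^((1-s)y/2) <= e^(y/8), which the decay of y k(y) <=
    4 e^(-y/4) beats. *)
Lemma kker_scale (s y : R) : 3 / 4 <= s <= 1 -> 0 < y ->
  s * kker (s * y) <= kker y + (1 - s) * (2 * expR (- (8^-1 * y))).
Proof.
move=> /andP[s34 s1] y0; have s0 : 0 < s by apply: lt_le_trans s34; rewrite divr_gt0.
have sy : 0 < s * y by rewrite mulr_gt0.
have d1 := expR2N_lt1 y0; have d2 := expR2N_lt1 sy.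
(* The point p is the convex combination of 0 and -2y with weight s; the tangent to exp at p is
   evaluated at both points and averaged. *)
have concave : s * (1 - expR (- (2 * y))) <= 1 - expR (- (2 * (s * y))).
  set p := - (2 * (s * y)); have t0 := expR_ge1Dx (- p).
  have t1 := expR_ge1Dx (- (2 * y) - p).
  have ep : 0 < expR p by exact: expR_gt0.
  have e0 : expR p * expR (- p) = 1 by rewrite expRxMexpNx_1.
  have e1 : expR (- (2 * y)) = expR p * expR (- (2 * y) - p) by rewrite -expRD; congr expR; ring.
  have h0 : expR p * (1 - p) <= 1 by rewrite -[leRHS]e0 ler_wpM2l// ltW.
  have h1 : expR p * (1 + (- (2 * y) - p)) <= expR (- (2 * y)) by rewrite e1 ler_wpM2l// ltW.
  have : (1 - s) * (expR p * (1 - p)) + s * (expR p * (1 + (- (2 * y) - p))) = expR p.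
    by rewrite /p; ring.
  have : (1 - s) * (expR p * (1 - p)) <= (1 - s) * 1 by rewrite ler_wpM2l// subr_ge0.
  have : s * (expR p * (1 + (- (2 * y) - p))) <= s * expR (- (2 * y)) by rewrite ler_wpM2l// ltW.
  clear; move: (expR (- (2 * y))) (expR p) ((1 - s) * (expR p * _)) (s * (expR p * _)).
  by move=> A B C D; lra.
have step : s * kker (s * y) <= expR ((1 - s) * (y / 2)) * kker y.
  have -> : expR ((1 - s) * (y / 2)) * kker y = expR (- (s * y / 2)) / (1 - expR (- (2 * y))).
    by rewrite kkerE// mulrA -expRD; congr (expR _ / _); field.
  rewrite kkerE// mulrA ler_pdivrMr// [leRHS]mulrAC ler_pdivlMr//.
  by rewrite mulrAC mulrC ler_wpM2l// expR_ge0.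
apply: (le_trans step).
have e2 := expR_ge1Dx (- ((1 - s) * (y / 2))).
have e3 : expR ((1 - s) * (y / 2)) - 1 <= (1 - s) * (y / 2) * expR (8^-1 * y).
  have E := expRxMexpNx_1 ((1 - s) * (y / 2)).
  apply: le_trans (_ : (1 - s) * (y / 2) * expR ((1 - s) * (y / 2)) <= _).
    have := expR_gt0 ((1 - s) * (y / 2)).
    move: e2 E; move: ((1 - s) * (y / 2)) => z; move: (expR z) (expR (- z)) => B A e2 E B0.
    have : B * (1 + - z) <= B * A by rewrite ler_wpM2l// ltW.
    by rewrite E; lra.
  rewrite ler_wpM2l ?mulr_ge0 ?subr_ge0 ?(ltW y0)// ler_expR.
  rewrite (_ : 8^-1 * y = 4^-1 * (y / 2)); last by field.
  by rewrite ler_wpM2r ?divr_ge0 ?(ltW y0)//; lra.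
have k0 := kker_gt0 y0.
have h : kker y * y * expR (8^-1 * y) <= 4 * expR (- (8^-1 * y)).
  have := mul_kker_le y0.
  have -> : expR (- (4^-1 * y)) = expR (- (8^-1 * y)) * expR (- (8^-1 * y)).
    by rewrite -expRD; congr expR; field.
  have := expRxMexpNx_1 (8^-1 * y); have := expR_gt0 (8^-1 * y).
  move: (8^-1 * y) => z; move: (expR z) (expR (- z)) (kker y) => B A k B0 AB H.
  have : y * k * B <= 4 * (A * A) * B by rewrite ler_wpM2r// ltW.
  have -> : 4 * (A * A) * B = 4 * A * (B * A) by ring.
  by rewrite AB mulr1 (mulrC y).
have : (expR ((1 - s) * (y / 2)) - 1) * kker y <= (1 - s) * (y / 2) * expR (8^-1 * y) * kker y.
  by rewrite ler_wpM2r// ltW.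
have : (1 - s) / 2 * (kker y * y * expR (8^-1 * y)) <= (1 - s) / 2 * (4 * expR (- (8^-1 * y))).
  by rewrite ler_wpM2l// divr_ge0// subr_ge0.
move: (expR _) (expR _) (expR _) (kker y) => A B C k; clear; lra.
Qed.

(** After the substitution x = s y the dilation acts on the kernel alone, where [kker_scale]
    applies. The constant is 64 = 2 x 4 x 8: the 2 of that lemma, the bound [NN] <= 4 [nr], and the
    integral 8 of e^(-y/8). *)
Lemma dilation_energy (s : R) v : 3 / 4 <= s <= 1 -> L2r v -> dE v ->
  dE (fun x => v (s^-1 * x)) /\
  EE (fun x => v (s^-1 * x)) (fun x => v (s^-1 * x)) <= EE v v + (1 - s) * (64 * nr v).
Proof.
move=> s34 vL vE; have s0 : 0 < s by case/andP: s34 => h _; apply: lt_le_trans h; rewrite divr_gt0.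
have s1 : s <= 1 by case/andP: s34.
have sn : s != 0 by rewrite gt_eqF.
pose w x := v (s^-1 * x).
have wL : L2r w.
  have := L2r_affine 0 (invr_neq0 sn) vL.
  by congr L2r; apply/funext => x; rewrite addr0.
have Nw x : NN w w x = s * NN v v (s^-1 * x).
  rewrite !NN_nr /w /nr; have i := (L2r_diff (s^-1 * x) vL).2.
  have := int_affine 0 (invr_neq0 sn) i.
  rewrite normrV ?unitfE// invrK gtr0_norm// => <-.
  by apply: eq_int => y; rewrite addr0 -mulrBr.
have e x : enI w w (s * x + 0) = s * hp (fun x => kker (s * x) * NN v v x) x.
  rewrite addr0 /enI /hp pmulr_rgt0//; case: ifPn => x0; last by rewrite mulr0.
  by rewrite Nw mulKf// mulrCA.
have [ie int8] := @hp_exp R 8^-1 ltac:(by []).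
pose G x := enI v v x + (1 - s) * (8 * nr v) * hp (fun y => expR (- (8^-1 * y))) x.
have iG : intg G by apply: intgD => //; exact: intgZ.
have le x : enI w w (s * x + 0) <= G x.
  rewrite e /G /enI /hp; case: ifPn => x0; last by rewrite !mulr0 addr0.
  rewrite mulrA; have := kker_scale s34 x0.
  have := NN_le x vL; have := NN_ge0 v x; have e0 := expR_ge0 (- (8^-1 * x)).
  move: (NN v v x) (kker x) (kker _) (nr v) (expR _) e0 => N k k' r E e0 N0 N4 h.
  apply: le_trans (ler_wpM2r N0 h) _; rewrite mulrDl lerD2l.
  have : (1 - s) * (2 * E) * N <= (1 - s) * (2 * E) * (4 * r).
    by rewrite ler_wpM2l// !mulr_ge0// subr_ge0.
  by move=> H; apply: le_trans H _; rewrite le_eqVlt; apply/orP; left; apply/eqP; ring.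
have mw := mes_enI wL wL.
have iA : intg (fun x => enI w w (s * x + 0)).
  apply: intg_dom iG; first exact: mes_comp_affine.
  by move=> x; rewrite ger0_norm ?enI_ge0.
have iw : dE w.
  have := intg_affine 0 (invr_neq0 sn) iA.
  by apply: eq_intg => x; rewrite !addr0 mulVKf.
split => //; rewrite !EE_int; apply: le_trans (_ : s * int (fun x => enI w w (s * x + 0)) <= _).
  by rewrite int_affine// gtr0_norm// mulVKf.
apply: le_trans (_ : int (fun x => enI w w (s * x + 0)) <= _).
  by rewrite -[leRHS]mul1r ler_wpM2r//; apply: int_ge0 => x; exact: enI_ge0.
apply: (le_trans (int_le iA iG le)).
rewrite intD//; last exact: intgZ.
rewrite intZ// int8 invrK lerD2l le_eqVlt; apply/orP; left; apply/eqP; ring.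
Qed.

End Energy.

(** * Approximation by test functions *)

Section Mollification.
Context {R : realType}.
Local Notation mu := (@lebesgue_measure R).
Implicit Types u v w f g phi : R -> R.

Definition mconv f v (x : R) : R := int (fun y => f (x - y) * v y).

(** A bounded probability density; boundedness puts it in L^2, so that its convolution with an L^2
    function is defined at every point. *)
Definition weight phi : Prop :=
  [/\ forall t, 0 <= phi t, intg phi, int phi = 1 & exists B, forall t, phi t <= B].

(** The variance of u under the density phi is nonnegative. *)
Lemma jensen phi u : weight phi -> measurable_fun setT u ->
  intg (fun t => phi t * u t ^+ 2) ->
  intg (fun t => phi t * u t) /\
  int (fun t => phi t * u t) ^+ 2 <= int (fun t => phi t * u t ^+ 2).
Proof.
move=> [p0 pi_ p1 _] mu_ i2.
have i1 : intg (fun t => phi t * u t).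
  apply: intg_dom (intgD pi_ i2).
    by apply: measurable_funM => //; exact: intg_mes.
  move=> t; rewrite normrM ger0_norm// -{2}[phi t]mulr1 -mulrDr ler_wpM2l//.
  rewrite -(real_normK (num_real (u t))).
  have := sqr_ge0 (`|u t| - 1); have := sqr_ge0 (`|u t|); have := normr_ge0 (u t).
  by rewrite !expr2; nra.
split => //; set m := int _.
have : 0 <= int (fun t => phi t * (u t - m) ^+ 2).
  by apply: int_ge0 => t; rewrite mulr_ge0// sqr_ge0.
rewrite (_ : (fun t => _) = (fun t => (phi t * u t ^+ 2 - (2 * m) * (phi t * u t)) + m ^+ 2 * phi t)); last first.
  by apply/funext => t; ring.
have j1 := intgZ (2 * m) i1; have j2 := intgB i2 j1.
rewrite intD// ?intB// ?intZ// ?p1 -/m; last exact: intgZ.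
by clear j1 j2; clearbody m; move: (int _) => A; rewrite expr2; lra.
Qed.

(** [jensen] for each x, integrated over x with Fubini. Taking for U the translates of v bounds a
    mollification; taking the increments v(x - t) - v(x) bounds its distance to v. *)
Lemma jensen_L2 phi (U : R * R -> R) : weight phi -> measurable_fun setT U ->
  (forall x, intg (fun t => phi t * U (t, x) ^+ 2)) ->
  (forall t, intg (fun x => U (t, x) ^+ 2)) ->
  intg (fun t => phi t * int (fun x => U (t, x) ^+ 2)) ->
  L2r (fun x => int (fun t => phi t * U (t, x))) /\
  nr (fun x => int (fun t => phi t * U (t, x))) <= int (fun t => phi t * int (fun x => U (t, x) ^+ 2)).
Proof.
move=> Wp mU Ux Ut Ui; have [p0 pi_ p1 _] := Wp; have mp := intg_mes pi_.
have mF : measurable_fun setT (fun z : R * R => phi z.1 * U z ^+ 2).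
  by apply: measurable_funM; [exact: mes_comp_fst|exact: measurable_funX].
have F2 : intg2 (fun z : R * R => phi z.1 * U z ^+ 2).
  apply: intg2_ge0 => //.
  - by move=> z; rewrite mulr_ge0// sqr_ge0.
  - by move=> t /=; exact: intgZ.
  - by apply: eq_intg Ui => t; rewrite /= intZ.
have [_ f2 f3] := fubini F2.
have mconv_ : measurable_fun setT (fun x => int (fun t => phi t * U (t, x))).
  apply: (@mes_int _ (fun z : R * R => phi z.2 * U (z.2, z.1))).
  apply: measurable_funM; first exact: mes_comp_snd.
  exact: (measurableT_comp mU (measurable_fun_pair measurable_snd measurable_fst)).
have le x : int (fun t => phi t * U (t, x)) ^+ 2 <= int (fun t => phi t * U (t, x) ^+ 2).
  by have [] := jensen Wp (mes_snd mU x) (Ux x).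
have i2 : intg (fun x => int (fun t => phi t * U (t, x)) ^+ 2).
  apply: intg_dom f2; first exact: measurable_funX.
  by move=> x /=; rewrite ger0_norm ?sqr_ge0.
have e : int (fun x => int (fun t => phi t * U (t, x) ^+ 2)) =
    int (fun t => phi t * int (fun x => U (t, x) ^+ 2)).
  transitivity (int (fun t => int (fun x => phi t * U (t, x) ^+ 2))); first exact: (esym f3).
  by apply: eq_int => t; rewrite intZ.
by split; [split|rewrite -e; apply: int_le].
Qed.

Lemma weight_L2r phi : weight phi -> L2r phi.
Proof.
move=> [p0 pi_ _ [B pB]]; split; first exact: intg_mes.
apply: intg_dom (intgZ B pi_); first by apply: measurable_funX; exact: intg_mes.
by move=> t; rewrite ger0_norm ?sqr_ge0// expr2 ler_wpM2r.
Qed.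

Lemma mconvE phi v x : L2r phi -> L2r v ->
  mconv phi v x = int (fun t => phi t * v (x - t)).
Proof.
move=> pL vL; rewrite -(@int_refl _ x (fun t => phi t * v (x - t))).
  by apply: eq_int => y; rewrite subKr.
exact: (intg_ip pL (L2r_refl x vL)).
Qed.

Lemma weight_sqr phi v : weight phi -> L2r v -> intg (fun t => phi t * v t ^+ 2).
Proof.
move=> [p0 pi_ _ [B pB]] [mv v2]; apply: intg_dom (intgZ B v2).
  by apply: measurable_funM; [exact: intg_mes|exact: measurable_funX].
move=> t; rewrite ger0_norm; last by rewrite mulr_ge0// sqr_ge0.
by rewrite ler_wpM2r// sqr_ge0.
Qed.

Lemma mconv_L2 phi v : weight phi -> L2r v -> L2r (mconv phi v) /\ nr (mconv phi v) <= nr v.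
Proof.
move=> Wp vL; have pL := weight_L2r Wp; have [p0 pi_ p1 _] := Wp.
have vt t : int (fun x => v (x - t) ^+ 2) = nr v by rewrite -(nr_shift (- t) vL).
have [] := @jensen_L2 phi (fun z => v (z.2 - z.1)) Wp.
- by apply: mes_comp_sub; case: vL.
- by move=> x; apply: weight_sqr => //; exact: L2r_refl.
- by move=> t; case: (L2r_shift (- t) vL).
- by apply: eq_intg (intgZ (nr v) pi_) => t /=; rewrite vt mulrC.
have -> : (fun x => int (fun t => phi t * v ((t, x).2 - (t, x).1))) = mconv phi v.
  by apply/funext => x; rewrite mconvE.
move=> h1 h2; split => //; apply: (le_trans h2).
rewrite (_ : (fun t => _) = (fun t => nr v * phi t)); first by rewrite intZ// p1 mulr1.
by apply/funext => t /=; rewrite vt mulrC.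
Qed.

Lemma mconvB phi v w x : L2r phi -> L2r v -> L2r w ->
  mconv phi (fun y => v y - w y) x = mconv phi v x - mconv phi w x.
Proof.
move=> pL vL wL; rewrite !mconvE//; last exact: L2rB.
rewrite -intB; [|exact: (intg_ip pL (L2r_refl x vL))|exact: (intg_ip pL (L2r_refl x wL))].
by apply: eq_int => t; ring.
Qed.

Lemma mconv_approx phi v : weight phi -> L2r v -> measurable_fun setT (NN v v) ->
  nr (fun x => mconv phi v x - v x) <= int (fun t => phi t * NN v v t).
Proof.
move=> Wp vL mN; have pL := weight_L2r Wp; have [p0 pi_ p1 _] := Wp.
have vt t : int (fun x => (v (x - t) - v x) ^+ 2) = NN v v t.
  by rewrite NN_nr nr_subC.
have [] := @jensen_L2 phi (fun z => v (z.2 - z.1) - v z.2) Wp.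
- by case: vL => mv _; apply: measurable_funB; [exact: mes_comp_sub|exact: mes_comp_snd].
- move=> x /=.
  apply: intg_dom (intgD (intgZ 2 (weight_sqr Wp (L2r_refl x vL))) (intgZ (2 * v x ^+ 2) pi_)).
    apply: measurable_funM; first exact: intg_mes.
    by apply: measurable_funX; apply: measurable_funB => //; case: (L2r_refl x vL).
  move=> t; rewrite ger0_norm; last by rewrite mulr_ge0// sqr_ge0.
  have -> : 2 * (phi t * v (x - t) ^+ 2) + 2 * v x ^+ 2 * phi t =
    phi t * (2 * v (x - t) ^+ 2 + 2 * v x ^+ 2) by ring.
  rewrite ler_wpM2l//; have := sqr_ge0 (v (x - t) + v x).
  by move: (v _) (v _) => A B; rewrite !expr2; lra.
- by move=> t; case: (L2rB (L2r_shift (- t) vL) vL).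
- apply: intg_dom (intgZ (4 * nr v) pi_).
    apply: measurable_funM; first exact: intg_mes.
    by rewrite (_ : (fun t => _) = NN v v)//; apply/funext => t; rewrite /= vt.
  move=> t /=; rewrite vt ger0_norm ?mulr_ge0 ?NN_ge0// mulrC ler_wpM2r//.
  exact: NN_le.
move=> _.
have -> : (fun x => int (fun t => phi t * (v (x - t) - v x))) = (fun x => mconv phi v x - v x).
  apply/funext => x; rewrite mconvE//.
  rewrite -[X in _ - X](mulr1 (v x)) -p1 -intZ// -intB; last exact: intgZ.
    by apply: eq_int => t; ring.
  exact: (intg_ip pL (L2r_refl x vL)).
by under [X in _ <= X -> _]eq_int do rewrite vt.
Qed.

(** Convolution commutes with translation, so [mconv_L2] applied to v - v(. - x) bounds the energy
    density at every x. *)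
Lemma mconv_energy phi v : weight phi -> L2r v -> dE v ->
  dE (mconv phi v) /\ EE (mconv phi v) (mconv phi v) <= EE v v.
Proof.
move=> Wp vL vE; have pL := weight_L2r Wp; have [mL _] := mconv_L2 Wp vL.
have N x : NN (mconv phi v) (mconv phi v) x <= NN v v x.
  rewrite !NN_nr; have [_] := mconv_L2 Wp (L2r_diff x vL).
  congr (nr _ <= _); apply/funext => y; rewrite mconvB//; last exact: L2r_shift.
  congr (_ - _); rewrite !mconvE//; last exact: L2r_shift.
  by apply: eq_int => t; congr (_ * v _); ring.
have le x : enI (mconv phi v) (mconv phi v) x <= enI v v x.
  rewrite /enI /hp; case: ifPn => // x0.
  by rewrite ler_wpM2l// ltW// kker_gt0.
have mE : dE (mconv phi v).
  apply: intg_dom vE; first exact: mes_enI.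
  by move=> x; rewrite ger0_norm ?enI_ge0.
by split => //; rewrite !EE_int; exact: int_le.
Qed.

(** The derivatives of e^(-1/x) are combinations of these functions, so smoothness reduces to the
    single rule [is_derive_bumpf]. *)
Definition bumpf (n : nat) : R -> R := hp (fun x => x^-1 ^+ n * expR (- x^-1)).

Lemma bumpf_ge0 n x : 0 <= bumpf n x.
Proof. by apply: hp_ge0 => y y0; rewrite mulr_ge0 ?expR_ge0// exprn_ge0// invr_ge0 ltW. Qed.

Lemma pow_exp_le n (y : R) : 0 < y -> y ^+ n * expR (- y) <= n`!%:R.
Proof.
move=> y0; rewrite expRN ler_pdivrMr ?expR_gt0//.
case: n => [|n]; first by rewrite expr0 fact0 mul1r -expR0 ler_expR ltW.
have := @expR_ge1Dxn R y n (ltW y0) => h.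
have {h} : y ^+ n.+1 / (n.+1)`!%:R <= expR y by apply: le_trans h; rewrite lerDr.
by rewrite ler_pdivrMr ?ltr0n ?fact_gt0// mulrC.
Qed.

Lemma bumpf_le n x : bumpf n x <= n`!%:R.
Proof. by rewrite /bumpf /hp; case: ifPn => // x0; rewrite pow_exp_le// invr_gt0. Qed.

(** Quadratic vanishing at 0, which makes the derivative there 0. *)
Lemma bumpf_sqr n x : `|bumpf n x| <= (n.+2)`!%:R * x ^+ 2.
Proof.
rewrite ger0_norm ?bumpf_ge0// /bumpf /hp; case: ifPn => x0; last by rewrite mulr_ge0// sqr_ge0.
have y0 : 0 < x^-1 by rewrite invr_gt0.
have := @pow_exp_le n.+2 _ y0; rewrite -(ler_pM2r (_ : 0 < x ^+ 2)) ?exprn_gt0//.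
by apply: le_trans; rewrite le_eqVlt; apply/orP; left; apply/eqP; rewrite !exprSr; field; rewrite gt_eqF.
Qed.

Lemma is_derive_bumpf n (x : R) :
  is_derive x 1 (bumpf n) (- n%:R * bumpf n.+1 x + bumpf n.+2 x).
Proof.
have [x0|x0|->] := ltgtP x 0.
- rewrite /bumpf !hp_le0 ?ltW// mulr0 addr0.
  apply: (@near_eq_is_derive _ _ _ (fun=> 0)) => //.
  by near=> z; rewrite hp_le0// ltW//; near: z; exact: lt_nbhsl.
- have xn : x != 0 by rewrite gt_eqF.
  have dv : is_derive x 1 (fun x : R => x^-1) (- x ^- 2).
    by have := @is_deriveV _ id x 1 1 xn (is_derive_id x 1); rewrite /GRing.scale/= mulr1.
  have d : is_derive x 1 (fun x : R => x^-1 ^+ n * expR (- x^-1))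
      (- n%:R * (x^-1 ^+ n.+1 * expR (- x^-1)) + x^-1 ^+ n.+2 * expR (- x^-1)).
    have dp : is_derive x 1 (fun x : R => x^-1 ^+ n) (- n%:R * x^-1 ^+ n.+1).
      elim: n => [|n IH].
        by rewrite oppr0 mul0r; exact: is_derive_cst.
      have -> : (fun x : R => x^-1 ^+ n.+1) = (fun x => x^-1 * x^-1 ^+ n).
        by apply/funext => y; rewrite exprS.
      apply: is_derive_eq; rewrite /GRing.scale/= -natr1 !exprS; field; exact: xn.
    by apply: is_derive_eq; rewrite /GRing.scale/= !exprS; field.
  rewrite /bumpf !hp_gt0//; apply: near_eq_is_derive d.
  by near=> z; rewrite hp_gt0//; near: z; exact: lt_nbhsr.
- rewrite /bumpf !hp_le0// mulr0 addr0 -/(bumpf n).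
  have q : h^-1 *: (bumpf n (h *: 1 + 0) - bumpf n 0) @[h --> (0 : R)^'] --> 0.
    apply: norm_cvg0.
    apply: (@squeeze_cvgr _ _ _ _ (fun=> 0) (fun h => (n.+2)`!%:R * `|h|)).
    + near=> h; rewrite normr_ge0/= {2}/bumpf (hp_le0 _ (lexx 0)) subr0 addr0.
      have h0 : h != 0 by near: h; exact: nbhs_dnbhs_neq.
      rewrite /GRing.scale/= mulr1 normrM normfV mulrC ler_pdivrMr ?normr_gt0//.
      by rewrite -mulrA -expr2 real_normK ?num_real// bumpf_sqr.
    + exact: cvg_cst.
    + rewrite -[X in _ --> X](mulr0 (n.+2)`!%:R); apply: cvgM; first exact: cvg_cst.
      have h := @norm_continuous _ R 0; rewrite /continuous_at normr0 in h.
      by apply: (cvg_trans _ h); apply: cvg_app; exact: cvg_within.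
  split; first by apply: cvgP q.
  exact/cvg_lim.
Unshelve. all: by end_near. Qed.

(** For m = n = 0 this is the standard bump e^(-2/(1 - x^2)) on ]-1, 1[; the other indices occur in
    its derivatives. *)
Definition tst (m n : nat) (x : R) : R := bumpf m (1 - x) * bumpf n (1 + x).

Lemma tst_supp m n x : 1 <= `|x| -> tst m n x = 0.
Proof.
rewrite ler_normr => /orP[h|h]; rewrite /tst /bumpf.
  by rewrite hp_le0 ?mul0r// subr_le0.
by rewrite (hp_le0 _ (_ : 1 + x <= 0)) ?mulr0// -lerBrDl sub0r lerNr.
Qed.

Lemma tst_le m n x : `|tst m n x| <= (m`! * n`!)%:R.
Proof.
rewrite ger0_norm ?mulr_ge0 ?bumpf_ge0// natrM.
by apply: ler_pM; rewrite ?bumpf_ge0// bumpf_le.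
Qed.

Lemma is_derive_tst m n (e x : R) : is_derive x 1 (fun x => tst m n (e * x))
  (e * (m%:R * tst m.+1 n (e * x) - tst m.+2 n (e * x)
        - n%:R * tst m n.+1 (e * x) + tst m n.+2 (e * x))).
Proof.
have d1 : is_derive x 1 (fun x => bumpf m (1 - e * x))
    (- e * (- m%:R * bumpf m.+1 (1 - e * x) + bumpf m.+2 (1 - e * x))).
  have i : is_derive x 1 (fun x : R => 1 - e * x) (- e).
    by apply: is_derive_eq; rewrite /GRing.scale/=; ring.
  by have := @is_derive1_comp _ (bumpf m) (fun x => 1 - e * x) x _ _ (is_derive_bumpf m (1 - e * x)) i; rewrite mulrC.
have d2 : is_derive x 1 (fun x => bumpf n (1 + e * x))
    (e * (- n%:R * bumpf n.+1 (1 + e * x) + bumpf n.+2 (1 + e * x))).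
  have i : is_derive x 1 (fun x : R => 1 + e * x) e.
    by apply: is_derive_eq; rewrite /GRing.scale/=; ring.
  by have := @is_derive1_comp _ (bumpf n) (fun x => 1 + e * x) x _ _ (is_derive_bumpf n (1 + e * x)) i; rewrite mulrC.
by apply: is_derive_eq; rewrite /GRing.scale/= /tst; ring.
Qed.

(** The span of the [tst] at scale e: bounded functions of bounded support (for e nonzero), closed
    under differentiation. *)
Definition bumps (e : R) f : Prop :=
  exists s : seq (R * (nat * nat)), f = fun x => \sum_(t <- s) t.1 * tst t.2.1 t.2.2 (e * x).

Lemma bumps_deriv e f : bumps e f ->
  exists2 g, bumps e g & forall x : R, is_derive x 1 f (g x).
Proof.
move=> [s ->]; elim: s => [|[c [m n]] s [g [r ->] dg]].
  exists (fun=> 0); first by exists [::]; apply/funext => x; rewrite big_nil.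
  move=> x; rewrite (_ : (fun x => _) = cst 0); last by apply/funext => y; rewrite big_nil.
  exact: is_derive_cst.
pose r' := [:: (c * e * m%:R, (m.+1, n)), (- (c * e), (m.+2, n)),
  (- (c * e * n%:R), (m, n.+1)), (c * e, (m, n.+2)) & r].
exists (fun x => \sum_(t <- r') t.1 * tst t.2.1 t.2.2 (e * x)); first by exists r'.
move=> x; rewrite (_ : (fun x => _) = fun x => c * tst m n (e * x) +
   \sum_(t <- s) t.1 * tst t.2.1 t.2.2 (e * x)); last first.
  by apply/funext => y; rewrite big_cons.
have d1 := is_derive_tst m n e x; have d2 := dg x.
apply: is_derive_eq; rewrite !big_cons/= /GRing.scale/=.
by move: (\sum_(_ <- r) _) (tst _ _ _) (tst _ _ _) (tst _ _ _) (tst _ _ _) => *; ring.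
Qed.

Lemma bumps_bounded e f : bumps e f -> exists C, forall x, `|f x| <= C.
Proof.
move=> [s ->]; exists (\sum_(t <- s) `|t.1| * ((t.2.1)`! * (t.2.2)`!)%:R) => x.
apply: le_trans (ler_norm_sum _ _ _) _; apply: ler_sum => t _.
by rewrite normrM ler_wpM2l// tst_le.
Qed.

Lemma bumps_supp e f x : bumps e f -> 1 <= `|e * x| -> f x = 0.
Proof. by move=> [s ->] h; rewrite big1// => t _; rewrite tst_supp// mulr0. Qed.

Lemma bumps_continuous e f : bumps e f -> continuous f.
Proof.
move=> /bumps_deriv[g _ dg] x; apply: differentiable_continuous; apply/derivable1_diffP.
by have := dg x.
Qed.

Lemma bumps_mes e f : bumps e f -> measurable_fun setT f.
Proof. by move=> /bumps_continuous/continuous_measurable_fun. Qed.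

Lemma intg_bumps_conv e f v x : bumps e f -> intg v -> intg (fun y => f (x - y) * v y).
Proof.
move=> bf vi; have [C fC] := bumps_bounded bf.
apply: intg_dom (intgZ C (intg_norm vi)).
  apply: measurable_funM; last exact: intg_mes.
  by apply: (measurableT_comp (bumps_mes bf)); apply: measurable_funB.
by move=> y; rewrite normrM ler_wpM2r.
Qed.

(** Differentiation under the integral: g is bounded, so a multiple of |v| dominates all the
    derivatives. *)
Lemma is_derive_mconv e f g v (x : R) : bumps e f -> bumps e g ->
  (forall x : R, is_derive x 1 f (g x)) -> intg v ->
  is_derive x 1 (mconv f v) (mconv g v x).
Proof.
move=> bf bg dfg vi; have [C gC] := bumps_bounded bg.
have C0 : 0 <= C by apply: le_trans (gC 0); exact: normr_ge0.
pose h (x y : R) := f (x - y) * v y.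
have dh (z y : R) : is_derive z 1 (h ^~ y) (g (z - y) * v y).
  have i : is_derive z 1 (fun x : R => x - y) 1.
    by apply: is_derive_eq; rewrite subr0.
  have := @is_derive1_comp _ f (fun x => x - y) z _ _ (dfg (z - y)) i; rewrite mulr1 => d1.
  by rewrite /h; apply: is_derive_eq; rewrite /GRing.scale/=; ring.
have p1 z y : partial1of2 h z y = g (z - y) * v y.
  by rewrite partial1of2E; have [_ ->] := dh z y.
have xI : `]x - 1, x + 1[%classic x by rewrite /= in_itv/=; apply/andP; split; lra.
have hi z : (`]x - 1, x + 1[%classic : set R) z -> mu.-integrable setT (EFin \o h z).
  by move=> _; exact: (intg_bumps_conv z bf vi).
have hd z y : (`]x - 1, x + 1[%classic : set R) z -> setT y -> derivable (h ^~ y) z 1.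
  by move=> _ _; have := dh z y.
have Gi : mu.-integrable setT (EFin \o (fun y => C * `|v y|)).
  exact: (intgZ C (intg_norm vi)).
have hG z y : (`]x - 1, x + 1[%classic : set R) z -> setT y -> `|partial1of2 h z y| <= C * `|v y|.
  by move=> _ _; rewrite p1 normrM ler_wpM2r.
have G0 y : 0 <= C * `|v y| by rewrite mulr_ge0.
split; first exact: (derivable_under_integral measurableT xI hi hd G0 Gi hG).
rewrite -derive1E (differentiation_under_integral measurableT xI hi hd G0 Gi hG).
by apply: eq_Rintegral => y _; rewrite p1.
Qed.

Lemma derive1n_mconv e f v n : bumps e f -> intg v ->
  exists2 g, bumps e g & derive1n n (mconv f v) = mconv g v.
Proof.
move=> bf vi; elim: n => [|n [g bg IH]]; first by exists f.
have [k bk dk] := bumps_deriv bg; exists k => //.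
rewrite derive1nS IH; apply/funext => x; rewrite derive1E.
by have [_ ->] := is_derive_mconv x bg bk dk vi.
Qed.

Lemma smooth_mconv e f v : bumps e f -> intg v -> smooth (mconv f v).
Proof.
move=> bf vi n x; have [g bg ->] := derive1n_mconv n bf vi.
have [k bk dk] := bumps_deriv bg.
by have := is_derive_mconv x bg bk dk vi.
Qed.

End Mollification.

(** * Test functions approximating in L^2 and in energy *)

Section TestFunctions.
Context {R : realType}.
Implicit Types u v w f g phi : R -> R.

Definition rtest (a : R) f : Prop :=
  smooth f /\ exists2 b, b < a & forall x, b < `|x| -> f x = 0.

Let psi : R -> R := tst 0 0.

Lemma psi_ge0 x : 0 <= psi x.
Proof. by rewrite mulr_ge0// bumpf_ge0. Qed.

Lemma psi_le1 x : psi x <= 1.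
Proof. by have := @tst_le R 0 0 x; rewrite ger0_norm ?psi_ge0// fact0 muln1. Qed.

Lemma psi_bumps : bumps 1 psi.
Proof.
by exists [:: (1, (0%N, 0%N))]; apply/funext => x; rewrite big_seq1/= !mul1r.
Qed.

Lemma intg_psi : intg psi.
Proof.
apply: intg_dom (intg_itv (-1) 1 true false); first exact: (bumps_mes psi_bumps).
move=> x; rewrite ger0_norm ?psi_ge0//; have [x1|x1] := leP 1 `|x|.
  by rewrite /psi tst_supp// indicE.
rewrite indicE mem_set ?psi_le1//=; rewrite in_itv/= -ler_norml ltW//.
Qed.

Lemma int_psi_gt0 : 0 < int psi.
Proof.
have h2 : -2^-1 <= 2^-1 :> R by lra.
(* For |x| <= 1/2 both 1/(1 - x) and 1/(1 + x) are at most 2. *)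
apply: lt_le_trans (_ : expR (- 4) * int (\1_(`[- 2^-1, 2^-1]%classic) : R -> R) <= _).
  by rewrite int_indic_itv// mulr_gt0 ?expR_gt0//; lra.
have ii : intg (\1_(`[- 2^-1, 2^-1]%classic) : R -> R) by exact: intg_itv.
rewrite -intZ//; apply: int_le; [exact: intgZ|exact: intg_psi|move=> x].
rewrite indicE; have [/set_mem/=|_] := boolP (x \in _); last by rewrite mulr0 psi_ge0.
rewrite in_itv/= mulr1 => /andP[x1 x2].
have p1 : 0 < 1 - x by lra. have p2 : 0 < 1 + x by lra.
rewrite /psi /tst /bumpf !hp_gt0// !expr0 !mul1r -expRD ler_expR.
have : (1 - x)^-1 <= 2 by rewrite -[leRHS]invrK lef_pV2 ?posrE ?invr_gt0//; lra.
have : (1 + x)^-1 <= 2 by rewrite -[leRHS]invrK lef_pV2 ?posrE ?invr_gt0//; lra.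
move: (_^-1) (_^-1) => A B; lra.
Qed.

(** The parameter e is the inverse of the width: mass 1, supported in [-1/e, 1/e] for e > 0. *)
Definition moll (e t : R) : R := e * ((int psi)^-1 * psi (e * t)).

Lemma moll_bumps e : bumps e (moll e).
Proof.
by exists [:: (e * (int psi)^-1, (0%N, 0%N))]; apply/funext => x; rewrite big_seq1/= /moll mulrA.
Qed.

Lemma moll_weight e : 0 < e -> weight (moll e).
Proof.
move=> e0; have en : e != 0 by rewrite gt_eqF.
have ci : 0 < (int psi)^-1 by rewrite invr_gt0 int_psi_gt0.
have i1 := intg_affine 0 en intg_psi.
have E t : moll e t = e * (int psi)^-1 * psi (e * t + 0) by rewrite addr0 /moll mulrA.
have i2 : intg (moll e) by apply: eq_intg (intgZ (e * (int psi)^-1) i1) => t; rewrite E.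
split => //.
- by move=> t; rewrite /moll mulr_ge0 ?(ltW e0)// mulr_ge0 ?(ltW ci)// psi_ge0.
- rewrite (eq_int E) intZ// int_affine//; last exact: intg_psi.
  by rewrite gtr0_norm//; field; rewrite en gt_eqF// int_psi_gt0.
- exists (e * ((int psi)^-1 * 1)) => t; rewrite /moll ler_wpM2l ?(ltW e0)//.
  by rewrite ler_wpM2l ?(ltW ci)// psi_le1.
Qed.

(** The bound of [mconv_approx] is rescaled to a fixed density, with [NN] taken at t / e; there
    continuity of translations and dominated convergence give 0. *)
Lemma moll_approx v (e : nat -> R) : L2r v -> (forall n, 1 <= e n) ->
  (e n)^-1 @[n --> \oo] --> 0 ->
  nr (fun x => mconv (moll (e n)) v x - v x) @[n --> \oo] --> 0.
Proof.
move=> vL e1 ec; have ci : 0 < (int psi)^-1 by rewrite invr_gt0 int_psi_gt0.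
have ep n : 0 < e n by apply: lt_le_trans (e1 n).
have en n : e n != 0 by rewrite gt_eqF.
have mN := mes_NN vL vL.
pose F n t := (int psi)^-1 * (psi t * NN v v ((e n)^-1 * t)).
have mF n : measurable_fun setT (F n).
  apply: measurable_funM => //; apply: measurable_funM; first exact: (bumps_mes psi_bumps).
  have := mes_comp_affine (e n)^-1 0 mN.
  by congr measurable_fun; apply/funext => t; rewrite addr0.
have iF n : intg (F n).
  apply: intg_dom (intgZ ((int psi)^-1 * (4 * nr v)) intg_psi) => // t.
  rewrite ger0_norm; last by rewrite mulr_ge0 ?(ltW ci)// mulr_ge0 ?psi_ge0 ?NN_ge0.
  by rewrite -mulrA ler_wpM2l ?(ltW ci)// mulrC ler_wpM2r ?psi_ge0// NN_le.
have Fle n : nr (fun x => mconv (moll (e n)) v x - v x) <= int (F n).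
  apply: le_trans (mconv_approx (moll_weight (ep n)) vL mN) _.
  have := int_affine 0 (en n) (iF n); rewrite gtr0_norm// => h.
  rewrite -[int (F n)](mulVKf (en n)) -h -intZ; last exact: intg_affine.
  rewrite le_eqVlt; apply/orP; left; apply/eqP; apply: eq_int => t.
  by rewrite /F /moll addr0 mulKf// !mulrA.
have [] := @dct R F (fun=> 0) (fun t => (int psi)^-1 * (4 * nr v) * psi t) mF.
- move=> t; have [t1|t1] := leP 1 `|t|.
    by rewrite /F /psi tst_supp//; under eq_fun do rewrite mul0r mulr0; exact: cvg_cst.
  rewrite -(mulr0 (int psi)^-1); apply: cvgM; first exact: cvg_cst.
  rewrite -(mulr0 (psi t)); apply: cvgM; first exact: cvg_cst.
  apply: shift_cvg => //.
    move=> n; rewrite normrM -[leRHS]mulr1 ger0_norm ?invr_ge0 ?(ltW (ep n))//.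
    by apply: ler_pM; rewrite ?invr_ge0 ?(ltW (ep n)) ?(ltW t1)// invf_le1.
  by rewrite -(mul0r t); apply: cvgM => //; exact: cvg_cst.
- move=> n t; rewrite ger0_norm; last by rewrite mulr_ge0 ?(ltW ci)// mulr_ge0 ?psi_ge0 ?NN_ge0.
  by rewrite -mulrA ler_wpM2l ?(ltW ci)// mulrC ler_wpM2r ?psi_ge0// NN_le.
- by apply: intgZ; exact: intg_psi.
rewrite int0 => _ h _.
apply: (@squeeze_cvgr _ _ _ _ (fun=> 0) _ _ _ _ _ h); last exact: cvg_cst.
by apply: nearW => n; rewrite nr_ge0/=.
Qed.

Lemma L2r_intg a v : L2r v -> suppin a v -> intg v.
Proof.
move=> [mv v2] va; apply: intg_dom (intgD v2 (intg_itv (- a) a true false)) => //.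
move=> x; have [xa|xa] := boolP (`|x| < a); last by rewrite va// normr0 expr0n add0r indicE.
rewrite indicE mem_set/=; last by rewrite in_itv/= -ler_norml ltW.
rewrite -(real_normK (num_real (v x))); have := sqr_ge0 (`|v x| - 1).
have := normr_ge0 (v x); move: `|v x| => A; rewrite !expr2; nra.
Qed.

(** The dilation by s n < 1 leaves a margin a d n at both ends of the interval, and a mollifier of
    radius q d n with q < a fits into it. One sequence serves both for L^2 and for the energy. *)
Lemma approx_test a v : 0 < a -> L2r v -> suppin a v ->
  exists u : nat -> R -> R, [/\ forall n, rtest a (u n), forall n, L2r (u n),
    nr (fun x => u n x - v x) @[n --> \oo] --> 0 &
    dE v -> (forall n, dE (u n)) /\
      EE (fun x => u n x - v x) (fun x => u n x - v x) @[n --> \oo] --> 0].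
Proof.
move=> a0 vL va.
(* Starting at 1/4 keeps s n >= 3/4, as [kker_scale] requires. *)
pose d n : R := n.+4%:R^-1; pose s n : R := 1 - d n.
(* Both q < a, for the margin, and q <= 1, so that the inverse width e n is at least 1. *)
pose q : R := a / (2 * (1 + a)).
have a1 : 0 < 2 * (1 + a) by rewrite mulr_gt0// addr_gt0.
have q0 : 0 < q by rewrite divr_gt0.
have q1 : q <= 1 by rewrite ler_pdivrMr//; lra.
have qa : q < a by rewrite ltr_pdivrMr// -[ltLHS]mulr1 ltr_pM2l//; lra.
pose e n : R := n.+4%:R / q.
have d0 n : 0 < d n by rewrite invr_gt0.
have d4 n : d n <= 1 / 4 by rewrite div1r lef_pV2 ?posrE// ler_nat.
have dc : d n @[n --> \oo] --> 0.
  by have := @cvg_harmonic R; rewrite -(cvg_shiftn 3 (@harmonic R)); under eq_fun do rewrite /harmonic/= addn3.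
have sb n : 3 / 4 <= s n <= 1 by rewrite /s; have := d4 n; have := d0 n => *; apply/andP; split; lra.
have s0 n : 0 < s n by case/andP: (sb n) => h _; apply: lt_le_trans h; rewrite divr_gt0.
have sn0 n : s n != 0 by rewrite gt_eqF.
have si0 n : (s n)^-1 != 0 by rewrite invr_eq0.
have e1 n : 1 <= e n.
  by rewrite ler_pdivlMr// mul1r (le_trans q1)// ler1n.
have e0 n : 0 < e n by apply: lt_le_trans (e1 n).
have ec : (e n)^-1 @[n --> \oo] --> 0.
  under eq_fun do rewrite /e invfM invrK; rewrite -(mul0r q).
  by apply: cvgM => //; exact: cvg_cst.
pose w n : R -> R := fun x => v ((s n)^-1 * x).
have wE n : w n = fun x => v ((s n)^-1 * x + 0) by apply/funext => x; rewrite addr0.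
have wL n : L2r (w n) by rewrite wE; exact: L2r_affine.
have sc : (s n)^-1 @[n --> \oo] --> (1 : R).
  rewrite -[X in _ --> X]invr1; apply: cvgV; first exact: oner_neq0.
  by rewrite -[X in _ --> X]subr0; apply: cvgB => //; exact: cvg_cst.
have wc : nr (fun x => w n x - v x) @[n --> \oo] --> 0.
  have := @affine_cvg _ v (fun n => (s n)^-1) (fun=> 0) vL.
  move=> /(_ _ _ sc _)/wrap[|||h].
  - move=> n; have /andP[h1 h2] := sb n.
    by rewrite lef_pV2 ?posrE//; lra.
  - by move=> n; rewrite normr0.
  - exact: cvg_cst.
  by apply: cvg_trans h; apply: near_eq_cvg; apply: nearW => n; rewrite wE.
pose u n := mconv (moll (e n)) (w n).
have W n : weight (moll (e n)) by exact: moll_weight.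
have uL n : L2r (u n) by have [] := mconv_L2 (W n) (wL n).
have wa n : suppin (s n * a) (w n).
  move=> x; rewrite -leNgt => h; apply: va; rewrite -leNgt normrM ger0_norm ?invr_ge0 ?(ltW (s0 n))//.
  by rewrite ler_pdivlMl.
have uc : nr (fun x => u n x - v x) @[n --> \oo] --> 0.
  have mc := moll_approx vL e1 ec.
  apply: (@squeeze_cvgr _ _ _ _ (fun=> 0) (fun n => 2 * nr (fun x => w n x - v x) +
    2 * nr (fun x => mconv (moll (e n)) v x - v x))).
  - apply: nearW => n; rewrite nr_ge0/=; have pL := weight_L2r (W n).
    have [cL _] := mconv_L2 (W n) vL.
    apply: le_trans (nr_tri (uL n) cL vL) _; rewrite lerD2r ler_wpM2l//.
    have [_] := mconv_L2 (W n) (L2rB (wL n) vL).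
    by under [X in X <= _ -> _]eq_int do rewrite mconvB//.
  - exact: cvg_cst.
  - rewrite -[X in _ --> X](_ : 2 * 0 + 2 * 0 = 0); last by rewrite !mulr0 addr0.
    by apply: cvgD; apply: cvgM => //; exact: cvg_cst.
exists u; split => //.
  move=> n; split; first exact: (smooth_mconv (moll_bumps (e n)) (L2r_intg (wL n) (wa n))).
  exists (s n * a + (e n)^-1).
    have : (e n)^-1 < a * d n by rewrite /e invfM invrK mulrC ltr_pM2r.
    by rewrite /s; lra.
  move=> x xb; rewrite -[RHS](@int0 R); apply: eq_int => y.
  have [ya|ya] := boolP (`|y| < s n * a); last by rewrite wa// mulr0.
  rewrite (bumps_supp (moll_bumps _)) ?mul0r// normrM gtr0_norm//.
  rewrite -ler_pdivrMl// mulr1; have := ler_normD (x - y) y; rewrite subrK.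
  by lra.
move=> vE; have dw n := dilation_energy (sb n) vL vE.
have du n := mconv_energy (W n) (wL n) (dw n).1.
split; first by move=> n; case: (du n).
apply: (@energy_strong _ u v (fun n => EE v v + d n * (64 * nr v))) => //.
- by move=> n; case: (du n).
- move=> n; apply: le_trans (du n).2 _; apply: le_trans (dw n).2 _.
  by rewrite /s subKr.
- rewrite -[X in _ --> X]addr0; apply: cvgD; first exact: cvg_cst.
  by rewrite -(mul0r (64 * nr v)); apply: cvgM => //; exact: cvg_cst.
Qed.

End TestFunctions.

(** * Primitives and the screw kernel *)

Section Primitive.
Context {R : realType}.
Local Notation mu := (@lebesgue_measure R).
Implicit Types u v w f g : R -> R.

Lemma int_off (c : R) f g : measurable_fun setT f -> measurable_fun setT g ->
  (forall x, x != c -> f x = g x) -> int f = int g.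
Proof.
move=> mf mg fg; rewrite /int /Rintegral; congr fine.
apply: ae_eq_integral => //; [exact/measurable_EFinP..|].
exists [set c]; split; [exact: measurable_set1|exact: lebesgue_measure_set1|].
move=> x /= h; apply/eqP; apply: contraPT h => x0; rewrite fg//.
Qed.

Lemma mes_lt (s : R) : measurable_fun setT (fun y : R => (y < s)%R%:R : R).
Proof.
rewrite (_ : (fun y => _) = (fun y => if y < s then 1 else 0)).
  by apply: measurable_fun_ifT => //; exact: measurable_fun_ltr.
by apply/funext => y; case: ifP.
Qed.

Lemma mes_gt (s : R) : measurable_fun setT (fun y : R => (s < y)%R%:R : R).
Proof.
rewrite (_ : (fun y => _) = (fun y => if s < y then 1 else 0)).
  by apply: measurable_fun_ifT => //; exact: measurable_fun_ltr.
by apply/funext => y; case: ifP.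
Qed.

Lemma mes_ge (s : R) : measurable_fun setT (fun y : R => (s <= y)%R%:R : R).
Proof.
rewrite (_ : (fun y => _) = (fun y => if s <= y then 1 else 0)).
  by apply: measurable_fun_ifT => //; exact: measurable_fun_ler.
by apply/funext => y; case: ifP.
Qed.

Lemma mes_lt2 : measurable_fun setT (fun z : R * R => (z.2 < z.1)%R%:R : R).
Proof.
rewrite (_ : (fun z => _) = (fun z : R * R => if z.2 < z.1 then 1 else 0)).
  by apply: measurable_fun_ifT => //; apply: measurable_fun_ltr; [exact: measurable_snd|exact: measurable_fst].
by apply/funext => y; case: ifP.
Qed.

Lemma bool_norm_le (b : bool) (x : R) : `|b%:R * x| <= `|x|.
Proof. by case: b; rewrite ?mul1r// mul0r normr0. Qed.

Lemma intg_boolM (P : R -> bool) f : measurable_fun setT (fun y => (P y)%:R : R) ->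
  intg f -> intg (fun y => (P y)%:R * f y).
Proof.
move=> mP fi; apply: intg_dom (intg_norm fi); first by apply: measurable_funM => //; exact: intg_mes.
by move=> x; exact: bool_norm_le.
Qed.

Lemma int_indic_itvco (a b : R) : a <= b -> int (\1_(`[a, b[%classic) : R -> R) = b - a.
Proof.
move=> ab; have h : mu (`[a, b[%classic : set R) = (b - a)%:E.
  rewrite lebesgue_measure_itv/= lte_fin.
  have [_|ba] := ltP a b; first by rewrite -EFinB.
  by have -> : a = b; [apply/eqP; rewrite eq_le ab|rewrite subrr].
rewrite /int /Rintegral (integral_indic mu measurableT (measurable_itv _)).
by rewrite -[RHS]/(fine (b - a)%:E) -h; congr (fine (mu _)); exact: setIT.
Qed.

Definition prim w (x : R) : R := int (fun y => (y < x)%R%:R * w y).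

Lemma intg_prim w x : intg w -> intg (fun y => (y < x)%R%:R * w y).
Proof. by move=> wi; apply: (@intg_boolM (fun y => y < x)) => //; exact: mes_lt. Qed.

Lemma int_ge_prim w x : intg w -> int (fun y => (x <= y)%R%:R * w y) = int w - prim w x.
Proof.
move=> wi; rewrite -intB//; last exact: intg_prim.
by apply: eq_int => y; rewrite leNgt; case: (y < x); rewrite ?mul0r ?mul1r ?subrr ?subr0.
Qed.

Lemma mes_prim w : measurable_fun setT w -> measurable_fun setT (prim w).
Proof.
move=> mw; apply: (@mes_int _ (fun z : R * R => (z.2 < z.1)%R%:R * w z.2)).
by apply: measurable_funM; [exact: mes_lt2|exact: mes_comp_snd].
Qed.

Definition meanzero (a : R) w : Prop := [/\ L2r w, suppin a w & int w = 0].

Lemma meanzero_intg a w : meanzero a w -> intg w.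
Proof. by move=> [wL wa _]; exact: L2r_intg wL wa. Qed.

Lemma prim_supp a w : intg w -> suppin a w -> int w = 0 -> suppin a (prim w).
Proof.
move=> wi wa w0 x; rewrite -leNgt ler_normr => /orP[ax|ax].
  rewrite /prim -[RHS]w0; apply: eq_int => y; have [_|xy] := ltP y x; first by rewrite mul1r.
  by rewrite wa ?mulr0// -leNgt ler_normr (le_trans ax).
rewrite /prim -[RHS](@int0 R); apply: eq_int => y; have [yx|_] := ltP y x; last by rewrite mul0r.
by rewrite wa ?mulr0// -leNgt ler_normr; apply/orP; right; lra.
Qed.

Lemma int_itv_sqr_le (b c : R) w : b <= c -> L2r w ->
  int (fun y => \1_(`[b, c]%classic) y * w y) ^+ 2 <= (c - b) * nr w.
Proof.
move=> bc wL; have i := intg_itv b c true false.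
have iL : L2r (\1_(`[b, c]%classic) : R -> R).
  split; first exact: intg_mes i.
  by apply: eq_intg i => y; rewrite indicE; case: (_ \in _); rewrite ?expr1n ?expr0n.
apply: le_trans (ip_sqr_le iL wL) _; rewrite le_eqVlt; apply/orP; left; apply/eqP.
congr (_ * _); rewrite -(int_indic_itv bc); apply: eq_int => y.
by rewrite indicE; case: (_ \in _); rewrite ?expr1n ?expr0n.
Qed.

(** Cauchy-Schwarz on the interval between the two points: primitives of L^2 functions are Hoelder
    of exponent 1/2. *)
Lemma prim_holder w x y : L2r w -> intg w ->
  (prim w x - prim w y) ^+ 2 <= `|x - y| * nr w.
Proof.
move=> wL wi; wlog xy : x y / y <= x.
  move=> h; have [/h//|/ltW/h] := leP y x.
  by rewrite distrC -sqrrN opprB.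
rewrite ger0_norm ?subr_ge0//.
pose w' z := (z < x)%R%:R * ((y <= z)%R%:R * w z).
have wL' : L2r w'.
  apply: L2r_dom wL => [|z].
    by apply: measurable_funM; [exact: mes_lt|apply: measurable_funM; [exact: mes_ge|exact: intg_mes]].
  by apply: le_trans (bool_norm_le _ _) _; exact: bool_norm_le.
have -> : prim w x - prim w y = int (fun z => \1_(`[y, x]%classic) z * w' z).
  rewrite -intB; try exact: intg_prim.
  apply: eq_int => z; rewrite /w' indicE.
  have [zy|yz] := ltP z y.
    by rewrite (lt_le_trans zy xy) mul0r mulr0 mulr0 subrr.
  rewrite mul0r subr0 mul1r; have [zx|xz] := ltP z x; last by rewrite !mul0r mulr0.
  by rewrite mem_set/= ?mul1r// in_itv/= yz ltW.
apply: le_trans (int_itv_sqr_le xy wL') _; rewrite ler_wpM2l ?subr_ge0//.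
apply: int_le; [by case: wL'|by case: wL|move=> z].
rewrite -(real_normK (num_real (w' z))) -(real_normK (num_real (w z))).
rewrite lerXn2r ?nnegrE//; apply: le_trans (bool_norm_le _ _) _; exact: bool_norm_le.
Qed.

Lemma prim_bounded a w x : 0 < a -> meanzero a w -> prim w x ^+ 2 <= 2 * a * nr w.
Proof.
move=> a0 wZ; have wi := meanzero_intg wZ; have [wL wa w0] := wZ.
have Va := prim_supp wi wa w0.
have [xa|xa] := boolP (`|x| < a); last first.
  by rewrite Va// expr0n/= mulr_ge0 ?nr_ge0// mulr_ge0// ltW.
have h := prim_holder x (- a) wL wi.
have -> : prim w x = prim w x - prim w (- a).
  by rewrite (Va (- a)) ?subr0// normrN gtr0_norm// ltxx.
apply: (le_trans h); rewrite ler_wpM2r ?nr_ge0// opprK.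
by apply: le_trans (ler_normD _ _) _; rewrite (gtr0_norm a0); lra.
Qed.

Lemma L2r_bounded a v B : measurable_fun setT v -> suppin a v -> (forall x, v x ^+ 2 <= B) -> L2r v.
Proof.
move=> mv va vB; split => //; apply: intg_dom (intgZ B (intg_itv (- a) a true false)).
  exact: measurable_funX.
move=> x; rewrite ger0_norm ?sqr_ge0// indicE.
have [xa|xa] := boolP (`|x| < a); last first.
  by rewrite va// expr0n/= mulr_ge0// (le_trans _ (vB 0))// sqr_ge0.
by rewrite mem_set ?mulr1//= in_itv/= -ler_norml ltW.
Qed.

Lemma prim_L2r a w : 0 < a -> meanzero a w -> L2r (prim w).
Proof.
move=> a0 wZ; have wi := meanzero_intg wZ; have [wL wa w0] := wZ.
apply: (@L2r_bounded a _ (2 * a * nr w)); first by apply: mes_prim; exact: intg_mes.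
  exact: prim_supp.
by move=> x; exact: prim_bounded.
Qed.

(** The increment by b has square at most b [nr w] and vanishes off two intervals of length 2a, so
    [NN] is O(b), and the kernel is integrable against b. *)
Lemma prim_dE a w : 0 < a -> meanzero a w -> dE (prim w).
Proof.
move=> a0 wZ; have wi := meanzero_intg wZ; have [wL wa w0] := wZ.
have VL := prim_L2r a0 wZ; have Va := prim_supp wi wa w0.
apply: (@intg_kker_le _ _ (4 * a * nr w)); first exact: mes_NN.
move=> b b0; rewrite ger0_norm ?NN_ge0// NN_nr.
have i1 := intg_itv (- a) a true false; have i2 := intg_shift (- b) i1.
apply: le_trans (_ : int (fun y => (b * nr w) * (\1_(`[- a, a]%classic) y + \1_(`[- a, a]%classic) (y - b))) <= _).
  apply: int_le; [by case: (L2r_diff b VL)|by apply: intgZ; exact: intgD|move=> y].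
  have c0 : 0 <= b * nr w by rewrite mulr_ge0 ?nr_ge0// ltW.
  have h : (prim w y - prim w (y - b)) ^+ 2 <= b * nr w.
    by apply: le_trans (prim_holder y (y - b) wL wi) _; rewrite subKr gtr0_norm.
  have [ya|ya] := boolP (`|y| < a).
    apply: (le_trans h); rewrite -[leLHS]mulr1 ler_wpM2l// indicE mem_set ?lerDl ?indicE//.
    by rewrite /= in_itv/= -ler_norml ltW.
  have [yb|yb] := boolP (`|y - b| < a).
    apply: (le_trans h); rewrite -[leLHS]mulr1 ler_wpM2l// addrC indicE mem_set ?lerDl ?indicE//.
    by rewrite /= in_itv/= -ler_norml ltW.
  by rewrite !Va// subrr expr0n/= mulr_ge0// addr_ge0// indicE.
rewrite intZ; last exact: intgD.
rewrite intD// int_shift// int_indic_itv; last by lra.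
by rewrite le_eqVlt; apply/orP; left; apply/eqP; ring.
Qed.

End Primitive.

(** * Ramps integrated against correlations *)

Section Correlation.
Context {R : realType}.
Implicit Types u v w f g : R -> R.

Lemma intg2_corr f g : intg f -> intg g -> intg2 (fun z : R * R => f z.1 * g (z.1 - z.2)).
Proof.
move=> fi gi; have mf := intg_mes fi; have mg := intg_mes gi.
apply: (@intg2_le _ _ (fun x => int (fun y => `|g y|) * `|f x|)).
- apply: measurable_funM; first exact: mes_comp_fst.
  by apply: (measurableT_comp mg); apply: measurable_funB; [exact: measurable_fst|exact: measurable_snd].
- by move=> x /=; apply: intgZ; exact: intg_refl.
- move=> x /=; under eq_int do rewrite normrM.
  rewrite intZ; last by apply: (@intg_refl _ x (fun y => `|g y|)); exact: intg_norm.
  by rewrite (int_refl x (intg_norm gi)) mulrC.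
- by apply: intgZ; exact: intg_norm.
Qed.

Lemma intg_rr v w : intg v -> intg w -> intg (rr v w).
Proof. by move=> vi wi; have [_ h _] := fubini (intg2_corr vi wi). Qed.

(** Fubini: the tail integral of w(x - t) over t > r is the primitive of w at x - r. *)
Lemma int_rr_gt v w r : intg v -> intg w ->
  int (fun t => (r < t)%R%:R * rr v w t) = rr v (prim w) r.
Proof.
move=> vi wi.
have F2 : intg2 (fun z : R * R => (r < z.2)%R%:R * (v z.1 * w (z.1 - z.2))).
  apply: intg2_dom (_ : intg2 (fun z : R * R => `|v z.1| * `|w (z.1 - z.2)|)).
  - apply: measurable_funM; first exact: mes_comp_snd (mes_gt r).
    exact: intg2_mes (intg2_corr vi wi).
  - by move=> z; rewrite -normrM; exact: bool_norm_le.
  - exact: (intg2_corr (intg_norm vi) (intg_norm wi)).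
have [_ _ h] := fubini F2.
transitivity (int (fun y => int (fun x => (r < y)%R%:R * (v x * w (x - y))))).
  apply: eq_int => t; rewrite /rr; case: (r < t).
    by rewrite mul1r; apply: eq_int => x; rewrite mul1r.
  by rewrite mul0r -[LHS](@int0 R); apply: eq_int => x; rewrite mul0r.
rewrite -h; apply: eq_int => x /=.
rewrite (_ : (fun y => _) = (fun y => v x * ((r < y)%R%:R * w (x - y)))); last first.
  by apply/funext => y; ring.
have i : intg (fun y => (r < y)%R%:R * w (x - y)).
  by apply: (@intg_boolM _ (fun y => r < y)); [exact: mes_gt|exact: intg_refl].
rewrite intZ//; congr (_ * _).
have i2 : intg (fun y => (y < x - r)%R%:R * w y) by exact: intg_prim.
rewrite /prim -(int_refl x i2); apply: eq_int => y; congr (_%:R * _).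
by rewrite ltrD2l ltrN2.
Qed.

Context (a : R) (a0 : 0 < a).

(** The second integration. The tail of w beyond x + b is minus its primitive there, because w has
    mean zero; this is the origin of the sign. *)
Lemma int_rr_ge v w b : L2r v -> intg v -> meanzero a w ->
  int (fun r => (b <= r)%R%:R * rr w v r) = - rr v (prim w) (- b).
Proof.
move=> vL vi wZ; have wi := meanzero_intg wZ; have [wL wa w0] := wZ.
have mg : measurable_fun setT w by exact: intg_mes.
have F2 : intg2 (fun z : R * R => (b <= z.2)%R%:R * (v z.1 * w (z.1 + z.2))).
  have wi' : intg (fun y => w (- y)).
    by apply: eq_intg (intg_refl 0 wi) => y; rewrite sub0r.
  have vi' : intg (fun y => v (- y)).
    by apply: eq_intg (intg_refl 0 vi) => y; rewrite sub0r.
  apply: (@intg2_le _ _ (fun x => int (fun y => `|w y|) * `|v x|)).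
  - apply: measurable_funM; first exact: mes_comp_snd (mes_ge b).
    apply: measurable_funM; first by apply: mes_comp_fst; exact: intg_mes.
    by apply: (measurableT_comp mg); apply: measurable_funD; [exact: measurable_fst|exact: measurable_snd].
  - move=> x /=; apply: (@intg_boolM _ (fun y => b <= y)); first exact: mes_ge.
    by apply: intgZ; apply: eq_intg (intg_shift x wi) => y; rewrite addrC.
  - move=> x /=; have j : intg (fun y => `|w (x + y)|).
      by apply: eq_intg (intg_norm (intg_shift x wi)) => y; rewrite addrC.
    apply: le_trans (_ : int (fun y => `|v x| * `|w (x + y)|) <= _).
      apply: int_le; [|exact: intgZ|by move=> y; rewrite -normrM; exact: bool_norm_le].
      apply: intg_norm; apply: (@intg_boolM _ (fun y => b <= y)); first exact: mes_ge.
      by apply: intgZ; apply: eq_intg (intg_shift x wi) => y; rewrite addrC.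
    rewrite intZ// mulrC ler_wpM2r// -(int_shift x (intg_norm wi)).
    by rewrite le_eqVlt; apply/orP; left; apply/eqP; apply: eq_int => y; rewrite addrC.
  - by apply: intgZ; exact: intg_norm.
have [_ _ h] := fubini F2.
transitivity (int (fun y => int (fun x => (b <= y)%R%:R * (v x * w (x + y))))).
  apply: eq_int => r; rewrite -[X in rr _ _ X]opprK rrC// /rr.
  case: (b <= r); rewrite ?mul1r ?mul0r.
    by apply: eq_int => x; rewrite mul1r opprK.
  by rewrite -[LHS](@int0 R); apply: eq_int => x; rewrite mul0r.
rewrite -h /rr -mulN1r -intZ; last first.
  by apply: intg_ip vL _; apply: (@L2r_shift _ (- - b)); exact: prim_L2r a0 wZ.
apply: eq_int => x /=.
rewrite (_ : (fun y => _) = (fun y => v x * ((b <= y)%R%:R * w (x + y)))); last first.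
  by apply/funext => y; ring.
rewrite intZ; last first.
  apply: (@intg_boolM _ (fun y => b <= y)); first exact: mes_ge.
  by apply: eq_intg (intg_shift x wi) => y; rewrite addrC.
rewrite mulrCA mulN1r; congr (_ * _).
rewrite opprK -[RHS]add0r -{1}w0 -int_ge_prim//.
have i3 : intg (fun y => (x + b <= y)%R%:R * w y).
  by apply: (@intg_boolM _ (fun y => x + b <= y)) => //; exact: mes_ge.
rewrite -(int_shift x i3).
by apply: eq_int => y; rewrite [y + x]addrC lerD2l.
Qed.

Lemma ramp_le (b L : R) c t : suppin L c -> `|Num.max 0 (t - b) * c t| <= (L + `|b|) * `|c t|.
Proof.
move=> cL; rewrite normrM.
have [tL|tL] := boolP (`|t| < L); last by rewrite cL// normr0 !mulr0.
rewrite ler_wpM2r// ger0_norm ?le_max ?lexx// maxEle; case: ifP => _.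
  by rewrite lerD//; [exact: le_trans (ler_norm _) (ltW tL)|rewrite -normrN ler_norm].
by rewrite addr_ge0// (le_trans _ (ltW tL)).
Qed.

Lemma intg_ramp (b L : R) c : intg c -> suppin L c -> intg (fun t => Num.max 0 (t - b) * c t).
Proof.
move=> ci cL; apply: intg_dom (intgZ (L + `|b|) (intg_norm ci)); last by move=> t; exact: ramp_le.
apply: measurable_funM; last exact: intg_mes.
by apply: measurable_maxr => //; exact: measurable_funB.
Qed.

(** The ramp max(0, t - b) is the integral over r of the indicator of b <= r < t; Fubini then splits
    the pairing into two successive tail integrals. *)
Lemma int_ramp (b L : R) c : intg c -> suppin L c ->
  int (fun t => Num.max 0 (t - b) * c t) =
  int (fun r => (b <= r)%R%:R * int (fun t => (r < t)%R%:R * c t)).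
Proof.
move=> ci cL.
pose B t r : R := (b <= r)%R%:R * (r < t)%R%:R.
have iB t : intg (B t).
  apply: eq_intg (intg_itv b t true true) => r.
  rewrite /B indicE; have [br|br] := leP b r; have [rt|rt] := ltP r t; rewrite ?mulr1 ?mulr0.
  - by rewrite mem_set//= in_itv/= br.
  - by rewrite memNset//= in_itv/= br ltNge rt.
  - by rewrite memNset//= in_itv/= leNgt br.
  - by rewrite memNset//= in_itv/= leNgt br.
have intB t : int (B t) = Num.max 0 (t - b).
  rewrite maxEle subr_ge0; have [bt|bt] := leP b t.
    rewrite -(int_indic_itvco bt); apply: eq_int => r; rewrite /B indicE.
    have [br|br] := leP b r; have [rt|rt] := ltP r t; rewrite ?mulr1 ?mulr0.
    - by rewrite mem_set//= in_itv/= br.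
    - by rewrite memNset//= in_itv/= br ltNge rt.
    - by rewrite memNset//= in_itv/= leNgt br.
    - by rewrite memNset//= in_itv/= leNgt br.
  rewrite -[RHS](@int0 R); apply: eq_int => r; rewrite /B.
  by have [br|br] := leP b r; rewrite ?mul0r// ltNge (le_trans (ltW bt) br)/= mulr0.
have mB : measurable_fun setT (fun z : R * R => B z.1 z.2).
  apply: measurable_funM; first exact: mes_comp_snd (mes_ge b).
  exact: mes_lt2.
have F2 : intg2 (fun z : R * R => B z.1 z.2 * c z.1).
  apply: (@intg2_le _ _ (fun t => (L + `|b|) * `|c t|)).
  - by apply: measurable_funM => //; apply: mes_comp_fst; exact: intg_mes.
  - by move=> t /=; apply: eq_intg (intgZ (c t) (iB t)) => r; rewrite mulrC.
  - move=> t /=; have -> : (fun r => `|B t r * c t|) = (fun r => `|c t| * B t r).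
      apply/funext => r; rewrite normrM mulrC; congr (_ * _); apply: ger0_norm.
      by rewrite mulr_ge0.
    rewrite intZ// intB mulrC; apply: le_trans (ramp_le b t cL).
    by rewrite normrM [X in _ <= X * _]ger0_norm// le_max lexx.
  - by apply: intgZ; exact: intg_norm.
have [_ _ h] := fubini F2.
rewrite (_ : int (fun t => _ * c t) = int (fun t => int (fun r => B t r * c t))); last first.
  apply: eq_int => t; rewrite -intB mulrC -intZ//; apply: eq_int => r; exact: mulrC.
rewrite h; apply: eq_int => r; rewrite /B /=.
case: (b <= r); last first.
  by rewrite mul0r -[RHS](@int0 R); apply: eq_int => t; rewrite !mul0r.
by rewrite mul1r; apply: eq_int => t; rewrite mul1r.
Qed.

Lemma int_ramp_rr w w' b : meanzero a w -> meanzero a w' ->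
  int (fun t => Num.max 0 (t - b) * rr w' w t) = - rr (prim w) (prim w') (- b).
Proof.
move=> wZ w'Z; have wi := meanzero_intg wZ; have w'i := meanzero_intg w'Z.
have [wL wa w0] := wZ; have [w'L w'a _] := w'Z.
have Vi : intg (prim w) by apply: (@L2r_intg _ a); [exact: prim_L2r a0 wZ|exact: prim_supp].
rewrite (@int_ramp _ (2 * a)); last first.
- by move=> t; rewrite -leNgt => ta; exact: (rr_supp w'a wa).
- exact: intg_rr.
under eq_int do rewrite int_rr_gt//.
by apply: int_rr_ge => //; exact: (prim_L2r a0 wZ).
Qed.

(** For b >= 0 the even ramp is the sum of a right and a left ramp; the reflection t -> -t turns the
    left one into the right one with w and w' exchanged. *)
Lemma int_TT_rr w w' b : 0 <= b -> meanzero a w -> meanzero a w' ->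
  int (fun t => TT b t * rr w' w t) = - (rr (prim w) (prim w') b + rr (prim w) (prim w') (- b)).
Proof.
move=> b0 wZ w'Z; have wi := meanzero_intg wZ; have w'i := meanzero_intg w'Z.
have [wL wa _] := wZ; have [w'L w'a _] := w'Z.
have ri : intg (fun t => Num.max 0 (t - b) * rr w' w t).
  by apply: (@intg_ramp _ (2 * a)); [exact: intg_rr|move=> t; rewrite -leNgt => ta; exact: (rr_supp w'a wa)].
have ri' : intg (fun t => Num.max 0 (t - b) * rr w w' t).
  by apply: (@intg_ramp _ (2 * a)); [exact: intg_rr|move=> t; rewrite -leNgt => ta; exact: (rr_supp wa w'a)].
have -> : int (fun t => TT b t * rr w' w t) =
    int (fun t => Num.max 0 (t - b) * rr w' w t + Num.max 0 (- t - b) * rr w w' (- t)).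
  apply: eq_int => t; rewrite (@rrC _ w w')// -mulrDl; congr (_ * _); rewrite /TT.
  have [t0|t0] := leP 0 t.
    by rewrite (ger0_norm t0) (max_l (_ : - t - b <= 0)) ?addr0//; lra.
  by rewrite (ltr0_norm t0) (max_l (_ : t - b <= 0)) ?add0r//; lra.
rewrite intD//; last by apply: eq_intg (intg_refl 0 ri') => t; rewrite sub0r.
rewrite int_ramp_rr//.
have -> : int (fun t => Num.max 0 (- t - b) * rr w w' (- t)) = - rr (prim w') (prim w) (- b).
  have := int_refl 0 ri'; rewrite (int_ramp_rr b w'Z wZ) => <-.
    by apply: eq_int => t; congr (Num.max 0 (_ - b) * rr w w' _); rewrite sub0r.
have -> : rr (prim w') (prim w) (- b) = rr (prim w) (prim w') b.
  by apply: rrC; [exact: prim_L2r w'Z|exact: prim_L2r wZ].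
by move: (rr _ _ (- b)) (rr _ _ b) => x y; rewrite opprD addrC.
Qed.

End Correlation.

(** * The screw kernel against correlations: the Weil form *)

Section KeyIdentity.
Context {R : realType}.
Implicit Types u v w f g c : R -> R.

(** Domination of F by a function of b alone is only asked for |x| < L; elsewhere the factor c
    vanishes. *)
Lemma fub_dom (F : R * R -> R) g c L : measurable_fun setT F -> intg g -> intg c -> suppin L c ->
  (forall x b, `|x| < L -> `|F (x, b)| <= g b) ->
  [/\ intg (fun x => int (fun b => F (x, b)) * c x),
      intg (fun b => int (fun x => F (x, b) * c x)) &
      int (fun x => int (fun b => F (x, b)) * c x) = int (fun b => int (fun x => F (x, b) * c x))].
Proof.
move=> mF gi ci cL Fg; have mc := intg_mes ci.
have F2 : intg2 (fun z : R * R => F z * c z.1).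
  apply: intg2_dom (intg2_prod (intg_norm ci) (intg_norm gi)).
    by apply: measurable_funM => //; exact: mes_comp_fst.
  move=> [x b] /=; rewrite normrM mulrC.
  have [xL|xL] := boolP (`|x| < L); last by rewrite cL// normr0 !mul0r.
  by rewrite ler_wpM2l// (le_trans (Fg _ b xL))// ler_norm.
have [i1 i2 e] := fubini F2.
have E x : int (fun b => F (x, b)) * c x = int (fun b => F (x, b) * c x).
  have [xL|xL] := boolP (`|x| < L); last first.
    by rewrite cL// mulr0 -[LHS](@int0 R); apply: eq_int => b; rewrite mulr0.
  have Fi : intg (fun b => F (x, b)).
    by apply: intg_dom gi; [exact: mes_fst|move=> b; exact: Fg].
  by rewrite mulrC -intZ//; apply: eq_int => b; rewrite mulrC.
split => //; first by apply: eq_intg i1 => x; rewrite E.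
by rewrite -e; apply: eq_int => x; exact: E.
Qed.

(* The Weil functional without its energy part, for f supported in [-2a, 2a] and N >= e^(2a);
   by [weil_constant] the energy part turns the constant of the functional into
   digamma(1/4) - ln pi. *)
Definition Kf (N : nat) f : R :=
  int (fun x => f x * cosh2 x)
  - \sum_(1 <= n < N.+1) von_mangoldt n / Num.sqrt n%:R * (f (ln n%:R) + f (- ln n%:R))
  + (digamma (1 / 4) - ln pi) * f 0.

Definition qform (N : nat) v w : R := Kf N (rr v w) + EE v w.

Lemma cosh2_ge0 b : 0 <= cosh2 b :> R.
Proof. by rewrite addr_ge0// expR_ge0. Qed.

Lemma cosh2N b : cosh2 (- b) = cosh2 b :> R.
Proof. by rewrite /cosh2 opprK addrC. Qed.

Lemma cosh2_le (L b : R) : `|b| <= L -> cosh2 b <= 2 * expR L.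
Proof.
move=> bL; have [b1 b2] : b <= L /\ - b <= L.
  by rewrite -normrN in bL *; split; [rewrite -[b]opprK|]; apply: le_trans (ler_norm _) _; rewrite ?normrN// -normrN.
have L0 : 0 <= L by apply: le_trans bL.
by rewrite mulr_natl mulr2n lerD// ler_expR; lra.
Qed.

Lemma intg_cosh2 (L : R) f : intg f -> suppin L f -> intg (fun x => f x * cosh2 x).
Proof.
move=> fi fL; apply: intg_dom (intgZ (2 * expR L) (intg_norm fi)).
  by apply: measurable_funM; [exact: intg_mes|exact: mes_cosh2].
move=> x; rewrite normrM (ger0_norm (cosh2_ge0 _)) mulrC.
have [xL|xL] := boolP (`|x| < L); last by rewrite fL// normr0 !mulr0.
by rewrite ler_wpM2r// cosh2_le// ltW.
Qed.

Lemma int_cosh2_sym (L : R) f : intg f -> suppin L f ->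
  int (fun x => f x * cosh2 x) =
  int (fun b => \1_(`[0, L]%classic) b * (cosh2 b * (f b + f (- b)))).
Proof.
move=> fi fL; have i := intg_cosh2 fi fL.
have mf := intg_mes fi.
have hi : intg (hp (fun x => f x * cosh2 x)).
  apply: intg_dom (intg_norm i); first by apply: mes_hp; exact: intg_mes.
  by move=> x; rewrite /hp; case: ifP; rewrite ?normr0.
have ji := intg_refl 0 (intgB i hi).
have -> : int (fun x => f x * cosh2 x) = int (fun x => hp (fun x => f x * cosh2 x) x +
    (f (0 - x) * cosh2 (0 - x) - hp (fun x => f x * cosh2 x) (0 - x))).
  rewrite intD// (int_refl 0 (intgB i hi)) intB// addrC subrK//.
(* The folded integrand counts f(0) twice at the single point 0. *)
apply: (@int_off _ 0); first exact: intg_mes (intgD hi ji).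
  apply: measurable_funM; first exact: intg_mes (intg_itv 0 L true false).
  apply: measurable_funM; first exact: mes_cosh2.
  by apply: measurable_funD => //; apply: intg_mes; apply: eq_intg (intg_refl 0 fi) => b; rewrite sub0r.
move=> b b0; rewrite sub0r /hp indicE oppr_gt0; case: ltP => b0'; last first.
  have b0'' : b < 0 by rewrite lt_neqAle b0.
  by rewrite b0'' subrr addr0 memNset ?mul0r//= in_itv/= leNgt b0''.
rewrite ltNge (ltW b0')/= subr0 cosh2N -mulrDl.
have [bL|bL] := leP b L.
  by rewrite mem_set/= ?in_itv/= ?(ltW b0')// mul1r mulrC.
rewrite memNset/= ?mul0r; last by rewrite in_itv/= (ltW b0')/= leNgt bL.
by rewrite !fL ?addr0 ?mul0r// ?normrN -leNgt ger0_norm ?(ltW b0')// ltW.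
Qed.

Lemma mes_TT2 : measurable_fun setT (fun z : R * R => TT z.2 z.1).
Proof.
apply: measurable_maxr => //; apply: measurable_funB; last exact: measurable_snd.
by apply: (measurableT_comp (@normr_measurable _ setT)); exact: measurable_fst.
Qed.

(** The difference of a ramp at 0 and one at b is what produces the combination 2 f(0) - f(b) -
    f(-b) of the energy. *)
Lemma minTT (b t : R) : 0 <= b -> Num.min b `|t| = TT 0 t - TT b t :> R.
Proof.
move=> b0; rewrite (TT_ge0 (normr_ge0 _)) subr0; have [tb|bt] := leP `|t| b.
  by rewrite TT_le0// subr0.
by rewrite TT_ge0 ?subKr ?ltW.
Qed.

Lemma TT_bound (b t L : R) : 0 <= b -> `|t| < L -> 0 <= TT b t <= L.
Proof.
move=> b0 tL; rewrite /TT le_max lexx/= ge_max (le_trans (normr_ge0 t) (ltW tL))/=.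
by rewrite lerBlDr (le_trans (ltW tL))// lerDl.
Qed.

Lemma intg_TTM (b L : R) c : 0 <= b -> intg c -> suppin L c -> intg (fun t => TT b t * c t).
Proof.
move=> b0 ci cL; apply: intg_dom (intgZ L (intg_norm ci)).
  apply: measurable_funM; last exact: intg_mes.
  exact: (mes_snd mes_TT2 b).
move=> t; rewrite normrM; have [tL|tL] := boolP (`|t| < L); last by rewrite cL// normr0 !mulr0.
by have /andP[t0 t1] := TT_bound b0 tL; rewrite (ger0_norm t0) ler_wpM2r.
Qed.

Lemma ln_nat_ge0 (n : nat) : 0 <= ln n%:R :> R.
Proof. by case: n => [|n]; [rewrite ln0|rewrite ln_ge0// ler1n]. Qed.

Context (a : R) (a0 : 0 < a).

(* The screw function is a superposition of the ramps [TT b], and pairing a ramp with the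
   correlation of w and w' integrates that correlation twice. *)
Lemma int_screw_rr N w w' : expR (2 * a) <= N%:R -> meanzero a w -> meanzero a w' ->
  int (fun t => screw t * rr w' w t) = qform N (prim w) (prim w').
Proof.
move=> LN wZ w'Z; have wi := meanzero_intg wZ; have w'i := meanzero_intg w'Z.
have [wL wa w0] := wZ; have [w'L w'a w'0] := w'Z.
have VL := prim_L2r a0 wZ; have WL := prim_L2r a0 w'Z.
have Va := prim_supp wi wa w0; have Wa := prim_supp w'i w'a w'0.
set V := prim w in VL Va *; set W := prim w' in WL Wa *.
pose c := rr w' w; pose f := rr V W.
have ci : intg c by exact: intg_rr.
have cL : suppin (2 * a) c by move=> t; rewrite -leNgt => ta; exact: (rr_supp w'a wa).
have fL : suppin (2 * a) f by move=> t; rewrite -leNgt => ta; exact: (rr_supp Va Wa).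
have fi : intg f by apply: intg_rr; [exact: L2r_intg VL Va|exact: L2r_intg WL Wa].
have TTc b : 0 <= b -> int (fun t => TT b t * c t) = - (f b + f (- b)).
  by move=> b0; rewrite (int_TT_rr a0 b0 wZ w'Z).
have TTi b : 0 <= b -> intg (fun t => TT b t * c t).
  by move=> b0; exact: intg_TTM cL.
have L0 : 0 <= 2 * a by rewrite mulr_ge0// ltW.
pose F1 (z : R * R) := \1_(`[0, 2 * a]%classic) z.2 * (cosh2 z.2 * TT z.2 z.1).
have [] := @fub_dom F1 (fun b => 2 * expR (2 * a) * (2 * a) * \1_(`[0, 2 * a]%classic) b) c (2 * a) _ _ ci cL _.
- apply: measurable_funM; first exact: mes_comp_snd (intg_mes (intg_itv 0 (2 * a) true false)).
  by apply: measurable_funM; [exact: mes_comp_snd mes_cosh2|exact: mes_TT2].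
- exact/intgZ/intg_itv.
- move=> t b tL; rewrite /F1 /= indicE.
  have [/set_mem/=|_] := boolP (b \in _); last by rewrite mul0r normr0 mulr0.
  rewrite in_itv/= => /andP[b0 bL]; rewrite mul1r mulr1.
  have /andP[t0 t1] := TT_bound b0 tL.
  rewrite ger0_norm; last by rewrite mulr_ge0// cosh2_ge0.
  apply: ler_pM => //; first exact: cosh2_ge0.
  by apply: cosh2_le; rewrite ger0_norm.
move=> I1 I1' E1.
pose F2 (z : R * R) := hp kker z.2 * Num.min z.2 `|z.1|.
have [] := @fub_dom F2 (hp (fun b => kker b * b)) c (2 * a) _ _ ci cL _.
- apply: measurable_funM; first exact: mes_comp_snd mes_kker.
  apply: measurable_minr; first exact: measurable_snd.
  by apply: (measurableT_comp (@normr_measurable _ setT)); exact: measurable_fst.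
- exact: intg_kker_mul.
- move=> t b tL; rewrite /F2 /= /hp; case: ifPn => b0; last by rewrite mul0r normr0.
  rewrite ger0_norm; last by apply: mulr_ge0; [exact/ltW/kker_gt0|rewrite le_min (ltW b0) normr_ge0].
  by rewrite ler_wpM2l ?ge_min ?lexx// ltW// kker_gt0.
move=> I2 I2' E2.
have e1 : int (fun x => int (fun b => F1 (x, b)) * c x) = - int (fun x => f x * cosh2 x).
  rewrite E1 (int_cosh2_sym fi fL); apply: oppr_inj; rewrite opprK -intN//.
  apply: eq_int => b; rewrite /F1/= indicE.
  have [/set_mem/=|_] := boolP (b \in _); last first.
    by rewrite mul0r -[RHS]oppr0; congr (- _); rewrite -[RHS](@int0 R); apply: eq_int => t; rewrite !mul0r.
  rewrite in_itv/= => /andP[b0 _].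
  rewrite mul1r -[f b + _]opprK -TTc// mulrN -intZ; last exact: TTi.
  by congr (- _); apply: eq_int => t; rewrite mul1r mulrA.
(* The ramps at 0 and b pair with c to give -2 f(0) and -(f(b) + f(-b)); their difference is
   -[NN V W b]. *)
have e2 : int (fun x => int (fun b => F2 (x, b)) * c x) = - EE V W.
  rewrite E2 EE_int; apply: oppr_inj; rewrite opprK -intN//.
  apply: eq_int => b; rewrite /F2/= /enI /hp; case: ifPn => b0; last first.
    by rewrite -[RHS]oppr0; congr (- _); rewrite -[RHS](@int0 R); apply: eq_int => t; rewrite !mul0r.
  have b0' := ltW b0.
  transitivity (- (kker b * int (fun t => TT 0 t * c t - TT b t * c t))).
    rewrite -intZ; last by apply: intgB; exact: TTi.
    by congr (- _); apply: eq_int => t; rewrite minTT// -mulrBl mulrA.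
  rewrite intB ?TTc//; try exact: TTi.
  rewrite NN_rr// -rr0 -/f oppr0; move: (f 0) (f b) (f (- b)) (kker b) => x y z k; ring.
have lnn (n : nat) := ln_nat_ge0 n.
pose P n t := von_mangoldt n / Num.sqrt n%:R * (TT (ln n%:R) t * c t).
have Pi n : intg (P n) by apply: intgZ; exact: TTi.
have sumi : intg (fun t => \sum_(1 <= n < N.+1) P n t) by exact: intg_sum.
(* The four terms of [screwE], each multiplied by c. The linear term |t| is the ramp at 0, whose
   pairing -2 f(0) cancels the denominator 2. *)
transitivity (int (fun t => - (int (fun b => F1 (t, b)) * c t) +
    \sum_(1 <= n < N.+1) P n t
    - (digamma (1 / 4) - ln pi) / 2 * (TT 0 t * c t) - int (fun b => F2 (t, b)) * c t)).
  apply: eq_int => t; have [tL|tL] := boolP (`|t| < 2 * a); last first.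
    rewrite -/c (cL _ tL) !mulr0 oppr0 big1 ?addr0 ?subr0//; by move=> n _; rewrite /P (cL _ tL) !mulr0.
  rewrite (screwE (ltW tL) LN) (TT_ge0 (normr_ge0 _)) subr0.
  have -> : int (hp (fun b => kker b * Num.min b `|t|)) = int (fun b => F2 (t, b)).
    by apply: eq_int => b; rewrite hpM.
  rewrite -/c mulrBl mulrBl mulrDl mulNr mulr_suml; congr (_ + _ - _ - _); last by rewrite mulrA.
  by apply: eq_bigr => n _; rewrite /P mulrA.
have i3 : intg (fun t => (digamma (1 / 4) - ln pi) / 2 * (TT 0 t * c t)) by apply: intgZ; exact: TTi.
have i12 := intgD (intgN I1) sumi.
rewrite intB//; last exact: intgB.
rewrite intB// intD//; last exact: intgN.
rewrite intN// e1 e2 !opprK intZ; last exact: TTi.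
rewrite TTc// oppr0 int_sum// /qform /Kf; congr (_ + _).
rewrite -/f -addrA -[RHS]addrA; congr (_ + _).
rewrite -sumrN; congr (_ + _).
  by apply: eq_bigr => n _; rewrite intZ ?TTc ?mulrN//; exact: TTi.
by move: (f 0) (digamma _) (ln pi) => x y z; field.
Qed.

(* The operator represented by [qform]: B_a v is its value at v, on ]-a, a[. *)
Definition weilop N V x : R :=
  int (fun b => \1_(`[- (2 * a), 2 * a]%classic) b * (cosh2 b * V (x + b)))
  - \sum_(1 <= n < N.+1) von_mangoldt n / Num.sqrt n%:R * (V (x + ln n%:R) + V (x - ln n%:R))
  + (digamma (1 / 4) - ln pi) * V x
  + int (fun b => hp kker b * (2 * V x - V (x + b) - V (x - b))).

Lemma prim_norm_le w x : meanzero a w -> `|prim w x| <= Num.sqrt (2 * a * nr w).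
Proof.
by move=> wZ; rewrite -sqrtr_sqr ler_wsqrtr// prim_bounded.
Qed.

Lemma prim_holder_norm w x y : meanzero a w ->
  `|prim w x - prim w y| <= Num.sqrt (nr w) * Num.sqrt `|x - y|.
Proof.
move=> wZ; have [wL _ _] := wZ.
rewrite -sqrtr_sqr -sqrtrM ?nr_ge0// ler_wsqrtr// mulrC.
by apply: prim_holder => //; exact: meanzero_intg wZ.
Qed.

(** The only delicate term is the last: the second difference of a Hoelder-1/2 function is O(sqrt
    b), integrable against the kernel by [intg_kker_sqrt]. The operator therefore yields a bounded
    function, in L^2 once cut to the interval, and Fubini identifies its pairing. *)
Lemma weilop_ip N w v : meanzero a w -> L2r v -> suppin a v ->
  [/\ L2r (fun x => (`|x| < a)%R%:R * weilop N (prim w) x) &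
   ip (fun x => (`|x| < a)%R%:R * weilop N (prim w) x) v = qform N (prim w) v].
Proof.
move=> wZ vL va; have wi := meanzero_intg wZ.
have [wL wa w0] := wZ; have VL := prim_L2r a0 wZ.
have Va := prim_supp wi wa w0.
have mV : measurable_fun setT (prim w) by case: VL.
have VB x : `|prim w x| <= Num.sqrt (2 * a * nr w) by exact: prim_norm_le.
have Vh x y := prim_holder_norm x y wZ.
(* From here on the primitive enters only through square integrability, support, bound and Hoelder
   estimate. *)
move: (prim w) VL Va mV VB Vh => V VL Va mV VB Vh.
have vi := L2r_intg vL va.
pose f := rr V v.
have fL : suppin (2 * a) f by move=> t; rewrite -leNgt => ta; exact: (rr_supp Va va).
have fi : intg f by apply: intg_rr => //; exact: L2r_intg VL Va.
have mVD : measurable_fun setT (fun z : R * R => V (z.1 + z.2)).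
  by apply: (measurableT_comp mV); apply: measurable_funD; [exact: measurable_fst|exact: measurable_snd].
have mVB : measurable_fun setT (fun z : R * R => V (z.1 - z.2)).
  by apply: (measurableT_comp mV); apply: measurable_funB; [exact: measurable_fst|exact: measurable_snd].
set B := Num.sqrt _ in VB; set H := Num.sqrt (nr w) in Vh.
pose F1 (z : R * R) := \1_(`[- (2 * a), 2 * a]%classic) z.2 * (cosh2 z.2 * V (z.1 + z.2)).
pose g1 b := 2 * expR (2 * a) * B * \1_(`[- (2 * a), 2 * a]%classic) b.
have mF1 : measurable_fun setT F1.
  apply: measurable_funM; first exact: mes_comp_snd (intg_mes (intg_itv (- (2 * a)) (2 * a) true false)).
  by apply: measurable_funM => //; exact: mes_comp_snd mes_cosh2.
have gi1 : intg g1 by exact/intgZ/intg_itv.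
have Fg1 x b : `|F1 (x, b)| <= g1 b.
  rewrite /F1 /g1 /= indicE.
  have [/set_mem/=|_] := boolP (b \in _); last by rewrite mul0r normr0 mulr0.
  rewrite in_itv/= -ler_norml => bL; rewrite mul1r mulr1 normrM.
  by apply: ler_pM => //; rewrite ger0_norm ?cosh2_ge0//; exact: cosh2_le.
pose F2 (z : R * R) := hp kker z.2 * (2 * V z.1 - V (z.1 + z.2) - V (z.1 - z.2)).
pose g2 b := 2 * H * hp (fun b => kker b * Num.sqrt b) b.
have mF2 : measurable_fun setT F2.
  apply: measurable_funM; first exact: mes_comp_snd mes_kker.
  apply: measurable_funB => //; apply: measurable_funB => //.
  by apply: measurable_funM => //; exact: mes_comp_fst.
have gi2 : intg g2 by exact/intgZ/intg_kker_sqrt.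
have Fg2 x b : `|F2 (x, b)| <= g2 b.
  rewrite /F2 /g2 /= /hp; case: ifPn => b0; last by rewrite mul0r normr0 mulr0.
  rewrite normrM (ger0_norm (ltW (kker_gt0 b0))) mulrCA ler_wpM2l ?(ltW (kker_gt0 b0))//.
  have -> : 2 * V x - V (x + b) - V (x - b) = (V x - V (x + b)) + (V x - V (x - b)) by ring.
  have e1 : `|x - (x + b)| = b by rewrite opprD addNKr normrN gtr0_norm.
  have e2 : `|x - (x - b)| = b by rewrite subKr gtr0_norm.
  have := Vh x (x + b); have := Vh x (x - b); rewrite e1 e2 => h1 h2.
  apply: le_trans (ler_normD _ _) _; rewrite -mulrA mulr_natl mulr2n; exact: lerD.
have mW : measurable_fun setT (weilop N V).
  rewrite /weilop; apply: measurable_funD; last exact: mes_int mF2.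
  apply: measurable_funD; last exact: measurable_funM.
  apply: measurable_funB; first exact: mes_int mF1.
  apply: measurable_sum => n; apply: measurable_funM => //.
  by apply: measurable_funD; apply: (measurableT_comp mV); [exact: measurable_funD|exact: measurable_funB].
have int_bd (F : R * R -> R) g x : measurable_fun setT F -> intg g -> (forall x b, `|F (x, b)| <= g b) ->
    `|int (fun b => F (x, b))| <= int g.
  move=> mF gi Fg; have Fi : intg (fun b => F (x, b)).
    by apply: intg_dom gi => //; exact: mes_fst.
  by apply: le_trans (int_norm Fi) _; apply: int_le => //; exact: intg_norm.
pose S : R := \sum_(1 <= n < N.+1) `|von_mangoldt n / Num.sqrt n%:R| * (B + B).
pose M : R := int g1 + S + `|digamma (1 / 4) - ln pi| * B + int g2.
have WM x : `|weilop N V x| <= M.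
  rewrite /weilop /M; apply: le_trans (ler_normD _ _) (lerD _ (int_bd F2 _ _ mF2 gi2 Fg2)).
  apply: le_trans (ler_normD _ _) (lerD _ _); last by rewrite normrM ler_wpM2l.
  apply: le_trans (ler_normB _ _) (lerD (int_bd F1 _ _ mF1 gi1 Fg1) _).
  apply: le_trans (ler_norm_sum _ _ _) _; apply: ler_sum => n _.
  by rewrite normrM ler_wpM2l//; apply: le_trans (ler_normD _ _) (lerD _ _).
have CL : L2r (fun x => (`|x| < a)%R%:R * weilop N V x).
  apply: (@L2r_bounded _ a _ (M ^+ 2)).
  - apply: measurable_funM => //.
    exact: (measurableT_comp (mes_lt a) (@normr_measurable _ setT)).
  - by move=> x /negbTE ->; rewrite mul0r.
  - move=> x; rewrite -(real_normK (num_real (_ * _))) lerXn2r ?nnegrE//.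
      by apply: le_trans (WM x).
    by apply: le_trans (bool_norm_le _ _) _.
split => //.
have -> : ip (fun x => (`|x| < a)%R%:R * weilop N V x) v = int (fun x => weilop N V x * v x).
  apply: eq_int => x; have [_|xa] := boolP (`|x| < a); first by rewrite mul1r.
  by rewrite va// !mulr0.
have [I1 I1' E1] := fub_dom mF1 gi1 vi va (fun x b _ => Fg1 x b).
have [I2 I2' E2] := fub_dom mF2 gi2 vi va (fun x b _ => Fg2 x b).
have iD b : intg (fun x => V (x + b) * v x) by apply: intg_ip => //; exact: L2r_shift.
have iB b : intg (fun x => V (x - b) * v x) by apply: intg_ip => //; exact: L2r_shift.
have eB b : int (fun x => V (x - b) * v x) = f (- b).
  by rewrite /f rrC//; apply: eq_int => x; rewrite mulrC.
have eD b : int (fun x => V (x + b) * v x) = f b.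
  by rewrite -[b in RHS]opprK -eB opprK.
have e1 : int (fun x => int (fun b => F1 (x, b)) * v x) = int (fun x => f x * cosh2 x).
  rewrite E1; apply: eq_int => b; rewrite /F1/= indicE.
  have [_|/negP bL] := boolP (b \in _).
    by rewrite -eD mulrC -intZ//; apply: eq_int => t; rewrite mul1r mulrA.
  rewrite fL ?mul0r; first by rewrite -[RHS](@int0 R); apply: eq_int => t; rewrite !mul0r.
  by apply/negP => /ltW bL'; apply: bL; rewrite mem_set//= in_itv/= -ler_norml.
have e2 : int (fun x => int (fun b => F2 (x, b)) * v x) = EE V v.
  rewrite E2 EE_int; apply: eq_int => b; rewrite /F2/= /enI -/f hpM NN_rr// -/f -(eD b) -(eB b).
  rewrite -intZ; last exact: intg_ip.
  rewrite -intB//; last by apply: intgZ; exact: intg_ip.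
  rewrite -intB//; last by apply: intgB => //; apply: intgZ; exact: intg_ip.
  rewrite -intZ; last by apply: intgB => //; apply: intgB => //; apply: intgZ; exact: intg_ip.
  by apply: eq_int => x; move: (hp _ _) (V x) (V (x + b)) (V (x - b)) (v x) => p q r s t; ring.
pose P n x := von_mangoldt n / Num.sqrt n%:R * (V (x + ln n%:R) * v x + V (x - ln n%:R) * v x).
have Pi n : intg (P n) by apply: intgZ; exact: intgD.
have sumi : intg (fun t => \sum_(1 <= n < N.+1) P n t) by exact: intg_sum.
transitivity (int (fun x => int (fun b => F1 (x, b)) * v x - \sum_(1 <= n < N.+1) P n x
    + (digamma (1 / 4) - ln pi) * (V x * v x) + int (fun b => F2 (x, b)) * v x)).
  apply: eq_int => x; rewrite /weilop 2!mulrDl mulrBl mulr_suml; congr (_ - _ + _ + _); last by rewrite mulrA.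
  by apply: eq_bigr => n _; rewrite /P -mulrDl mulrA.
have i3 : intg (fun x => (digamma (1 / 4) - ln pi) * (V x * v x)) by apply: intgZ; exact: intg_ip.
rewrite intD//; last by apply: intgD => //; exact: intgB.
rewrite intD//; last exact: intgB.
rewrite intB// e1 e2 /qform /Kf -/f intZ; last exact: intg_ip.
rewrite (_ : f 0 = ip V v) ?int_sum//; last exact: rr0.
congr (_ - _ + _ + _).
by apply: eq_bigr => n _; rewrite intZ ?intD ?eD ?eB//; exact: intgD.
Qed.

End KeyIdentity.

(** * Integration by parts and closure of test functions *)

Section TestFunctionCalculus.
Context {R : realType}.
Local Notation mu := (@lebesgue_measure R).
Implicit Types u v w f g phi : R -> R.

Lemma smooth_derivable f x : smooth f -> derivable f x 1.
Proof. by move=> sf; exact: (sf 0%N x). Qed.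

Lemma smooth_derive1 f : smooth f -> smooth (derive1 f).
Proof. by move=> sf n x; rewrite -derive1Sn; exact: (sf n.+1 x). Qed.

Lemma smooth_continuous f : smooth f -> continuous f.
Proof.
move=> sf x; apply: differentiable_continuous; apply/derivable1_diffP; exact: smooth_derivable.
Qed.

Lemma smooth_mes f : smooth f -> measurable_fun setT f.
Proof. by move=> sf; apply: continuous_measurable_fun; exact: smooth_continuous. Qed.

Lemma rtest_derive1 a f : rtest a f -> rtest a (derive1 f).
Proof.
move=> [sf [b ba fb]]; split; first exact: smooth_derive1.
exists b => // x bx; rewrite derive1E.
rewrite (@near_eq_derive _ _ _ f (fun=> 0) x 1); first by rewrite derive_cst.
near=> y; apply: fb; near: y.
by apply: (@cvgr_gt _ _ _ _ (fun y : R => `|y|) `|x|) => //; apply: norm_continuous.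
Unshelve. all: by end_near. Qed.

Lemma rtest_suppin a f : rtest a f -> suppin a f.
Proof. by move=> [_ [b ba fb]] x; rewrite -leNgt => ax; apply: fb; exact: lt_le_trans ax. Qed.

Lemma indic_suppin a f : suppin a f -> (fun x => \1_(`[- a, a]%classic) x * f x) = f.
Proof.
move=> fa; apply/funext => x; rewrite indicE.
have [_|ax] := boolP (x \in (`[- a, a]%classic : set R)); first by rewrite mul1r.
rewrite mul0r fa//; apply/negP => xa; move/negP: ax; apply.
by rewrite mem_set//= in_itv/= -ler_norml ltW.
Qed.

Lemma cvg0_le (e : nat -> R) x : (forall n, x <= e n) -> e n @[n --> \oo] --> 0 -> x <= 0.
Proof. by move=> xe e0; apply: (ler_cvg_to (cvg_cst x) e0); exact: nearW. Qed.

Lemma intg_cont_supp a f : continuous f -> suppin a f -> intg f.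
Proof.
move=> cf fa; have /intg_setT : mu.-integrable `[- a, a]%classic (EFin \o f).
  apply: continuous_compact_integrable; first exact: segment_compact.
  exact: continuous_subspaceT.
by move=> /(_ (measurable_itv _)); rewrite indic_suppin.
Qed.

Lemma rtest_L2r a f : rtest a f -> L2r f.
Proof.
move=> fT; have [sf _] := fT; have fa := rtest_suppin fT; split; first exact: smooth_mes.
apply: (@intg_cont_supp a); last by move=> x xa; rewrite fa// expr0n.
by move=> x; apply: cvgM; exact: smooth_continuous.
Qed.

Lemma int_ftc f (c d : R) : c < d -> smooth f ->
  int (fun x => \1_(`[c, d]%classic) x * derive1 f x) = f d - f c.
Proof.
move=> cd sf; rewrite -Rintegral_setT /Rintegral (@continuous_FTC2 _ (derive1 f) f)//.
- by apply: continuous_subspaceT; exact: (smooth_continuous (smooth_derive1 sf)).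
- split; first by move=> x _; exact: smooth_derivable.
  + by apply: cvg_at_right_filter; exact: smooth_continuous.
  + by apply: cvg_at_left_filter; exact: smooth_continuous.
Qed.

Lemma rtest_meanzero a f : 0 < a -> rtest a f -> meanzero a (derive1 f).
Proof.
move=> a0 fT; have f'T := rtest_derive1 fT; have f'a := rtest_suppin f'T.
split; [exact: rtest_L2r f'T|exact: f'a|].
have fa := rtest_suppin fT.
rewrite -(indic_suppin f'a) int_ftc; [|by lra|by case: fT].
by rewrite !fa ?subrr// ?normrN gtr0_norm// ltxx.
Qed.

Lemma prim_derive1 a f : 0 < a -> rtest a f -> prim (derive1 f) = f.
Proof.
move=> a0 fT; have [sf _] := fT; have fa := rtest_suppin fT.
have f'T := rtest_derive1 fT; have f'a := rtest_suppin f'T.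
have f'i := meanzero_intg (rtest_meanzero a0 fT); have mf' := intg_mes f'i.
apply/funext => x; have [xa|ax] := leP x (- a).
  rewrite fa; last by rewrite -leNgt ler_normr; apply/orP; right; lra.
  rewrite -[RHS](@int0 R); apply: eq_int => y; have [yx|_] := ltP y x; last by rewrite mul0r.
  by rewrite f'a ?mulr0// -leNgt ler_normr; apply/orP; right; lra.
rewrite -[RHS]subr0 -[X in _ - X](fa (- a)); last by rewrite normrN gtr0_norm// ltxx.
rewrite -int_ftc// /prim; apply: (@int_off _ x).
- by apply: measurable_funM => //; exact: mes_lt.
- by apply: mes_indicM.
- move=> y yx; rewrite indicE; have [yx'|xy] := ltP y x.
    have [ay|ya] := leP (- a) y; first by rewrite mem_set//= in_itv/= ay ltW.
    rewrite memNset/= ?in_itv/=; last by rewrite leNgt ya.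
    by rewrite mul0r f'a ?mulr0// -leNgt ler_normr; apply/orP; right; lra.
  rewrite memNset/= ?mul0r// in_itv/= => /andP[_ yx'']; move/eqP: yx; apply.
  by apply/eqP; rewrite eq_le xy yx''.
Qed.

(** Fubini on the region y < x; the tail of f' beyond y is -f(y). The open and the closed tail
    differ at one point. *)
Lemma int_prim_parts a w f : 0 < a -> meanzero a w -> rtest a f ->
  int (fun x => prim w x * derive1 f x) = - int (fun x => w x * f x).
Proof.
move=> a0 wZ fT; have wi := meanzero_intg wZ.
have f'Z := rtest_meanzero a0 fT; have f'i := meanzero_intg f'Z.
have mw := intg_mes wi; have mf' := intg_mes f'i.
have F2 : intg2 (fun z : R * R => (z.2 < z.1)%R%:R * (w z.2 * derive1 f z.1)).
  apply: intg2_dom (intg2_prod (intg_norm f'i) (intg_norm wi)).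
    by apply: measurable_funM; [exact: mes_lt2|apply: measurable_funM; [exact: mes_comp_snd|exact: mes_comp_fst]].
  by move=> z; apply: le_trans (bool_norm_le _ _) _; rewrite normrM mulrC.
have [_ _ h] := fubini F2.
transitivity (int (fun x => int (fun y => (y < x)%R%:R * (w y * derive1 f x)))).
  apply: eq_int => x; rewrite mulrC /prim -intZ; last exact: intg_prim.
  by apply: eq_int => y; ring.
rewrite h -intN; last by apply: intg_ip; [case: wZ|exact: rtest_L2r fT].
apply: eq_int => y /=; rewrite -mulrN.
transitivity (w y * int (fun x => (y < x)%R%:R * derive1 f x)).
  rewrite -intZ; first by apply: eq_int => x; ring.
  by apply: (@intg_boolM _ (fun x => y < x) _ _ f'i); exact: mes_gt.
congr (_ * _); rewrite -[f y in RHS](congr1 (@^~ y) (prim_derive1 a0 fT)).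
have [_ _ f'0] := f'Z; have := int_ge_prim y f'i; rewrite f'0 sub0r => <-.
apply: (@int_off _ y).
- exact: measurable_funM (mes_gt y) mf'.
- exact: measurable_funM (mes_ge y) mf'.
- by move=> x xy; rewrite le_eqVlt eq_sym (negbTE xy).
Qed.

Lemma intg_supp_int_le a w : 0 < a -> L2r w -> suppin a w -> int w ^+ 2 <= 2 * a * nr w.
Proof.
move=> a0 wL wa; have aa : - a <= a by lra.
have := int_itv_sqr_le aa wL; rewrite (indic_suppin wa) opprK.
by congr (_ <= _ * _); ring.
Qed.

Lemma primB w w' x : intg w -> intg w' ->
  prim (fun y => w y - w' y) x = prim w x - prim w' x.
Proof.
move=> wi w'i; rewrite /prim -intB; try exact: intg_prim.
by apply: eq_int => y; rewrite mulrBr.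
Qed.

Lemma meanzeroB a w w' : meanzero a w -> meanzero a w' -> meanzero a (fun y => w y - w' y).
Proof.
move=> wZ w'Z; have wi := meanzero_intg wZ; have w'i := meanzero_intg w'Z.
case: wZ w'Z => wL wa w0 [w'L w'a w'0]; split; first exact: L2rB.
  by move=> x xa; rewrite wa ?w'a ?subrr.
by rewrite intB// w0 w'0 subrr.
Qed.

(** A Poincare inequality, from the pointwise bound [prim_bounded] on an interval of length 2a. *)
Lemma nr_prim_le a w : 0 < a -> meanzero a w -> nr (prim w) <= (2 * a) ^+ 2 * nr w.
Proof.
move=> a0 wZ; have [_ wa w0] := wZ; have VL := prim_L2r a0 wZ.
have Va := prim_supp (meanzero_intg wZ) wa w0.
apply: le_trans (_ : int (fun x => 2 * a * nr w * \1_(`[- a, a]%classic) x) <= _); last first.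
  rewrite intZ; last exact: intg_itv.
  rewrite int_indic_itv; last by lra.
  by rewrite le_eqVlt; apply/orP; left; apply/eqP; move: (nr w) => A; ring.
apply: int_le; [by case: VL|exact/intgZ/intg_itv|move=> x].
rewrite -[in leLHS](indic_suppin Va) indicE; case: (_ \in _).
  by rewrite mulr1 mul1r prim_bounded.
by rewrite mul0r mulr0 expr0n.
Qed.

(** The mean is continuous in L^2 on a bounded interval, so r inherits mean zero. The Poincare
    inequality for phi' - r then shows that phi also converges to the primitive of r. *)
Lemma test_closure a (phi : nat -> R -> R) p r : 0 < a ->
  (forall n, rtest a (phi n)) -> L2r p -> L2r r -> suppin a r ->
  nr (fun x => phi n x - p x) @[n --> \oo] --> 0 ->
  nr (fun x => derive1 (phi n) x - r x) @[n --> \oo] --> 0 ->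
  meanzero a r /\ nr (fun x => p x - prim r x) = 0.
Proof.
move=> a0 phiT pL rL ra phip phir.
have phiL n := rtest_L2r (phiT n).
have phi'Z n := rtest_meanzero a0 (phiT n).
have ri := L2r_intg rL ra.
have rZ : meanzero a r.
  split => //; apply/eqP; rewrite -sqrf_eq0 eq_le sqr_ge0 andbT.
  apply: (@cvg0_le (fun n => 2 * a * nr (fun x => derive1 (phi n) x - r x))) => [n|].
    have [fL fa f0] := phi'Z n.
    have da : suppin a (fun x => derive1 (phi n) x - r x) by move=> x xa; rewrite fa ?ra ?subrr.
    apply: le_trans (intg_supp_int_le a0 (L2rB fL rL) da).
    by rewrite intB ?f0 ?sub0r ?sqrrN//; exact: meanzero_intg (phi'Z n).
  by rewrite -(mulr0 (2 * a)); apply: cvgM => //; exact: cvg_cst.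
split => //; have VL := prim_L2r a0 rZ.
have h n : nr (fun x => p x - prim r x) <=
    2 * nr (fun x => phi n x - p x) + 2 * ((2 * a) ^+ 2 * nr (fun x => derive1 (phi n) x - r x)).
  apply: le_trans (nr_tri pL (phiL n) VL) _; rewrite nr_subC lerD2l ler_wpM2l//.
  apply: le_trans (nr_prim_le a0 (meanzeroB (phi'Z n) rZ)).
  rewrite le_eqVlt; apply/orP; left; apply/eqP; apply: eq_int => x.
  rewrite primB//; last exact: meanzero_intg (phi'Z n).
  by rewrite (prim_derive1 a0 (phiT n)).
apply/eqP; rewrite eq_le nr_ge0 andbT.
have lim0 : 2 * nr (fun x => phi n x - p x) + 2 * ((2 * a) ^+ 2 * nr (fun x => derive1 (phi n) x - r x)) @[n --> \oo] --> (0 : R).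
  rewrite [X in _ --> X](_ : 0 = 2 * 0 + 2 * ((2 * a) ^+ 2 * 0)); last by ring.
  by apply: cvgD; apply: cvgM => //; try exact: cvg_cst; apply: cvgM => //; exact: cvg_cst.
exact: (cvg0_le h lim0).
Qed.

(** The pairings of u with its own approximating test functions vanish and converge to [nr u]. *)
Lemma test_dense0 a u : 0 < a -> L2r u -> suppin a u ->
  (forall phi, rtest a phi -> ip u phi = 0) -> nr u = 0.
Proof.
move=> a0 uL ua h; have [phi [phiT phiL phiu _]] := approx_test a0 uL ua.
have uu : nr (fun x => u x - u x) = 0.
  by rewrite -[RHS](@int0 R); apply: eq_int => x; rewrite subrr expr0n.
have := ip_cvg (fun=> uL) phiL uL uL _ phiu.
rewrite uu => /(_ (@cvg_cst _ _ _ _ _)) c.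
rewrite nr_ip; apply: (cvg_unique _ c) => //.
by rewrite (_ : (fun n => _) = (fun=> 0)); [exact: cvg_cst|apply/funext => n; rewrite h].
Qed.

End TestFunctionCalculus.

(** * The Weil form on real functions *)

Section QForm.
Context {R : realType}.
Context (a : R) (a0 : 0 < a).
Implicit Types u v w f g : R -> R.

Lemma intg_rr_supp v w : L2r v -> suppin a v -> L2r w -> suppin a w ->
  intg (rr v w) /\ suppin (2 * a) (rr v w).
Proof.
move=> vL va wL wa; split; first by apply: intg_rr; [exact: L2r_intg va|exact: L2r_intg wa].
by move=> t; rewrite -leNgt => ta; exact: (rr_supp va wa).
Qed.

Lemma Kf_lin N (L c : R) f g : intg f -> suppin L f -> intg g -> suppin L g ->
  Kf N (fun x => f x + c * g x) = Kf N f + c * Kf N g.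
Proof.
move=> fi fL gi gL; rewrite /Kf.
have -> : int (fun x => (f x + c * g x) * cosh2 x) =
    int (fun x => f x * cosh2 x) + c * int (fun x => g x * cosh2 x).
  have i1 := intg_cosh2 fi fL; have i2 := intg_cosh2 gi gL.
  rewrite -intZ// -intD//; last exact: intgZ.
  by apply: eq_int => x; ring.
pose S1 := \sum_(1 <= n < N.+1) von_mangoldt n / Num.sqrt n%:R * (f (ln n%:R) + f (- ln n%:R)).
pose S2 := \sum_(1 <= n < N.+1) von_mangoldt n / Num.sqrt n%:R * (g (ln n%:R) + g (- ln n%:R)).
have -> : \sum_(1 <= n < N.+1) von_mangoldt n / Num.sqrt n%:R *
    (f (ln n%:R) + c * g (ln n%:R) + (f (- ln n%:R) + c * g (- ln n%:R))) = S1 + c * S2.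
  rewrite /S1 /S2 mulr_sumr -big_split/=; apply: eq_bigr => n _.
  by move: (_ / _) (f _) (g _) (f (- _)) (g (- _)) => p q r s t; ring.
by rewrite -/S1 -/S2; move: S1 S2 (int _) (int _) (digamma _) (ln pi) => p q r s t z; ring.
Qed.

Lemma KfN N (L : R) f : intg f -> suppin L f -> Kf N (fun x => f (- x)) = Kf N f.
Proof.
move=> fi fL; rewrite /Kf oppr0; congr (_ - _ + _); last first.
  by apply: eq_bigr => n _; rewrite opprK [f _ + _]addrC.
by rewrite -(int_refl 0 (intg_cosh2 fi fL)); apply: eq_int => x; rewrite sub0r cosh2N.
Qed.

(** A bound for [Kf] on functions bounded by 1: 4a is the length of [-2a, 2a], on which [cosh2] is
    at most 2 e^(2a), and each n contributes two values of f. *)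
Definition Kbound (N : nat) : R := 4 * a * (2 * expR (2 * a)) +
  \sum_(1 <= n < N.+1) `|von_mangoldt n / Num.sqrt n%:R| * 2 + `|digamma (1 / 4) - ln pi|.

Lemma Kbound_ge0 N : 0 <= Kbound N.
Proof.
rewrite addr_ge0// addr_ge0//; last by apply: sumr_ge0 => n _; rewrite mulr_ge0.
by rewrite mulr_ge0// ?mulr_ge0 ?expR_ge0// ltW.
Qed.

Lemma Kf_le N f (B : R) : intg f -> suppin (2 * a) f -> (forall x, `|f x| <= B) ->
  `|Kf N f| <= Kbound N * B.
Proof.
move=> fi fL fB; rewrite /Kf /Kbound [leRHS]mulrDl [X in _ <= X + _]mulrDl.
apply: le_trans (ler_normD _ _) (lerD _ _); last by rewrite normrM ler_wpM2l.
apply: le_trans (ler_normB _ _) (lerD _ _).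
  have i := intg_cosh2 fi fL.
  apply: le_trans (int_norm i) _.
  apply: le_trans (_ : int (fun x => 2 * expR (2 * a) * B * \1_(`[- (2 * a), 2 * a]%classic) x) <= _).
    apply: int_le; [exact: intg_norm|exact/intgZ/intg_itv|move=> x].
    rewrite -[in leLHS](indic_suppin fL) indicE.
    have [/set_mem/=|_] := boolP (x \in _); last by rewrite !mul0r normr0 mulr0.
    rewrite in_itv/= -ler_norml => xL; rewrite mul1r mulr1 normrM mulrC.
    by apply: ler_pM => //; rewrite ger0_norm ?cosh2_ge0//; exact: cosh2_le.
  rewrite intZ; last exact: intg_itv.
  rewrite int_indic_itv; last by move: a0 => ha; lra.
  by rewrite le_eqVlt; apply/orP; left; apply/eqP; move: (expR _) => A; ring.
apply: le_trans (ler_norm_sum _ _ _) _; rewrite mulr_suml; apply: ler_sum => n _.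
rewrite normrM -mulrA ler_wpM2l// mulr_natl mulr2n.
by apply: le_trans (ler_normD _ _) (lerD _ _).
Qed.

Definition KK N v w : R := Kf N (rr v w).

Lemma KK_le N v w : L2r v -> suppin a v -> L2r w -> suppin a w ->
  `|KK N v w| <= Kbound N * (Num.sqrt (nr v) * Num.sqrt (nr w)).
Proof.
move=> vL va wL wa; have [i s] := intg_rr_supp vL va wL wa.
by apply: Kf_le => // x; exact: rr_le.
Qed.

Lemma KKC N v w : L2r v -> suppin a v -> L2r w -> suppin a w -> KK N v w = KK N w v.
Proof.
move=> vL va wL wa; have [i s] := intg_rr_supp vL va wL wa.
rewrite /KK -(KfN N i s); congr Kf; apply/funext => x; exact: rrC.
Qed.

Lemma KKBl N u v w : L2r u -> suppin a u -> L2r v -> suppin a v -> L2r w -> suppin a w ->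
  KK N (fun x => u x - v x) w = KK N u w - KK N v w.
Proof.
move=> uL ua vL va wL wa; have [i s] := intg_rr_supp uL ua wL wa.
have [j t] := intg_rr_supp vL va wL wa.
rewrite /KK -mulN1r -(@Kf_lin _ (2 * a))//; congr Kf; apply/funext => x.
by rewrite rrBl// mulN1r.
Qed.

Lemma suppinB u v : suppin a u -> suppin a v -> suppin a (fun x => u x - v x).
Proof. by move=> ua va x xa; rewrite ua ?va ?subrr. Qed.

Lemma KK_cvg N (u u' : nat -> R -> R) v w :
  (forall n, L2r (u n)) -> (forall n, suppin a (u n)) ->
  (forall n, L2r (u' n)) -> (forall n, suppin a (u' n)) ->
  L2r v -> suppin a v -> L2r w -> suppin a w ->
  nr (fun x => u n x - v x) @[n --> \oo] --> 0 ->
  nr (fun x => u' n x - w x) @[n --> \oo] --> 0 ->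
  KK N (u n) (u' n) @[n --> \oo] --> KK N v w.
Proof.
move=> uL ua u'L u'a vL va wL wa uv u'w; apply/subr_cvg0/norm_cvg0P.
pose e n := Kbound N * (Num.sqrt (nr (fun x => u n x - v x)) * Num.sqrt (nr (u' n))) +
  Kbound N * (Num.sqrt (nr (fun x => u' n x - w x)) * Num.sqrt (nr v)).
apply: (@squeeze_cvgr _ _ _ _ (fun=> 0) e); last 2 first.
- exact: cvg_cst.
- rewrite [X in _ --> X](_ : 0 = Kbound N * (0 * Num.sqrt (nr w)) + Kbound N * (0 * Num.sqrt (nr v))); last by ring.
  apply: cvgD; apply: cvgM; try exact: cvg_cst; apply: cvgM; try exact: sqrt_cvg0; last exact: cvg_cst.
  apply: (@continuous_cvg _ _ _ _ _ _ Num.sqrt); first exact: sqrt_continuous.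
  exact: nr_cvg.
apply: nearW => n; rewrite normr_ge0/= /e.
have uvL := L2rB (uL n) vL; have u'wL := L2rB (u'L n) wL.
have uva := suppinB (ua n) va; have u'wa := suppinB (u'a n) wa.
have -> : KK N (u n) (u' n) - KK N v w =
    KK N (fun x => u n x - v x) (u' n) + KK N (fun x => u' n x - w x) v.
  by rewrite !KKBl// (KKC _ (u'L n))// (KKC _ wL)//; move: (KK _ _ _) (KK _ _ _) (KK _ _ _) => p q r; ring.
by apply: le_trans (ler_normD _ _) (lerD _ _); exact: KK_le.
Qed.

Lemma qformC N v w : L2r v -> suppin a v -> L2r w -> suppin a w -> qform N v w = qform N w v.
Proof. by move=> vL va wL wa; rewrite /qform -/(KK N v w) KKC// EEC. Qed.

Lemma qform_cvg N (u u' : nat -> R -> R) v w :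
  (forall n, L2r (u n)) -> (forall n, suppin a (u n)) -> (forall n, dE (u n)) ->
  (forall n, L2r (u' n)) -> (forall n, suppin a (u' n)) -> (forall n, dE (u' n)) ->
  L2r v -> suppin a v -> dE v -> L2r w -> suppin a w -> dE w ->
  nr (fun x => u n x - v x) @[n --> \oo] --> 0 ->
  nr (fun x => u' n x - w x) @[n --> \oo] --> 0 ->
  EE (fun x => u n x - v x) (fun x => u n x - v x) @[n --> \oo] --> 0 ->
  EE (fun x => u' n x - w x) (fun x => u' n x - w x) @[n --> \oo] --> 0 ->
  qform N (u n) (u' n) @[n --> \oo] --> qform N v w.
Proof. by move=> *; apply: cvgD; [exact: KK_cvg|exact: EE_cvg]. Qed.

Definition weil_arch_real f x : R :=
  (f x + f (- x) - 2 * expR (- x / 2) * f 0) * (expR (x / 2) / (expR x - expR (- x))).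

Definition weil_finite_real f : R :=
  int (fun x => f x * cosh2 x)
  - limn (fun N : nat => \sum_(1 <= n < N) von_mangoldt n / Num.sqrt n%:R * (f (ln n%:R) + f (- ln n%:R)))
  - (ln (4 * pi) + euler_mascheroni) * f 0.

Lemma weil_finite_realE N f : expR (2 * a) <= N%:R -> suppin (2 * a) f ->
  weil_finite_real f = Kf N f - (ln (4 * pi) + euler_mascheroni + (digamma (1 / 4) - ln pi)) * f 0.
Proof.
move=> LN fL; rewrite /weil_finite_real.
have -> : limn (fun N : nat => \sum_(1 <= n < N) von_mangoldt n / Num.sqrt n%:R * (f (ln n%:R) + f (- ln n%:R))) =
   \sum_(1 <= n < N.+1) von_mangoldt n / Num.sqrt n%:R * (f (ln n%:R) + f (- ln n%:R)).
  (* For n > N one has ln n >= 2a, off the support of f, so the partial sums are eventually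
     constant. *)
  apply: cvg_lim => //; apply: cvg_near_cst; exists N.+1 => // M /= NM.
  rewrite (@big_cat_nat _ _ _ N.+1)//= [X in _ + X]big1_seq ?addr0// => n.
  rewrite mem_index_iota => /andP[_ /andP[Nn _]].
  have n0 : 0 < n%:R :> R by rewrite ltr0n (leq_trans _ Nn).
  have h : ~~ (`|ln n%:R : R| < 2 * a).
    rewrite -leNgt (le_trans _ (ler_norm _))// -ler_expR lnK ?posrE//.
    by apply: le_trans LN _; rewrite ler_nat ltnW.
  by rewrite !fL ?addr0 ?mulr0 ?normrN.
rewrite /Kf; set S := \sum_(_ <= _ < _) _.
by move: S (int _) (digamma _) (ln pi) (ln _) euler_mascheroni (f 0) => p q r s t z y; ring.
Qed.

(** Here e^(-x/2) = 1 - (1 - e^(-x/2)): the 1 completes the second difference in [NN], and the rest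
    is an integrable multiple of f(0) = [ip v w]. *)
Lemma hp_weil_arch v w x : L2r v -> L2r w ->
  hp (weil_arch_real (rr v w)) x =
  2 * ip v w * hp (fun b => kker b * (1 - expR (- (b / 2)))) x - enI v w x.
Proof.
move=> vL wL; rewrite /enI /hp; case: ifPn => _; last by rewrite mulr0 subr0.
rewrite /weil_arch_real NN_rr// rr0 (mulNr x) -/(kker x).
by move: (expR _) (kker x) (ip v w) (rr v w x) (rr v w (- x)) => p q r s t; ring.
Qed.

Definition kker_one : R := int (hp (fun b => kker b * (1 - expR (- (b / 2))))).

Lemma intg_kker_one : intg (hp (fun b : R => kker b * (1 - expR (- (b / 2))))).
Proof.
apply: (@intg_kker_le _ _ 1).
  by apply: measurable_funB => //; apply: measurableT_comp => //; apply: measurable_funN; exact: measurable_funM.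
move=> x x0; rewrite mul1r ger0_norm; last by rewrite subr_ge0 -[leRHS]expR0 ler_expR; lra.
by have := expR_ge1Dx (- (x / 2)); lra.
Qed.

Lemma weil_arch_lin c f g x :
  weil_arch_real (fun y => f y + c * g y) x = weil_arch_real f x + c * weil_arch_real g x.
Proof.
rewrite /weil_arch_real; move: (expR _) (_ / _) (f x) (g x) (f (- x)) (g (- x)) (f 0) (g 0).
move=> p q r s t z y u; ring.
Qed.

Lemma int_weil_arch v w : L2r v -> L2r w -> intg (enI v w) ->
  intg (hp (weil_arch_real (rr v w))) /\ int (hp (weil_arch_real (rr v w))) = 2 * ip v w * kker_one - EE v w.
Proof.
move=> vL wL i; have j := intgZ (2 * ip v w) intg_kker_one.
have e : hp (weil_arch_real (rr v w)) =
    fun x => 2 * ip v w * hp (fun b => kker b * (1 - expR (- (b / 2)))) x - enI v w x.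
  by apply/funext => x; exact: hp_weil_arch.
rewrite e; split; first exact: intgB.
by rewrite intB// intZ ?EE_int//; exact: intg_kker_one.
Qed.

Definition weil_real f : R := weil_finite_real f - int (hp (weil_arch_real f)).

(** The real and imaginary parts of a complex correlation are combinations of two real ones, with c
    = 1 and c = -1. The constants are reconciled by [weil_constant]. *)
Lemma weil_real_rr N c v w v' w' : expR (2 * a) <= N%:R ->
  L2r v -> suppin a v -> L2r w -> suppin a w -> L2r v' -> suppin a v' -> L2r w' -> suppin a w' ->
  dE v -> dE w -> dE v' -> dE w' ->
  weil_real (fun x => rr v w x + c * rr v' w' x) = qform N v w + c * qform N v' w'.
Proof.
move=> LN vL va wL wa v'L v'a w'L w'a vE wE v'E w'E.
have [i s] := intg_rr_supp vL va wL wa; have [i' s'] := intg_rr_supp v'L v'a w'L w'a.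
have [j e] := int_weil_arch vL wL (intg_enI vL wL vE wE).
have [j' e'] := int_weil_arch v'L w'L (intg_enI v'L w'L v'E w'E).
rewrite /weil_real (weil_finite_realE LN); last by move=> x xL; rewrite s// s'// mulr0 addr0.
rewrite (Kf_lin N c i s i' s').
have -> : int (hp (weil_arch_real (fun x => rr v w x + c * rr v' w' x))) =
    int (hp (weil_arch_real (rr v w))) + c * int (hp (weil_arch_real (rr v' w'))).
  rewrite -intZ// -intD//; last exact: intgZ.
  apply: eq_int => x; rewrite /hp; case: ifP => _; first exact: weil_arch_lin.
  by rewrite mulr0 addr0.
rewrite e e' !rr0 /qform; have := @weil_constant R; rewrite -/kker_one.
move: (ln _) euler_mascheroni kker_one (ln pi) (digamma _) (Kf _ _) (Kf _ _) (EE _ _) (EE _ _) (ip _ _) (ip _ _).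
move=> p q r s1 t p' q' r' s2 t' z h; have -> : p = s1 - t - q - 2 * r by rewrite -h; ring.
by ring.
Qed.

(** The archimedean integrand is g - e with g integrable and e >= 0 the sum of the two energy
    densities. Applied to the real and imaginary parts of one function, it identifies the form
    domain. *)
Lemma weil_ext_finite v w (A : R) : L2r v -> L2r w ->
  (`|A%:E - \int[@lebesgue_measure R]_(x in `]0%R, +oo[%classic)
     (weil_arch_real (fun x => rr v v x + rr w w x) x)%:E| < +oo)%E <-> dE v /\ dE w.
Proof.
move=> vL wL; pose e x := enI v v x + enI w w x.
pose g x := 2 * (ip v v + ip w w) * hp (fun b => kker b * (1 - expR (- (b / 2)))) x.
pose h x := g x - e x.
have me : measurable_fun setT e by apply: measurable_funD; exact: mes_enI.
have e0 x : 0 <= e x by rewrite addr_ge0 ?enI_ge0.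
have gi : intg g by apply: intgZ; exact: intg_kker_one.
have mh : measurable_fun setT h by apply: measurable_funB => //; exact: intg_mes.
have eE : intg e <-> dE v /\ dE w.
  split=> [ei|[vE wE]]; last exact: intgD.
  by split; apply: intg_dom ei; try exact: mes_enI; move=> x; rewrite ger0_norm ?enI_ge0// /e ?lerDl ?lerDr enI_ge0.
have -> : (\int[@lebesgue_measure R]_(x in `]0%R, +oo[%classic)
     (weil_arch_real (fun x => rr v v x + rr w w x) x)%:E = \int[@lebesgue_measure R]_x (h x)%:E)%E.
  rewrite integral_mkcond; apply: eq_integral => x _; rewrite /patch.
  have -> : (x \in (`]0%R, +oo[%classic : set R)) = (0 < x).
    by apply/idP/idP => [/set_mem|x0]; [|apply/mem_set]; rewrite /= in_itv/= andbT.
  have <- : hp (weil_arch_real (fun x => rr v v x + rr w w x)) x = h x.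
    rewrite /h /e /g mulrDr mulrDl opprD addrACA -!hp_weil_arch//.
    rewrite /hp; case: ifP => _; last by rewrite addr0.
    have := weil_arch_lin 1 (rr v v) (rr w w) x; rewrite mul1r => <-.
    by congr weil_arch_real; apply/funext => y; rewrite mul1r.
  by rewrite /hp; case: ifP.
rewrite -eE; split; last first.
  move=> ei; have hi : intg h by exact: intgB.
  by rewrite -int_EFin// -EFinB/= ltry.
move=> fin.
(* The positive part of h is at most |g|, so a finite value of the integral forces the negative
   part, which carries the energy, to be integrable. *)
have ni : intg (fun x => Num.max (- h x) 0).
  apply/intg_lty; first by apply: measurable_maxr => //; exact: measurable_funN.
    by move=> x; rewrite le_max lexx orbT.
  have pi' : (\int[@lebesgue_measure R]_x (Num.max (h x) 0)%:E < +oo)%E.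
    apply/intg_lty; [exact: measurable_maxr|by move=> x; rewrite le_max lexx orbT|].
    apply: intg_dom (intg_norm gi); first exact: measurable_maxr.
    move=> x; rewrite ger0_norm ?le_max ?lexx ?orbT// ge_max normr_ge0 andbT /h.
    by apply: le_trans (ler_norm (g x)); rewrite gerBl.
  move: fin; rewrite integralE.
  have -> : (\int[@lebesgue_measure R]_x ((fun x => (h x)%:E)^\+)%E x =
      \int[@lebesgue_measure R]_x (Num.max (h x) 0)%:E)%E.
    by apply: eq_integral => x _; rewrite funeposE EFin_max.
  have -> : (\int[@lebesgue_measure R]_x ((fun x => (h x)%:E)^\-)%E x =
      \int[@lebesgue_measure R]_x (Num.max (- h x) 0)%:E)%E.
    by apply: eq_integral => x _; rewrite funenegE EFin_max EFinN.
  have p0 : (0 <= \int[@lebesgue_measure R]_x (Num.max (h x) 0)%:E)%E.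
    by apply: integral_ge0 => x _; rewrite lee_fin le_max lexx orbT.
  move: pi' p0; case: (integral _ _ _) => // p _ _; case: (integral _ _ _) => [q _| |_] /=.
  - exact: ltry.
  - by [].
  - by rewrite ltNye.
apply: intg_dom (intgD (intg_norm gi) ni) => // x.
rewrite ger0_norm//; have -> : e x = g x + - h x by rewrite /h; ring.
by rewrite lerD// ?ler_norm// le_max lexx.
Qed.

End QForm.

(** * Convolution with the screw function *)

Section ScrewOperatorReal.
Context {R : realType}.
Context (a : R) (a0 : 0 < a).
Implicit Types u v w r f g : R -> R.

(* Only the values of the screw function on ]-2a, 2a[ matter, and only there is it known to be bounded. *)
Definition screw_cut t : R := (`|t| < 2 * a)%R%:R * screw t.

Lemma screw_cut_bounded : measurable_fun setT screw_cut /\ exists B, forall t, `|screw_cut t| <= B.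
Proof.
pose N := (Num.truncn (expR (2 * a))).+1.
have LN : expR (2 * a) <= N%:R by exact/ltW/truncnS_gt.
pose F1 (z : R * R) := \1_(`[0, 2 * a]%classic) z.2 * (cosh2 z.2 * TT z.2 z.1).
pose g1 b := 2 * expR (2 * a) * (2 * a) * \1_(`[0, 2 * a]%classic) b.
pose F2 (z : R * R) := hp kker z.2 * Num.min z.2 `|z.1|.
pose g2 : R -> R := hp (fun b => kker b * b).
have mF1 : measurable_fun setT F1.
  apply: measurable_funM; first exact: mes_comp_snd (intg_mes (intg_itv 0 (2 * a) true false)).
  by apply: measurable_funM; [exact: mes_comp_snd mes_cosh2|exact: mes_TT2].
have mF2 : measurable_fun setT F2.
  apply: measurable_funM; first exact: mes_comp_snd mes_kker.
  apply: measurable_minr; first exact: measurable_snd.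
  by apply: (measurableT_comp (@normr_measurable _ setT)); exact: measurable_fst.
have gi1 : intg g1 by exact/intgZ/intg_itv.
have gi2 : intg g2 by exact: intg_kker_mul.
have Fg1 t b : `|t| < 2 * a -> `|F1 (t, b)| <= g1 b.
  move=> tL; rewrite /F1 /g1 /= indicE.
  have [/set_mem/=|_] := boolP (b \in _); last by rewrite mul0r normr0 mulr0.
  rewrite in_itv/= => /andP[b0 bL]; rewrite mul1r mulr1.
  have /andP[t0 t1] := TT_bound b0 tL.
  rewrite ger0_norm; last by rewrite mulr_ge0// cosh2_ge0.
  apply: ler_pM => //; first exact: cosh2_ge0.
  by apply: cosh2_le; rewrite ger0_norm.
have Fg2 t b : `|F2 (t, b)| <= g2 b.
  rewrite /F2 /g2 /= /hp; case: ifPn => b0; last by rewrite mul0r normr0.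
  rewrite ger0_norm; last by apply: mulr_ge0; [exact/ltW/kker_gt0|rewrite le_min (ltW b0) normr_ge0].
  by rewrite ler_wpM2l ?ge_min ?lexx// ltW// kker_gt0.
pose P (t : R) := \sum_(1 <= n < N.+1) von_mangoldt n / Num.sqrt n%:R * TT (ln n%:R) t.
pose c := (digamma (1 / 4) - ln pi) / 2 : R.
pose G t := - int (fun b => F1 (t, b)) + P t - c * `|t| - int (fun b => F2 (t, b)).
have sE : screw_cut = fun t => (`|t| < 2 * a)%R%:R * G t.
  apply/funext => t; rewrite /screw_cut; have [tL|_] := boolP (`|t| < 2 * a); last by rewrite !mul0r.
  congr (_ * _); rewrite (screwE (ltW tL) LN) /G; congr (_ + _ - _ - _).
  by apply: eq_int => b; rewrite hpM.
rewrite sE; split.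
  apply: measurable_funM.
    exact: (measurableT_comp (mes_lt (2 * a)) (@normr_measurable _ setT)).
  apply: measurable_funB; last exact: mes_int mF2.
  apply: measurable_funB; last by apply: measurable_funM => //; exact: normr_measurable.
  apply: measurable_funD; first by apply: measurable_funN; exact: mes_int mF1.
  apply: measurable_sum => n; apply: measurable_funM => //.
  exact: (mes_snd mes_TT2 (ln n%:R)).
exists (int g1 + \sum_(1 <= n < N.+1) `|von_mangoldt n / Num.sqrt n%:R| * (2 * a) + `|c| * (2 * a) + int g2).
move=> t; have [tL|_] := boolP (`|t| < 2 * a); last first.
  rewrite mul0r normr0; have aa : 0 <= 2 * a by rewrite mulr_ge0// ltW.
  rewrite !addr_ge0//.
  - by apply: int_ge0 => b; apply: le_trans (Fg1 0 b _); rewrite ?normr0 ?mulr_gt0.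
  - by apply: sumr_ge0 => n _; rewrite mulr_ge0.
  - by rewrite mulr_ge0.
  - by apply: int_ge0 => b; apply: le_trans (Fg2 0 b).
have int_bd (F : R * R -> R) g : measurable_fun setT F -> intg g -> (forall b, `|F (t, b)| <= g b) ->
    `|int (fun b => F (t, b))| <= int g.
  move=> mF gi Fg; have Fi : intg (fun b => F (t, b)).
    by apply: intg_dom gi => //; exact: mes_fst.
  by apply: le_trans (int_norm Fi) _; apply: int_le => //; exact: intg_norm.
rewrite mul1r /G; apply: le_trans (ler_normB _ _) (lerD _ _); last by apply: int_bd.
apply: le_trans (ler_normB _ _) (lerD _ _); last by rewrite normrM ler_wpM2l// normr_id ltW.
apply: le_trans (ler_normD _ _) (lerD _ _).
  by rewrite normrN; apply: int_bd => // b; exact: Fg1.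
apply: le_trans (ler_norm_sum _ _ _) _; apply: ler_sum => n _.
rewrite normrM ler_wpM2l//; have /andP[t0 t1] := TT_bound (ln_nat_ge0 n) tL.
by rewrite ger0_norm.
Qed.

Definition screw_conv r x : R := int (fun y => screw_cut (x - y) * r y).

Lemma intg_screw_conv r x : intg r -> intg (fun y => screw_cut (x - y) * r y).
Proof.
move=> ri; have [ms [B sB]] := screw_cut_bounded.
apply: intg_dom (intgZ B (intg_norm ri)).
  apply: measurable_funM; last exact: intg_mes.
  by apply: (measurableT_comp ms); exact: measurable_funB.
by move=> y; rewrite normrM ler_wpM2r.
Qed.

Lemma screw_convE r x : suppin a r -> `|x| < a ->
  (fun y => screw (x - y) * r y) = (fun y => screw_cut (x - y) * r y).
Proof.
move=> ra xa; apply/funext => y; have [ya|ya] := boolP (`|y| < a); last by rewrite ra// !mulr0.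
rewrite /screw_cut (_ : `|x - y| < 2 * a) ?mul1r//.
by apply: le_lt_trans (ler_normB _ _) _; rewrite mulr_natl mulr2n ltrD.
Qed.

Lemma mes_screw_conv r : intg r -> measurable_fun setT (screw_conv r).
Proof.
move=> ri; have [ms _] := screw_cut_bounded.
apply: (@mes_int _ (fun z : R * R => screw_cut (z.1 - z.2) * r z.2)).
apply: measurable_funM; last by apply: mes_comp_snd; exact: intg_mes.
by apply: (measurableT_comp ms); apply: measurable_funB; [exact: measurable_fst|exact: measurable_snd].
Qed.

Lemma screw_conv_bounded r : intg r -> exists B, forall x, `|screw_conv r x| <= B.
Proof.
move=> ri; have [ms [B sB]] := screw_cut_bounded.
exists (B * int (fun y => `|r y|)) => x.
have i := intg_screw_conv x ri; apply: le_trans (int_norm i) _.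
rewrite -intZ; last exact: intg_norm.
apply: int_le; [exact: intg_norm|by apply: intgZ; exact: intg_norm|].
by move=> y; rewrite normrM ler_wpM2r.
Qed.

(** In weak form: the derivative of G r on the interval is minus the operator [weilop] at the
    primitive of r. Fubini turns the left side into the screw function paired with the correlation
    of f' and r, and f is the primitive of f', so [int_screw_rr] applies. *)
Lemma int_screw_conv N r f : expR (2 * a) <= N%:R -> meanzero a r -> rtest a f ->
  int (fun x => screw_conv r x * derive1 f x) =
  ip (fun x => (`|x| < a)%R%:R * weilop a N (prim r) x) f.
Proof.
move=> LN rZ fT; have f'Z := rtest_meanzero a0 fT.
have ri := meanzero_intg rZ; have f'i := meanzero_intg f'Z.
have [rL ra r0] := rZ; have [f'L f'a _] := f'Z.
have [_ ->] := weilop_ip a0 N rZ (rtest_L2r fT) (rtest_suppin fT).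
rewrite -[f in qform _ _ f](prim_derive1 a0 fT) -(int_screw_rr a0 LN rZ f'Z).
have [ms [B sB]] := screw_cut_bounded.
transitivity (int (fun x => int (fun t => screw_cut t * (derive1 f x * r (x - t))))).
  apply: eq_int => x; rewrite /screw_conv -(int_refl x (intg_screw_conv x ri)) mulrC -intZ.
    by apply: eq_int => t; rewrite subKr; ring.
  exact: intg_refl (intg_screw_conv x ri).
have F2 : intg2 (fun z : R * R => screw_cut z.2 * (derive1 f z.1 * r (z.1 - z.2))).
  apply: intg2_dom (intg2_corr (intgZ B (intg_norm f'i)) (intg_norm ri)).
  - apply: measurable_funM; first exact: mes_comp_snd.
    exact: intg2_mes (intg2_corr f'i ri).
  - move=> z; rewrite normrM (normrM (derive1 f z.1)) -[leRHS]mulrA.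
    by apply: ler_pM.

have [_ _ ->] := fubini F2.
apply: eq_int => t /=; have [tL|tL] := boolP (`|t| < 2 * a); last first.
  rewrite (rr_supp f'a ra) ?leNgt// mulr0 -[RHS](@int0 R); apply: eq_int => x.
  by rewrite /screw_cut (negbTE tL) !mul0r.
rewrite /screw_cut tL mul1r intZ//.
by apply: intg_ip => //; exact: L2r_shift.
Qed.

End ScrewOperatorReal.

(** * Complex functions and the operator B *)

Section LocalizedL2.
Context {R : realType}.
Context (a : R).
Implicit Types u v w f g : R -> R.

Definition cut v x : R := (`|x| < a)%R%:R * v x.

Lemma mes_cut v : measurable_fun setT v -> measurable_fun setT (cut v).
Proof.
move=> mv; apply: measurable_funM => //.
exact: (measurableT_comp (mes_lt a) (@normr_measurable _ setT)).
Qed.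

Lemma suppin_cut v : suppin a (cut v).
Proof. by move=> x /negbTE xa; rewrite /cut xa mul0r. Qed.

Lemma cut_id v : suppin a v -> cut v = v.
Proof.
move=> va; apply/funext => x; rewrite /cut.
by have [_|xa] := boolP (`|x| < a); rewrite ?mul1r// va// mulr0.
Qed.

Lemma L2r_cut v : L2r v -> L2r (cut v).
Proof.
move=> vL; apply: (L2r_dom _ _ vL); first by apply: mes_cut; case: vL.
by move=> x; exact: bool_norm_le.
Qed.

Lemma cutB v w : cut (fun x => v x - w x) = fun x => cut v x - cut w x.
Proof. by apply/funext => x; rewrite /cut mulrBr. Qed.

Lemma nr_cut_le v : L2r v -> nr (cut v) <= nr v.
Proof.
move=> vL; have [_ i] := L2r_cut vL; apply: int_le => //; first by case: vL.
by move=> x; rewrite /cut; case: (_ < _); rewrite ?mul1r// mul0r expr0n/= sqr_ge0.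
Qed.

Lemma ip_cut v f : suppin a f -> ip (cut v) f = ip v f.
Proof.
move=> fa; apply: eq_int => x; rewrite /cut.
by have [_|xa] := boolP (`|x| < a); rewrite ?mul1r// fa// !mulr0.
Qed.

(* Real functions of L^2(-a,a): they vanish almost everywhere, not everywhere, outside ]-a, a[. *)
Record L2a v : Prop := { L2a_L2r : L2r v; L2a_ae : nr (fun x => v x - cut v x) = 0 }.

Lemma L2a_supp v : L2r v -> suppin a v -> L2a v.
Proof.
move=> vL va; split=> //; rewrite cut_id// -[RHS](@int0 R); apply: eq_int => x.
by rewrite subrr expr0n.
Qed.

Lemma nr0_trans u v w : L2r u -> L2r v -> L2r w ->
  nr (fun x => u x - v x) = 0 -> nr (fun x => v x - w x) = 0 -> nr (fun x => u x - w x) = 0.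
Proof.
move=> uL vL wL uv vw; apply/eqP; rewrite eq_le nr_ge0 andbT.
by apply: le_trans (nr_tri uL vL wL) _; rewrite uv vw mulr0 addr0.
Qed.

Lemma nr0D u u' v v' : L2r u -> L2r u' -> L2r v -> L2r v' ->
  nr (fun x => u x - u' x) = 0 -> nr (fun x => v x - v' x) = 0 ->
  nr (fun x => (u x - v x) - (u' x - v' x)) = 0.
Proof.
move=> uL u'L vL v'L uu vv; apply/eqP; rewrite eq_le nr_ge0 andbT.
have := nrB_le (L2rB uL u'L) (L2rB vL v'L); rewrite uu vv mulr0 addr0.
by congr (_ <= _); apply: eq_int => x; ring.
Qed.

Lemma L2aB v w : L2a v -> L2a w -> L2a (fun x => v x - w x).
Proof.
move=> [vL v0] [wL w0]; split; first exact: L2rB.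
rewrite cutB; apply: nr0D => //; exact: L2r_cut.
Qed.

(** A correlation depends only on the classes of its arguments, and at every point, by
    Cauchy-Schwarz. The same then holds for energies and forms. *)
Lemma rr_nr0 v v' w w' : L2r v -> L2r v' -> L2r w -> L2r w' ->
  nr (fun x => v x - v' x) = 0 -> nr (fun x => w x - w' x) = 0 -> rr v w = rr v' w'.
Proof.
move=> vL v'L wL w'L vv ww; apply/funext => x.
transitivity (rr v' w x); apply/eqP; rewrite -subr_eq0 -normr_le0.
  rewrite -rrBl//; apply: le_trans (rr_le x (L2rB vL v'L) wL) _.
  by rewrite vv sqrtr0 mul0r.
rewrite -rrBr//; apply: le_trans (rr_le x v'L (L2rB wL w'L)) _.
by rewrite ww sqrtr0 mulr0.
Qed.

Lemma enI_nr0 v v' w w' : L2r v -> L2r v' -> L2r w -> L2r w' ->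
  nr (fun x => v x - v' x) = 0 -> nr (fun x => w x - w' x) = 0 -> enI v w = enI v' w'.
Proof.
move=> vL v'L wL w'L vv ww; rewrite /enI; congr hp; apply/funext => x.
by rewrite !NN_rr// -!rr0 (rr_nr0 vL v'L wL w'L vv ww).
Qed.

Lemma dE_nr0 v v' : L2r v -> L2r v' -> nr (fun x => v x - v' x) = 0 -> dE v -> dE v'.
Proof. by move=> vL v'L vv; rewrite /dE (enI_nr0 vL v'L vL v'L vv vv). Qed.

Lemma qform_nr0 N v v' w w' : L2r v -> L2r v' -> L2r w -> L2r w' ->
  nr (fun x => v x - v' x) = 0 -> nr (fun x => w x - w' x) = 0 ->
  qform N v w = qform N v' w'.
Proof.
move=> vL v'L wL w'L vv ww.
by rewrite /qform !EE_int (enI_nr0 vL v'L wL w'L vv ww) (rr_nr0 vL v'L wL w'L vv ww).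
Qed.

Lemma qform_cut N v w : L2a v -> L2a w -> qform N v w = qform N (cut v) (cut w).
Proof. by move=> [vL v0] [wL w0]; apply: qform_nr0 => //; exact: L2r_cut. Qed.

Lemma dE_cut v : L2a v -> dE v <-> dE (cut v).
Proof.
move=> [vL v0]; have cL := L2r_cut vL.
by split; apply: dE_nr0 => //; rewrite nr_subC.
Qed.

Lemma nr_cut_cvg (u : nat -> R -> R) v : (forall n, L2r (u n)) -> L2r v ->
  nr (fun x => u n x - v x) @[n --> \oo] --> 0 ->
  nr (fun x => cut (u n) x - cut v x) @[n --> \oo] --> 0.
Proof.
move=> uL vL uv; apply: (@squeeze_cvgr _ _ _ _ (fun=> 0) (fun n => nr (fun x => u n x - v x))) => //.
  by apply: nearW => n; rewrite nr_ge0/= -cutB nr_cut_le//; exact: L2rB.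
exact: cvg_cst.
Qed.

End LocalizedL2.

(** * Reduction of the complex form to real and imaginary parts *)

Section ComplexL2.
Context {R : realType}.
Local Notation C := R[i].
Local Notation mu := (@lebesgue_measure R).
Implicit Types v w : R -> C.

Definition re v x : R := complex.Re (v x).
Definition im v x : R := complex.Im (v x).

Lemma ReB (z z' : C) : complex.Re (z - z') = complex.Re z - complex.Re z'.
Proof. by case: z z' => [? ?] []. Qed.

Lemma ImB (z z' : C) : complex.Im (z - z') = complex.Im z - complex.Im z'.
Proof. by case: z z' => [? ?] []. Qed.

Lemma sqmod_finite v : cmeasurable v ->
  (normsq v < +oo)%E <-> L2r (re v) /\ L2r (im v).
Proof.
move=> [mr mi].
have ms : measurable_fun setT (fun x => sqmod (v x)).
  by apply: measurable_funD; exact: measurable_funX.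
rewrite /normsq (intg_lty ms); last by move=> x; rewrite addr_ge0// sqr_ge0.
split=> [i|[[_ ri] [_ ii]]]; last exact: intgD.
split; split=> //; apply: intg_dom i; try exact: measurable_funX.
  by move=> x; rewrite ger0_norm ?sqr_ge0// lerDl sqr_ge0.
by move=> x; rewrite ger0_norm ?sqr_ge0// lerDr sqr_ge0.
Qed.

Lemma L2P a v : L2 a v <-> L2a a (re v) /\ L2a a (im v).
Proof.
split.
  move=> [mv fv v0]; have /(sqmod_finite mv)[rL iL] := fv.
  split; split=> //; apply/nr_eq0; try (by apply: L2rB => //; exact: L2r_cut);
    apply: (@filterS _ _ (ae_filter_ringOfSetsType mu)) v0 => x h; rewrite /cut; have [xa|xa] := boolP (`|x| < a); rewrite ?mul1r ?subrr//;
    by rewrite mul0r subr0 /re /im h//= in_itv/= -ltr_norml; exact/negP.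
move=> [[rL r0] [iL i0]]; have mv : cmeasurable v by split; [case: rL|case: iL].
split=> //; first exact/(sqmod_finite mv).
have cr := L2rB rL (L2r_cut a rL); have ci := L2rB iL (L2r_cut a iL).
have := (nr_eq0 cr).1 r0; have := (nr_eq0 ci).1 i0; apply: (@filterS2 _ _ (ae_filter_ringOfSetsType mu)) => x hi hr /= h.
have xa : `|x| < a = false by apply/negP => xa; apply: h; rewrite in_itv/= -ltr_norml.
move: hr hi; rewrite /cut xa !mul0r !subr0 /re /im; case: (v x) => p q /= -> ->; exact: erefl.
Qed.

Lemma normsqE v : L2r (re v) -> L2r (im v) -> normsq v = (nr (re v) + nr (im v))%:E.
Proof.
move=> [mr ri] [mi ii]; rewrite /normsq -intD// int_EFin//; exact: intgD.
Qed.

Lemma cvgL2P (u : nat -> R -> C) v : (forall n, L2r (re (u n))) -> (forall n, L2r (im (u n))) ->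
  L2r (re v) -> L2r (im v) ->
  cvgL2 u v <-> nr (fun x => re (u n) x - re v x) @[n --> \oo] --> 0 /\
                nr (fun x => im (u n) x - im v x) @[n --> \oo] --> 0.
Proof.
move=> rL iL vrL viL.
have e n : normsq (fun x => u n x - v x) =
    (nr (fun x => re (u n) x - re v x) + nr (fun x => im (u n) x - im v x))%:E.
  have er : re (fun x => u n x - v x) = fun x => re (u n) x - re v x.
    by apply/funext => x; exact: ReB.
  have ei : im (fun x => u n x - v x) = fun x => im (u n) x - im v x.
    by apply/funext => x; exact: ImB.
  by rewrite normsqE ?er ?ei//; exact: L2rB.
rewrite /cvgL2; under eq_fun do rewrite e.
split=> [/fine_cvgP[_ h]|[h1 h2]]; last first.
  by apply: cvg_EFinW; rewrite -(addr0 0); exact: cvgD.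
split; (apply: squeeze_cvgr h; last exact: (@cvg_cst _ (0 : R)));
  by apply: nearW => n; rewrite nr_ge0/= ?lerDl ?lerDr nr_ge0.
Qed.

Lemma innerE v w : L2r (re v) -> L2r (im v) -> L2r (re w) -> L2r (im w) ->
  inner v w = Complex (ip (re v) (re w) + ip (im v) (im w)) (ip (im v) (re w) - ip (re v) (im w)).
Proof.
move=> vr vi wr wi; rewrite /inner /cintegral; congr Complex.
  rewrite -intD; try exact: intg_ip.
  by apply: eq_int => x; rewrite /re /im; case: (v x) => ? ?; case: (w x) => ? ? /=; rewrite mulrN opprK.
rewrite -intB; try exact: intg_ip.
apply: eq_int => x; rewrite /re /im; case: (v x) => ? ?; case: (w x) => ? ? /=.
by rewrite mulrN addrC.
Qed.

(** At each x the convolution is the inner product of v with a translate of w, so [innerE] applies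
    pointwise. *)
Lemma convolution_tilde v w : L2r (re v) -> L2r (im v) -> L2r (re w) -> L2r (im w) ->
  convolution v (tilde w) =
  fun x => Complex (rr (re v) (re w) x + rr (im v) (im w) x) (rr (im v) (re w) x - rr (re v) (im w) x).
Proof.
move=> vr vi wr wi; apply/funext => x; rewrite !rr_ip -(@innerE v (fun y => w (y - x)))//; try exact: (@L2r_shift _ (- x) (re w)); try exact: (@L2r_shift _ (- x) (im w)).
by rewrite /convolution /inner; congr cintegral; apply/funext => y; rewrite /tilde opprB.
Qed.

Lemma ReZ (z : C) (c : R) : complex.Re (z * RtoC c) = complex.Re z * c.
Proof. by case: z => p q /=; rewrite mulr0 subr0. Qed.

Lemma ImZ (z : C) (c : R) : complex.Im (z * RtoC c) = complex.Im z * c.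
Proof. by case: z => p q /=; rewrite mulr0 add0r. Qed.

Lemma ReD (z z' : C) : complex.Re (z + z') = complex.Re z + complex.Re z'.
Proof. by case: z z' => [? ?] []. Qed.

Lemma ImD (z z' : C) : complex.Im (z + z') = complex.Im z + complex.Im z'.
Proof. by case: z z' => [? ?] []. Qed.

Lemma complex_eta (z : C) : z = Complex (complex.Re z) (complex.Im z).
Proof. by case: z. Qed.

Lemma re_weil_arch (f : R -> C) x : complex.Re (weil_arch f x) = weil_arch_real (re f) x.
Proof. by rewrite /weil_arch ReZ ReB ReD (mulrC (RtoC _) (f 0)) ReZ (mulrC _ (2 * _)). Qed.

Lemma im_weil_arch (f : R -> C) x : complex.Im (weil_arch f x) = weil_arch_real (im f) x.
Proof. by rewrite /weil_arch ImZ ImB ImD (mulrC (RtoC _) (f 0)) ImZ (mulrC _ (2 * _)). Qed.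

Lemma re_weil_finite (f : R -> C) : complex.Re (weil_finite_part f) = weil_finite_real (re f).
Proof.
rewrite /weil_finite_part !ReB (mulrC (RtoC _)) ReZ /weil_finite_real (mulrC _ (re f 0)).
congr (_ - _ - _); first by apply: eq_int => x; rewrite ReZ.
rewrite /cseries/=; apply: (congr1 (fun s : R^nat => limn s)); apply/funext => N; apply: eq_bigr => n _.
by rewrite mulrC ReZ ReD mulrC.
Qed.

Lemma im_weil_finite (f : R -> C) : complex.Im (weil_finite_part f) = weil_finite_real (im f).
Proof.
rewrite /weil_finite_part !ImB (mulrC (RtoC _)) ImZ /weil_finite_real (mulrC _ (im f 0)).
congr (_ - _ - _); first by apply: eq_int => x; rewrite ImZ.
rewrite /cseries/=; apply: (congr1 (fun s : R^nat => limn s)); apply/funext => N; apply: eq_bigr => n _.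
by rewrite mulrC ImZ ImD mulrC.
Qed.

Lemma weilE (f : R -> C) : weil f = Complex (weil_real (re f)) (weil_real (im f)).
Proof.
rewrite /weil [LHS]complex_eta ReB ImB re_weil_finite im_weil_finite; congr (Complex (_ - _) (_ - _)).
  by rewrite /= Rintegral_hp; congr int; apply/funext => x; rewrite /hp re_weil_arch.
by rewrite /= Rintegral_hp; congr int; apply/funext => x; rewrite /hp im_weil_arch.
Qed.

(** The sesquilinear extension of the real form [qform], conjugate-linear in w. *)
Definition cform N v w : C :=
  Complex (qform N (re v) (re w) + qform N (im v) (im w))
          (qform N (im v) (re w) - qform N (re v) (im w)).

Lemma QWE a N v w : 0 < a -> expR (2 * a) <= N%:R ->
  L2a a (re v) -> L2a a (im v) -> L2a a (re w) -> L2a a (im w) ->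
  dE (re v) -> dE (im v) -> dE (re w) -> dE (im w) -> QW v w = cform N v w.
Proof.
move=> a0 LN vr vi wr wi vrE viE wrE wiE.
have cE u : L2a a u -> dE u -> dE (cut a u) by move=> uL /(dE_cut uL).
have cr u u' : L2a a u -> L2a a u' -> rr u u' = rr (cut a u) (cut a u').
  by move=> [uL u0] [u'L u'0]; apply: rr_nr0 => //; exact: L2r_cut.
have [vrL _] := vr; have [viL _] := vi; have [wrL _] := wr; have [wiL _] := wi.
rewrite /QW weilE (convolution_tilde vrL viL wrL wiL).
have W c p q p' q' (pL : L2r p) (qL : L2r q) (p'L : L2r p') (q'L : L2r q') :=
  weil_real_rr c LN (L2r_cut a pL) (@suppin_cut _ a p) (L2r_cut a qL) (@suppin_cut _ a q)
  (L2r_cut a p'L) (@suppin_cut _ a p') (L2r_cut a q'L) (@suppin_cut _ a q').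
rewrite /cform (qform_cut N vr wr) (qform_cut N vi wi) (qform_cut N vi wr) (qform_cut N vr wi).
congr Complex.
  rewrite -[X in _ + X]mul1r -(W 1 _ _ _ _ vrL wrL viL wiL (cE _ vr vrE) (cE _ wr wrE) (cE _ vi viE) (cE _ wi wiE)).
  by congr weil_real; apply/funext => x; rewrite mul1r /re/= (cr _ _ vr wr) (cr _ _ vi wi).
rewrite -[- qform _ _ _]mulN1r -(W _ _ _ _ _ viL wrL vrL wiL (cE _ vi viE) (cE _ wr wrE) (cE _ vr vrE) (cE _ wi wiE)).
by congr weil_real; apply/funext => x; rewrite mulN1r /im/= (cr _ _ vi wr) (cr _ _ vr wi).
Qed.

Lemma fdom_QWa a v : fdom (QWa a) v <-> L2 a v /\ dE (re v) /\ dE (im v).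
Proof.
rewrite /QWa/=; split=> -[vL]; have [[vr _] [vi _]] := (L2P a v).1 vL;
  rewrite /QW_ext -(weil_ext_finite (complex.Re (weil_finite_part (convolution v (tilde v)))) vr vi);
  rewrite (convolution_tilde vr vi vr vi) => h; split=> //;
  move: h; congr (`|_ - _| < _)%E; apply: eq_integral => x _; by rewrite re_weil_arch.
Qed.

End ComplexL2.

(** * Weak derivatives and the space H^1_0 *)

Section WeakDerivative.
Context {R : realType}.
Context (a : R) (a0 : 0 < a).
Local Notation C := R[i].
Local Notation mu := (@lebesgue_measure R).

Lemma indic_oo x : \1_(`]- a, a[%classic) x = (`|x| < a)%R%:R :> R.
Proof.
rewrite indicE; congr (nat_of_bool _)%:R; rewrite ltr_norml.
by apply/idP/idP => [/set_mem|h]; [|apply/mem_set]; rewrite /= in_itv.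
Qed.

Lemma int_oo f : \int[mu]_(x in `]- a, a[) f x = int (cut a f).
Proof. by rewrite Rintegral_setT; apply: eq_int => x; rewrite indic_oo. Qed.

Lemma test_functionP (phi : R -> C) :
  test_function a phi <-> rtest a (re phi) /\ rtest a (im phi).
Proof.
split=> [[sr si [b ba h]]|[[sr [b ba hr]] [si [c ca hi]]]].
  by split; split=> //; exists b => // x bx; rewrite /re /im h.
split=> //; exists (Num.max b c); first by rewrite gt_max ba.
move=> x; rewrite gt_max => /andP[bx cx]; move: (hr x bx) (hi x cx); rewrite /re /im.
by case: (phi x) => p q /= -> ->.
Qed.

Lemma cintegral_mul (v phi : R -> C) : L2r (re v) -> L2r (im v) ->
  L2r (re phi) -> L2r (im phi) -> suppin a (re phi) -> suppin a (im phi) ->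
  cintegral `]- a, a[%classic (fun x => v x * phi x) =
  Complex (ip (re v) (re phi) - ip (im v) (im phi)) (ip (re v) (im phi) + ip (im v) (re phi)).
Proof.
move=> vr vi pr pi' ra ia; rewrite /cintegral !int_oo; congr Complex.
  rewrite -intB; try exact: intg_ip.
  apply: eq_int => x; rewrite /cut; have [_|xa] := boolP (`|x| < a); last first.
    by rewrite ra// ia// !mulr0 mul0r subr0.
  by rewrite mul1r /re /im; case: (v x) => ? ?; case: (phi x).
rewrite -intD; try exact: intg_ip.
apply: eq_int => x; rewrite /cut; have [_|xa] := boolP (`|x| < a); last first.
  by rewrite ra// ia// !mulr0 mul0r addr0.
by rewrite mul1r /re /im; case: (v x) => ? ?; case: (phi x).
Qed.

Definition wder (p q : R -> R) : Prop := forall f, rtest a f -> ip p (derive1 f) = - ip q f.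

Lemma rtest0 : rtest a (fun=> 0).
Proof.
split; last by exists 0.
move=> n x; suff -> : derive1n n (fun=> 0 : R) = fun=> 0 by exact: derivable_cst.
by elim: n => // n IH; rewrite derive1nS IH; apply/funext => y; rewrite derive1_cst.
Qed.

Lemma weak_derivativeP (v w : R -> C) : weak_derivative a v w <->
  [/\ L2 a v, L2 a w, wder (re v) (re w) & wder (im v) (im w)].
Proof.
split=> [[vL wL h]|[vL wL hr hi]]; have [[vr _] [vi _]] := (L2P a v).1 vL;
    have [[wr _] [wi _]] := (L2P a w).1 wL.
  (* Real-valued complex tests separate the two components. *)
  have key f : rtest a f -> ip (re v) (derive1 f) = - ip (re w) f /\ ip (im v) (derive1 f) = - ip (im w) f.
    move=> fT; pose phi x : C := Complex (f x) 0.
    have phiT : test_function a phi by apply/test_functionP; split => //; exact: rtest0.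
    have e0 (p : R -> R) : ip p (fun=> 0) = 0.
      by rewrite -[RHS](@int0 R); apply: eq_int => x; rewrite mulr0.
    have d0 : im (cderive phi) = fun=> 0.
      by apply/funext => x; rewrite /im /= derive1_cst.
    have fL := rtest_L2r fT; have f'T := rtest_derive1 fT.
    have := h _ phiT; rewrite !cintegral_mul//; try exact: rtest_suppin; try exact: L2r0;
      try exact: rtest_suppin f'T; try exact: rtest_L2r f'T;
      try (by rewrite d0; exact: L2r0); try by rewrite d0.
    by rewrite d0 !e0 !subr0 !add0r => -[].
  by split=> // f /key[].
split=> // phi /test_functionP[rT iT].
have r'T := rtest_derive1 rT; have i'T := rtest_derive1 iT.
have er : re (cderive phi) = derive1 (re phi) by [].
have ei : im (cderive phi) = derive1 (im phi) by [].
have rL := rtest_L2r rT; have iL := rtest_L2r iT.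
rewrite !cintegral_mul ?er ?ei//; try exact: rtest_suppin;
  try exact: rtest_suppin r'T; try exact: rtest_L2r r'T;
  try exact: rtest_suppin i'T; try exact: rtest_L2r i'T.
by rewrite !hr// !hi//; congr Complex; rewrite ?opprB ?opprD ?opprK// addrC.
Qed.

Lemma nr0_test d : L2a a d -> (forall f, rtest a f -> ip d f = 0) -> nr d = 0.
Proof.
move=> [dL d0] h; have cL := L2r_cut a dL.
have c0 : nr (cut a d) = 0.
  apply: (test_dense0 a0 cL); first exact: suppin_cut.
  by move=> f fT; rewrite ip_cut ?h//; exact: rtest_suppin fT.
apply/eqP; rewrite eq_le nr_ge0 andbT.
have := nrD_le (L2rB dL cL) cL; rewrite d0 c0 mulr0 addr0.
by congr (_ <= _); apply: eq_int => x; ring.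
Qed.

Lemma wder_uniq p q q' : L2a a q -> L2a a q' -> wder p q -> wder p q' ->
  nr (fun x => q x - q' x) = 0.
Proof.
move=> qL q'L h h'; apply: nr0_test; first exact: L2aB.
move=> f fT; have [qL' _] := qL; have [q'L' _] := q'L.
rewrite ipBl//; last exact: rtest_L2r fT.
by rewrite -[ip q f]opprK -[ip q' f]opprK -h// -h'// subrr.
Qed.

(** Here q0 is the derivative that the approximating sequence reaches and q any other weak
    derivative; they agree almost everywhere, so [test_closure] applies to the cut of q. *)
Lemma wder_closure (phi : nat -> R -> R) p q0 q : (forall n, rtest a (phi n)) ->
  L2a a p -> L2a a q0 -> L2a a q -> wder p q0 -> wder p q ->
  nr (fun x => phi n x - p x) @[n --> \oo] --> 0 ->
  nr (fun x => derive1 (phi n) x - q0 x) @[n --> \oo] --> 0 ->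
  meanzero a (cut a q) /\ nr (fun x => p x - prim (cut a q) x) = 0.
Proof.
move=> phiT [pL _] q0L qL h0 h phip phiq.
have e := wder_uniq q0L qL h0 h; have [q0L' _] := q0L; have [qL' qc] := qL.
have cL := L2r_cut a qL'.
have e' : nr (fun x => q0 x - cut a q x) = 0 := nr0_trans q0L' qL' cL e qc.
apply: (test_closure a0 phiT pL cL) => //; first exact: suppin_cut.
apply: (@squeeze_cvgr _ _ _ _ (fun=> 0) (fun n => 2 * nr (fun x => derive1 (phi n) x - q0 x))).
- apply: nearW => n; rewrite nr_ge0/=.
  have := nr_tri (rtest_L2r (rtest_derive1 (phiT n))) q0L' cL.
  by rewrite e' mulr0 addr0.
- exact: cvg_cst.
- by rewrite -(mulr0 2); apply: cvgM => //; exact: cvg_cst.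
Qed.

(** The concrete description of H^1_0 used from here on: primitives of mean-zero functions, for
    whichever weak derivative is at hand. *)
Lemma H10_prim (v w : R -> C) : H10 a v -> weak_derivative a v w ->
  [/\ meanzero a (cut a (re w)), nr (fun x => re v x - prim (cut a (re w)) x) = 0,
      meanzero a (cut a (im w)) & nr (fun x => im v x - prim (cut a (im w)) x) = 0].
Proof.
move=> [w0 [/weak_derivativeP[vL w0L hr0 hi0] [phi [phiT phiv phiw]]]] /weak_derivativeP[_ wL hr hi].
have [vr vi] := (L2P a v).1 vL; have [w0r w0i] := (L2P a w0).1 w0L; have [wr wi] := (L2P a w).1 wL.
have rT n := ((test_functionP (phi n)).1 (phiT n)).1.
have iT n := ((test_functionP (phi n)).1 (phiT n)).2.
have [phir phii] := (cvgL2P (fun n => rtest_L2r (rT n)) (fun n => rtest_L2r (iT n)) (L2a_L2r vr) (L2a_L2r vi)).1 phiv.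
have [phir' phii'] := (@cvgL2P _ (fun n => cderive (phi n)) _ (fun n => rtest_L2r (rtest_derive1 (rT n)))
  (fun n => rtest_L2r (rtest_derive1 (iT n))) (L2a_L2r w0r) (L2a_L2r w0i)).1 phiw.
have [h1 h2] := wder_closure rT vr w0r wr hr0 hr phir phir'.
by have [h3 h4] := wder_closure iT vi w0i wi hi0 hi phii phii'.
Qed.

Lemma wder_test f : rtest a f -> wder f (derive1 f).
Proof.
move=> fT g gT; rewrite -{1}(prim_derive1 a0 fT).
exact: (int_prim_parts a0 (rtest_meanzero a0 fT) gT).
Qed.

Lemma rtest_L2a f : rtest a f -> L2a a f.
Proof. by move=> fT; apply: L2a_supp; [exact: rtest_L2r fT|exact: rtest_suppin]. Qed.

Lemma test_H10 (phi : R -> C) : test_function a phi -> H10 a phi.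
Proof.
move=> phiT; have [rT iT] := (test_functionP phi).1 phiT.
have r'T := rtest_derive1 rT; have i'T := rtest_derive1 iT.
have cvg0 (u : R -> C) : cvgL2 (fun=> u) u.
  rewrite /cvgL2 (_ : normsq _ = 0%E); first exact: cvg_cst.
  rewrite /normsq (_ : (fun x => _) = (fun=> 0%E)) ?integral0//.
  by apply/funext => x; rewrite subrr /sqmod/= expr0n addr0.
exists (cderive phi); split.
  apply/weak_derivativeP; split.
  - by apply/L2P; split; exact: rtest_L2a.
  - by apply/L2P; split; [exact: rtest_L2a r'T|exact: rtest_L2a i'T].
  - exact: wder_test rT.
  - exact: wder_test iT.
by exists (fun=> phi); split => //; exact: cvg0.
Qed.

Lemma smoothB (f g : R -> R) : smooth f -> smooth g -> smooth (fun x => f x - g x).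
Proof.
move=> sf sg; have e n : derive1n n (fun x => f x - g x) = fun x => derive1n n f x - derive1n n g x.
  elim: n => // n IH; rewrite derive1nS IH; apply/funext => x.
  rewrite derive1E deriveB; [|exact: sf|exact: sg].
  by rewrite !derive1nS !derive1E.
by move=> n x; rewrite e; apply: derivableB; [exact: sf|exact: sg].
Qed.

Lemma rtestB f g : rtest a f -> rtest a g -> rtest a (fun x => f x - g x).
Proof.
move=> [sf [b ba fb]] [sg [c ca gc]]; split; first exact: smoothB.
exists (Num.max b c); first by rewrite gt_max ba.
by move=> x; rewrite gt_max => /andP[bx cx]; rewrite fb// gc// subrr.
Qed.

Lemma reB (v w : R -> C) : re (fun x => v x - w x) = fun x => re v x - re w x.
Proof. by apply/funext => x; exact: ReB. Qed.

Lemma imB (v w : R -> C) : im (fun x => v x - w x) = fun x => im v x - im w x.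
Proof. by apply/funext => x; exact: ImB. Qed.

Lemma L2B (v w : R -> C) : L2 a v -> L2 a w -> L2 a (fun x => v x - w x).
Proof.
move=> /L2P[vr vi] /L2P[wr wi]; apply/L2P; rewrite reB imB; split; exact: L2aB.
Qed.

Lemma wderB p q p' q' : L2a a p -> L2a a q -> L2a a p' -> L2a a q' ->
  wder p q -> wder p' q' -> wder (fun x => p x - p' x) (fun x => q x - q' x).
Proof.
move=> [pL _] [qL _] [p'L _] [q'L _] h h' f fT.
have fL := rtest_L2r fT; have f'L := rtest_L2r (rtest_derive1 fT).
by rewrite !ipBl// h// h'// opprB opprK addrC.
Qed.

Lemma cvg_nrB (u u' : nat -> R -> R) v v' : (forall n, L2r (u n)) -> (forall n, L2r (u' n)) ->
  L2r v -> L2r v' ->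
  nr (fun x => u n x - v x) @[n --> \oo] --> 0 -> nr (fun x => u' n x - v' x) @[n --> \oo] --> 0 ->
  nr (fun x => (u n x - u' n x) - (v x - v' x)) @[n --> \oo] --> 0.
Proof.
move=> uL u'L vL v'L c c'.
apply: (@squeeze_cvgr _ _ _ _ (fun=> 0) (fun n => 2 * nr (fun x => u n x - v x) + 2 * nr (fun x => u' n x - v' x))).
- apply: nearW => n; rewrite nr_ge0/=.
  have := nrB_le (L2rB (uL n) vL) (L2rB (u'L n) v'L).
  by congr (_ <= _); apply: eq_int => x; ring.
- exact: cvg_cst.
- rewrite [X in _ --> X](_ : 0 = 2 * 0 + 2 * 0); last by ring.
  by apply: cvgD; apply: cvgM => //; exact: cvg_cst.
Qed.

Lemma cvgL2B (u u' : nat -> R -> C) v v' : (forall n, L2 a (u n)) -> (forall n, L2 a (u' n)) ->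
  L2 a v -> L2 a v' -> cvgL2 u v -> cvgL2 u' v' ->
  cvgL2 (fun n x => u n x - u' n x) (fun x => v x - v' x).
Proof.
move=> uL u'L vL v'L.
have D n := L2B (uL n) (u'L n); have d := L2B vL v'L.
have rL w : L2 a w -> L2r (re w) by move=> /L2P[[]].
have iL w : L2 a w -> L2r (im w) by move=> /L2P[_ []].
move=> /(cvgL2P (fun n => rL _ (uL n)) (fun n => iL _ (uL n)) (rL _ vL) (iL _ vL))[r1 i1].
move=> /(cvgL2P (fun n => rL _ (u'L n)) (fun n => iL _ (u'L n)) (rL _ v'L) (iL _ v'L))[r2 i2].
apply/(cvgL2P (fun n => rL _ (D n)) (fun n => iL _ (D n)) (rL _ d) (iL _ d)); split.
  under eq_fun do rewrite reB; rewrite reB.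
  by apply: cvg_nrB => //; try (by move=> n; exact: rL); exact: rL.
under eq_fun do rewrite imB; rewrite imB.
by apply: cvg_nrB => //; try (by move=> n; exact: iL); exact: iL.
Qed.

(** Form convergence evaluates the form of B_a at differences of members of a sequence, which must
    lie in its domain. *)
Lemma H10B (v v' : R -> C) : H10 a v -> H10 a v' -> H10 a (fun x => v x - v' x).
Proof.
move=> [w [wd [phi [phiT pv pw]]]] [w' [wd' [phi' [phi'T pv' pw']]]].
have [vL wL hr hi] := (weak_derivativeP _ _).1 wd.
have [v'L w'L hr' hi'] := (weak_derivativeP _ _).1 wd'.
have [vr vi] := (L2P a v).1 vL; have [wr wi] := (L2P a w).1 wL.
have [v'r v'i] := (L2P a v').1 v'L; have [w'r w'i] := (L2P a w').1 w'L.
exists (fun x => w x - w' x); split.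
  apply/weak_derivativeP; split; [exact: L2B|exact: L2B|rewrite !reB|rewrite !imB]; exact: wderB.
have tL phi0 : test_function a phi0 -> L2 a phi0.
  by move=> /test_functionP[? ?]; apply/L2P; split; exact: rtest_L2a.
have tL' phi0 : test_function a phi0 -> L2 a (cderive phi0).
  move=> /test_functionP[? ?]; apply/L2P; split; apply: (@rtest_L2a (derive1 _)); exact: rtest_derive1.
exists (fun n x => phi n x - phi' n x); split.
- move=> n; have /test_functionP[? ?] := phiT n; have /test_functionP[? ?] := phi'T n.
  by apply/test_functionP; rewrite reB imB; split; exact: rtestB.
- by apply: cvgL2B => // n; exact: tL.
- rewrite (_ : (fun n => _) = fun n x => cderive (phi n) x - cderive (phi' n) x).
    by apply: cvgL2B => // n; exact: tL'.
  apply/funext => n; apply/funext => x.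
  have /test_functionP[[rs _] [is_ _]] := phiT n; have /test_functionP[[rs' _] [is' _]] := phi'T n.
  rewrite /cderive; have e1 := @deriveB R _ _ (re (phi n)) (re (phi' n)) x 1 (smooth_derivable rs) (smooth_derivable rs').
  have e2 := @deriveB R _ _ (im (phi n)) (im (phi' n)) x 1 (smooth_derivable is_) (smooth_derivable is').
  rewrite [RHS]complex_eta ReB ImB /= !derive1E; congr Complex.
    rewrite -[RHS]e1; congr ('D_1 _ x); apply/funext => y; exact: ReB.
  rewrite -[RHS]e2; congr ('D_1 _ x); apply/funext => y; exact: ImB.
Qed.

End WeakDerivative.

(** * The operator B_a computed on H^1_0 *)

Section OperatorB.
Context {R : realType}.
Context (a : R) (a0 : 0 < a).
Local Notation C := R[i].

(** Correlations of functions on the interval vanish at +-ln n for n >= e^(2a), so this cutoff loses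
    no term of the prime sum. *)
Definition Nmax : nat := (Num.truncn (expR (2 * a))).+1.

Lemma Nmax_ge : expR (2 * a) <= Nmax%:R.
Proof. exact/ltW/truncnS_gt. Qed.

Definition weilcut r : R -> R := cut a (weilop a Nmax (prim r)).

Lemma weilcut_L2a r : meanzero a r -> L2a a (weilcut r).
Proof.
move=> rZ; have [h _] := weilop_ip a0 Nmax rZ (@L2r0 R) (fun _ _ => erefl).
by apply: L2a_supp; [exact: h|exact: suppin_cut].
Qed.

Lemma ip_weilcut r v : meanzero a r -> L2a a v ->
  ip (weilcut r) v = qform Nmax (prim r) (cut a v).
Proof.
move=> rZ [vL v0]; have cL := L2r_cut a vL.
have [_ <-] := weilop_ip a0 Nmax rZ cL (@suppin_cut _ a v).
have [wL _] := weilcut_L2a rZ.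
by rewrite ipC -(ip_cut v (@suppin_cut _ a (weilop a Nmax (prim r)))) ipC.
Qed.

Lemma re_mul_i (w : R -> C) : re (fun x => 'i%C * w x) = fun x => - im w x.
Proof. by apply/funext => x; rewrite /re /im; case: (w x) => p q /=; rewrite mul0r mul1r sub0r. Qed.

Lemma im_mul_i (w : R -> C) : im (fun x => 'i%C * w x) = re w.
Proof. by apply/funext => x; rewrite /re /im; case: (w x) => p q /=; rewrite mul0r mul1r add0r. Qed.

(** A derivative of an H^1_0 function has mean zero, so the inner projection merely cuts;
    multiplication by i exchanges the two parts, with a sign. *)
Lemma projL20_i (w : R -> C) : meanzero a (cut a (re w)) -> meanzero a (cut a (im w)) ->
  cintegral `]- a, a[%classic (fun x => 'i%C * w x) = 0 /\
  projL20 a (fun x => 'i%C * w x) =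
    fun x => Complex (- cut a (im w) x) (cut a (re w) x).
Proof.
move=> rZ sZ; have [_ _ r0] := rZ; have [_ _ s0] := sZ.
have e : cintegral `]- a, a[%classic (fun x => 'i%C * w x) = 0.
  rewrite /cintegral !int_oo -[RHS]/(Complex 0 0); congr Complex.
    transitivity (int (fun x => - cut a (im w) x)).
      apply: eq_int => x; rewrite /cut -mulrN; congr (_ * _).
      exact: (congr1 (fun f : R -> R => f x) (re_mul_i w)).
    by rewrite intN ?s0 ?oppr0//; exact: meanzero_intg sZ.
  rewrite -[RHS]r0; apply: eq_int => x; rewrite /cut; congr (_ * _).
  exact: (congr1 (fun f : R -> R => f x) (im_mul_i w)).
split=> //; apply/funext => x; rewrite /projL20 e mulr0 subr0 in_itv/= -ltr_norml /cut.
case: ifPn => _; last by rewrite !mul0r oppr0.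
rewrite !mul1r [LHS]complex_eta; congr Complex.
  exact: (congr1 (fun f : R -> R => f x) (re_mul_i w)).
exact: (congr1 (fun f : R -> R => f x) (im_mul_i w)).
Qed.

Lemma opG_pair r s x : intg r -> suppin a r -> intg s -> suppin a s -> `|x| < a ->
  opG (fun y => Complex (- s y) (r y)) x =
  Complex (- screw_conv a s x) (screw_conv a r x).
Proof.
move=> ri ra si sa xa; rewrite /opG /cintegral; congr Complex.
  rewrite /screw_conv -intN; last exact: intg_screw_conv.
  apply: eq_int => y /=; rewrite mul0r subr0 mulrN; congr (- _).
  exact: (congr1 (fun f : R -> R => f y) (screw_convE sa xa)).
apply: eq_int => y /=; rewrite mul0r addr0.
exact: (congr1 (fun f : R -> R => f y) (screw_convE ra xa)).
Qed.

(** The constants k and k' are the components of the mean subtracted by the outer projection. *)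
Lemma opGa_i (w : R -> C) : meanzero a (cut a (re w)) -> meanzero a (cut a (im w)) ->
  exists k k' : R,
    re (opGa a (fun x => 'i%C * w x)) = cut a (fun x => - screw_conv a (cut a (im w)) x - k) /\
    im (opGa a (fun x => 'i%C * w x)) = cut a (fun x => screw_conv a (cut a (re w)) x - k').
Proof.
move=> rZ sZ; have [rL ra r0] := rZ; have [sL sa s0] := sZ.
have [_ e] := projL20_i rZ sZ.
have [c hc] : exists c : C, forall x, opGa a (fun x => 'i%C * w x) x =
    if `|x| < a then opG (projL20 a (fun x => 'i%C * w x)) x - c else 0.
  exists (RtoC (2 * a)^-1 * cintegral `]- a, a[%classic (opG (projL20 a (fun x => 'i%C * w x)))).
  by move=> x; rewrite {1}/opGa {1}/projL20 in_itv/= -ltr_norml.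
have h x : opGa a (fun x => 'i%C * w x) x = if `|x| < a then
    Complex (- screw_conv a (cut a (im w)) x - complex.Re c) (screw_conv a (cut a (re w)) x - complex.Im c) else 0.
  rewrite hc; case: ifPn => // xa; rewrite e.
  rewrite (opG_pair (meanzero_intg rZ) ra (meanzero_intg sZ) sa xa).
  by case: (c).
exists (complex.Re c), (complex.Im c).
by split; apply/funext => x; rewrite /re /im h /cut; case: ifPn => _; rewrite ?mul1r ?mul0r.
Qed.

Lemma L2a_bounded (f : R -> R) (B : R) : measurable_fun setT f -> (forall x, `|f x| <= B) -> L2a a (cut a f).
Proof.
move=> mf fB; apply: L2a_supp; last exact: suppin_cut.
apply: (@L2r_bounded _ a _ (B ^+ 2)); [exact: mes_cut|exact: suppin_cut|move=> x].
have B0 : 0 <= B by apply: le_trans (fB 0).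
rewrite -(real_normK (num_real (cut a f x))) lerXn2r ?nnegrE//.
by apply: le_trans (bool_norm_le _ _) _.
Qed.

(** [int_screw_conv] read as a weak derivative; the constant k disappears because derivatives of
    test functions have mean zero. *)
Lemma wder_screw_conv r k : meanzero a r ->
  L2a a (cut a (fun x => screw_conv a r x - k)) /\
  wder a (cut a (fun x => screw_conv a r x - k)) (fun x => - weilcut r x).
Proof.
move=> rZ; have ri := meanzero_intg rZ; have [B hB] := screw_conv_bounded a0 ri.
have ms := mes_screw_conv a0 ri.
have L : L2a a (cut a (fun x => screw_conv a r x - k)).
  apply: (@L2a_bounded _ (B + `|k|)); first exact: measurable_funB.
  by move=> x; apply: le_trans (ler_normB _ _) _; rewrite lerD2r.
split=> // f fT; have f'T := rtest_derive1 fT; have fL := rtest_L2r fT.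
have [wL _] := weilcut_L2a rZ; rewrite ipNl// opprK /weilcut.
rewrite ip_cut; last exact: rtest_suppin f'T.
have f'i := meanzero_intg (rtest_meanzero a0 fT); have [_ _ f'0] := rtest_meanzero a0 fT.
rewrite -(int_screw_conv a0 Nmax_ge rZ fT).
transitivity (int (fun x => screw_conv a r x * derive1 f x - k * derive1 f x)).
  by apply: eq_int => x; rewrite mulrBl.
rewrite intB ?intZ ?f'0 ?mulr0 ?subr0//; last exact: intgZ.
apply: intg_dom (intgZ B (intg_norm f'i)); first by apply: measurable_funM => //; exact: intg_mes.
by move=> x; rewrite normrM ler_wpM2r.
Qed.

Lemma wder_screw_convN r k : meanzero a r ->
  L2a a (cut a (fun x => - screw_conv a r x - k)) /\
  wder a (cut a (fun x => - screw_conv a r x - k)) (weilcut r).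
Proof.
move=> rZ; have [L h] := wder_screw_conv (- k) rZ.
have e : cut a (fun x => - screw_conv a r x - k) = fun x => - cut a (fun x => screw_conv a r x - - k) x.
  by apply/funext => x; rewrite /cut -mulrN; congr (_ * _); ring.
have [LL _] := L; have [wL _] := weilcut_L2a rZ.
rewrite e; split; first by apply: L2a_supp; [exact: L2rN|move=> x xa; rewrite suppin_cut ?oppr0].
move=> f fT; rewrite ipNl//; last by apply: rtest_L2r (rtest_derive1 fT).
by rewrite h// ipNl ?opprK//; exact: rtest_L2r fT.
Qed.

Lemma L2aN f : L2a a f -> L2a a (fun x => - f x).
Proof.
move=> fL; have := L2aB (L2a_supp (@L2r0 R) (fun _ _ => erefl)) fL.
by congr (L2a a _); apply/funext => x; rewrite sub0r.
Qed.

Lemma L2_mul_i (w : R -> C) : L2 a w -> L2 a (fun x => 'i%C * w x).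
Proof. by move=> /L2P[wr wi]; apply/L2P; rewrite re_mul_i im_mul_i; split=> //; exact: L2aN. Qed.

Lemma L20_i (w : R -> C) : L2 a w -> meanzero a (cut a (re w)) -> meanzero a (cut a (im w)) ->
  L20 a (fun x => 'i%C * w x).
Proof. by move=> wL rZ sZ; split; [exact: L2_mul_i|have [] := projL20_i rZ sZ]. Qed.

Lemma opB_exists (v : R -> C) : H10 a v -> exists h, opB a v h.
Proof.
move=> vH; have [w [wd _]] := vH; have [rZ _ sZ _] := H10_prim a0 vH wd.
have [_ wL _ _] := (weak_derivativeP a0 v w).1 wd.
have [k [k' [er ei]]] := opGa_i rZ sZ.
have [L1 W1] := wder_screw_convN k sZ; have [L2' W2] := wder_screw_conv k' rZ.
(* The weak derivative of G_a(i w). The second factor i sends it to [weilcut] of the real part of w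
   plus i times [weilcut] of the imaginary part: the signs from i twice and from the derivative
   cancel. *)
pose w2 x : C := Complex (weilcut (cut a (im w)) x) (- weilcut (cut a (re w)) x).
exists (fun x => 'i%C * w2 x), (fun x => 'i%C * w x); split; [split=> //|exact: L20_i|].
  by exists w.
exists w2 => //; apply/(weak_derivativeP a0); split; rewrite ?er ?ei//.
- by apply/L2P; rewrite er ei.
- apply/L2P; split; first exact: weilcut_L2a.
  exact: (L2aN (weilcut_L2a rZ)).
Qed.

(** Valid for every h related to v, not only the one constructed above: weak derivatives are unique
    almost everywhere, and both sides depend only on classes. *)
Lemma opB_weil (v h k : R -> C) : opB a v h -> L2 a k -> L2 a h /\ inner h k = cform Nmax v k.
Proof.
move=> [u [[vH [w wd ->]] _ [w2 wd2 ->]]] kL.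
have [rZ pr sZ ps] := H10_prim a0 vH wd.
have [kk [kk' [er ei]]] := opGa_i rZ sZ.
have [L1 W1] := wder_screw_convN kk sZ; have [L2' W2] := wder_screw_conv kk' rZ.
have [_ w2L h1 h2] := (weak_derivativeP a0 _ _).1 wd2; rewrite er in h1; rewrite ei in h2.
have [w2r w2i] := (L2P a w2).1 w2L; have [kr ki] := (L2P a k).1 kL.
have [vL _ _ _] := (weak_derivativeP a0 _ _).1 wd; have [vr vi] := (L2P a v).1 vL.
have e1 := wder_uniq a0 w2r (weilcut_L2a sZ) h1 W1.
have e2 := wder_uniq a0 w2i (L2aN (weilcut_L2a rZ)) h2 W2.
have e2' : nr (fun x => - im w2 x - weilcut (cut a (re w)) x) = 0.
  by rewrite -[RHS]e2; apply: eq_int => x; rewrite opprK -sqrrN opprB addrC opprK.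
split; first exact: L2_mul_i.
have iL := L2rN (L2a_L2r w2i); have rL := L2a_L2r w2r.
have R1 := L2a_L2r (weilcut_L2a rZ); have S1 := L2a_L2r (weilcut_L2a sZ).
have key p q x : L2a a p -> meanzero a x -> L2a a q -> nr (fun y => p y - prim x y) = 0 ->
    ip (weilcut x) q = qform Nmax p q.
  move=> pL xZ qL px; rewrite ip_weilcut//; exact: (esym (qform_nr0 Nmax (L2a_L2r pL) (prim_L2r a0 xZ) (L2a_L2r qL) (L2r_cut a (L2a_L2r qL)) px (L2a_ae qL))).
have ipe (p p' q : R -> R) : L2r p -> L2r p' -> L2r q -> nr (fun x => p x - p' x) = 0 -> ip p q = ip p' q.
  move=> pL p'L qL e; apply/eqP; rewrite -subr_eq0 -ipBl//; apply/eqP; apply: nr0_ip => //.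
  exact: L2rB.
have krL := L2a_L2r kr; have kiL := L2a_L2r ki.
rewrite innerE ?re_mul_i ?im_mul_i// /cform.
rewrite -(key _ _ _ vr rZ kr pr) -(key _ _ _ vr rZ ki pr) -(key _ _ _ vi sZ kr ps) -(key _ _ _ vi sZ ki ps).
rewrite (ipe _ _ _ rL S1 krL e1) (ipe _ _ _ rL S1 kiL e1).
by rewrite (ipe _ _ _ iL R1 krL e2') (ipe _ _ _ iL R1 kiL e2').
Qed.

End OperatorB.

(** * The closure of the form of B_a *)

Section Friedrichs.
Context {R : realType}.
Context (a : R) (a0 : 0 < a).
Local Notation C := R[i].
Local Notation N := (Nmax a).
Local Notation B := (op_form (opB a)).

Lemma EEB_le (v w : R -> R) : L2r v -> L2r w -> dE v -> dE w ->
  EE (fun x => v x - w x) (fun x => v x - w x) <= 2 * EE v v + 2 * EE w w.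
Proof.
move=> vL wL vE wE; have := EE_ge0 (fun x => v x + w x); rewrite EED// EEB//.
by move: (EE v v) (EE w w) (EE v w) => p q r; lra.
Qed.

Lemma EE_tri (u v w : R -> R) : L2r u -> L2r v -> L2r w -> dE u -> dE v -> dE w ->
  EE (fun x => u x - w x) (fun x => u x - w x) <=
  2 * EE (fun x => u x - v x) (fun x => u x - v x) + 2 * EE (fun x => w x - v x) (fun x => w x - v x).
Proof.
move=> uL vL wL uE vE wE.
have := EEB_le (L2rB uL vL) (L2rB wL vL) (dEB uL vL uE vE) (dEB wL vL wE vE).
have -> : (fun x => (u x - v x) - (w x - v x)) = fun x => u x - w x by apply/funext => x; ring.
by [].
Qed.

(** The form is the energy up to an L^2-bounded perturbation. This gives the lower bound of B_a, and
    along L^2-convergent sequences it makes form convergence and energy convergence the same. *)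
Lemma qform_EE_le p : L2a a p -> `|qform N p p - EE p p| <= Kbound a N * nr p.
Proof.
move=> pL; have [pL' p0] := pL; have cL := L2r_cut a pL'; have cs := @suppin_cut R a p.
have -> : qform N p p - EE p p = KK N (cut a p) (cut a p).
  by rewrite /KK -(rr_nr0 pL' cL pL' cL p0 p0) /qform addrK.
apply: le_trans (KK_le a0 N cL cs cL cs) _.
by rewrite -expr2 sqr_sqrtr ?nr_ge0// ler_wpM2l ?Kbound_ge0// nr_cut_le.
Qed.

Lemma EE_cut d : L2a a d -> EE d d = EE (cut a d) (cut a d).
Proof.
move=> [dL d0]; have cL := L2r_cut a dL.
by rewrite !EE_int (enI_nr0 dL cL dL cL d0 d0).
Qed.

Lemma qform_sym p r : L2a a p -> L2a a r -> qform N p r = qform N r p.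
Proof.
move=> pL rL; rewrite (qform_cut N pL rL) (qform_cut N rL pL).
exact: (qformC N (L2r_cut a (L2a_L2r pL)) (@suppin_cut _ a p) (L2r_cut a (L2a_L2r rL)) (@suppin_cut _ a r)).
Qed.

Lemma cform_diag (v : R -> C) : L2 a v ->
  cform N v v = Complex (qform N (re v) (re v) + qform N (im v) (im v)) 0.
Proof. by move=> /L2P[vr vi]; rewrite /cform (qform_sym vi vr) subrr. Qed.

Lemma odom_opB : odom (opB a) = H10 a.
Proof.
apply/seteqP; split=> [v [h [u [[vH _] _ _]]]|v vH]//.
exact: opB_exists.
Qed.

Lemma H10_dE (v : R -> C) : H10 a v -> [/\ L2 a v, dE (re v) & dE (im v)].
Proof.
move=> vH; have [w [wd _]] := vH; have [rZ pr sZ ps] := H10_prim a0 vH wd.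
have [vL _ _ _] := (weak_derivativeP a0 _ _).1 wd; have [vr vi] := (L2P a v).1 vL.
split=> //.
  apply: dE_nr0 (prim_dE a0 rZ); [exact: prim_L2r rZ|exact: L2a_L2r vr|by rewrite nr_subC].
apply: dE_nr0 (prim_dE a0 sZ); [exact: prim_L2r sZ|exact: L2a_L2r vi|by rewrite nr_subC].
Qed.

(** The form of B_a involves a chosen value of the operator; [opB_weil] holds for every admissible
    value, so the choice has no effect. *)
Lemma opB_form (v w : R -> C) : H10 a v -> L2 a w -> fval B v w = cform N v w.
Proof.
move=> vH wL /=; have [h hv] := opB_exists a0 vH.
by have [_] := opB_weil a0 (xgetPex (fun=> 0) (ex_intro _ h hv)) wL.
Qed.

Lemma nr_cvg_cut (u : nat -> R -> R) w : (forall n, L2r (u n)) -> L2a a w ->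
  nr (fun x => u n x - cut a w x) @[n --> \oo] --> 0 -> nr (fun x => u n x - w x) @[n --> \oo] --> 0.
Proof.
move=> uL wL uc; have [wL' w0] := wL; have cL := L2r_cut a wL'.
apply: (@squeeze_cvgr _ _ _ _ (fun=> 0) (fun n => 2 * nr (fun x => u n x - cut a w x))).
- apply: nearW => n; rewrite nr_ge0/=.
  by have := nr_tri (uL n) cL wL'; rewrite (nr_subC (cut a w)) w0 mulr0 addr0.
- exact: cvg_cst.
- by rewrite -(mulr0 2); apply: cvgM => //; exact: cvg_cst.
Qed.

Lemma EE_cvg_cut (u : nat -> R -> R) w : (forall n, L2a a (u n)) -> L2a a w ->
  EE (fun x => u n x - cut a w x) (fun x => u n x - cut a w x) @[n --> \oo] --> 0 ->
  EE (fun x => u n x - w x) (fun x => u n x - w x) @[n --> \oo] --> 0.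
Proof.
move=> uL wL; have [wL' w0] := wL; apply: cvg_extn => n; have unL := L2a_L2r (uL n).
have d1 := L2rB unL wL'; have d2 := L2rB unL (L2r_cut a wL').
have e : nr (fun x => (u n x - w x) - (u n x - cut a w x)) = 0.
  by rewrite -[RHS]w0; apply: eq_int => x; ring.
by rewrite !EE_int (enI_nr0 d1 d2 d1 d2 e e).
Qed.

Lemma opB_dense : dense_in_L2 a (odom (opB a)).
Proof.
move=> v vL; have [vr vi] := (L2P a v).1 vL; rewrite odom_opB.
have vrL := L2a_L2r vr; have viL := L2a_L2r vi.
have [p [pT pL pc _]] := approx_test a0 (L2r_cut a vrL) (@suppin_cut R a (re v)).
have [q [qT qL qc _]] := approx_test a0 (L2r_cut a viL) (@suppin_cut R a (im v)).
exists (fun n x => Complex (p n x) (q n x)).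
  by move=> n; apply: test_H10 => //; apply/test_functionP; split; [exact: pT|exact: qT].
apply/(@cvgL2P R (fun n x => Complex (p n x) (q n x)) v pL qL vrL viL).
by split; apply: nr_cvg_cut.
Qed.

Lemma opB_symmetric : symmetric_op (opB a).
Proof.
move=> v h w k vh wk.
have vH : H10 a v by rewrite -odom_opB; exists h.
have wH : H10 a w by rewrite -odom_opB; exists k.
have [vL _ _] := H10_dE vH; have [wL _ _] := H10_dE wH.
have [hL ->] := opB_weil a0 vh wL; have [kL] := opB_weil a0 wk vL.
have [vr vi] := (L2P a v).1 vL; have [wr wi] := (L2P a w).1 wL; have [kr ki] := (L2P a k).1 kL.
rewrite innerE; [|exact: L2a_L2r kr|exact: L2a_L2r ki|exact: L2a_L2r vr|exact: L2a_L2r vi].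
rewrite innerE; [|exact: L2a_L2r vr|exact: L2a_L2r vi|exact: L2a_L2r kr|exact: L2a_L2r ki].
rewrite /cform => -[e1 e2]; congr Complex.
  by rewrite (ipC (re v)) (ipC (im v)) e1 (qform_sym vr wr) (qform_sym vi wi).
by rewrite (ipC (re v)) (ipC (im v)) -[RHS]opprB e2 opprB (qform_sym vi wr) (qform_sym vr wi).
Qed.

Lemma opB_lower_bounded : lower_bounded_op (opB a).
Proof.
exists (- Kbound a N) => v h vh.
have vH : H10 a v by rewrite -odom_opB; exists h.
have [vL _ _] := H10_dE vH; have [_ ->] := opB_weil a0 vh vL; have [vr vi] := (L2P a v).1 vL.
have vrL := L2a_L2r vr; have viL := L2a_L2r vi.
rewrite cform_diag// innerE//.
rewrite (ipC (re v) (im v)) subrr -!nr_ip.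
have -> : RtoC (- Kbound a N) * Complex (nr (re v) + nr (im v)) 0 =
    Complex (- Kbound a N * (nr (re v) + nr (im v))) 0 :> C.
  by rewrite [LHS]complex_eta /= !mulr0 mul0r subr0 addr0.
rewrite lecE/= eqxx/= mulrDr.
have g p : L2a a p -> - Kbound a N * nr p <= qform N p p.
  move=> pL; have := qform_EE_le pL; rewrite ler_norml => /andP[h1 _].
  have := EE_ge0 p; move: h1; rewrite mulNr; move: (_ * nr p) (qform _ _ _) (EE p p) => A D E; lra.
by apply: lerD; exact: g.
Qed.

(** Kato's condition is a Cauchy condition on the form. Modulo the L^2-small perturbation it is a
    Cauchy condition on the energies of both parts, and [energy_cauchy] turns this into convergence
    to v and finite energy of v. *)
Lemma opB_form_cvg (u : nat -> R -> C) v : form_cvg a B u v <->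
  [/\ (forall n, H10 a (u n)), fdom (QWa a) v, cvgL2 u v,
      EE (fun x => re (u n) x - re v x) (fun x => re (u n) x - re v x) @[n --> \oo] --> 0 &
      EE (fun x => im (u n) x - im v x) (fun x => im (u n) x - im v x) @[n --> \oo] --> 0].
Proof.
suff S : (forall n, H10 a (u n)) -> L2 a v -> cvgL2 u v ->
    (let d (k : nat * nat) : R -> C := fun x => u k.1 x - u k.2 x in
       sqmod (fval B (d k) (d k))) @[k --> (\oo, \oo)] --> (0 : R) <->
    [/\ dE (re v), dE (im v),
      EE (fun x => re (u n) x - re v x) (fun x => re (u n) x - re v x) @[n --> \oo] --> 0 &
      EE (fun x => im (u n) x - im v x) (fun x => im (u n) x - im v x) @[n --> \oo] --> 0].
  split=> [[uH vL uv c]|[uH /fdom_QWa[vL [rE iE]] uv rc ic]].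
    have {}uH n : H10 a (u n) by rewrite -odom_opB; exact: uH.
    have [rE iE rc ic] := (S uH vL uv).1 c.
    by split=> //; apply/fdom_QWa.
  by split=> //; [move=> n; rewrite /= odom_opB|apply/S].
move=> uH vL uv; have [vr vi] := (L2P a v).1 vL.
have uL n : L2 a (u n) by have [] := H10_dE (uH n).
have rE n : dE (re (u n)) by have [] := H10_dE (uH n).
have iE n : dE (im (u n)) by have [] := H10_dE (uH n).
have rL n : L2r (re (u n)) by have /L2P[[]] := uL n.
have iL n : L2r (im (u n)) by have /L2P[_ []] := uL n.
have vrL := L2a_L2r vr; have viL := L2a_L2r vi.
have [ruv iuv] := (cvgL2P rL iL vrL viL).1 uv.
pose d (k : nat * nat) : R -> C := fun x => u k.1 x - u k.2 x.
have dH k : H10 a (d k) by exact: H10B.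
pose X k : R := qform N (re (d k)) (re (d k)) + qform N (im (d k)) (im (d k)).
have Xe : (fun k => sqmod (fval B (d k) (d k))) = fun k => X k ^+ 2.
  apply/funext => k; have [dL _ _] := H10_dE (dH k).
  by rewrite opB_form// cform_diag// /sqmod/= expr0n addr0.
pose Er k := EE (re (d k)) (re (d k)); pose Ei k := EE (im (d k)) (im (d k)).
pose nn n := nr (fun x => re (u n) x - re v x) + nr (fun x => im (u n) x - im v x).
pose K := Kbound a N; have K0 : 0 <= K by exact: Kbound_ge0.
have XE k : `|X k - (Er k + Ei k)| <= K * (2 * nn k.1 + 2 * nn k.2).
  have [/L2P[dr di] _ _] := H10_dE (dH k).
  rewrite /X opprD addrACA; apply: le_trans (ler_normD _ _) _.
  apply: le_trans (lerD (qform_EE_le dr) (qform_EE_le di)) _.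
  rewrite -mulrDr ler_wpM2l// /nn !mulrDr addrACA reB imB; apply: lerD.
    have := nr_tri (rL k.1) vrL (rL k.2); rewrite (nr_subC (re v)); exact.
  have := nr_tri (iL k.1) viL (iL k.2); rewrite (nr_subC (im v)); exact.
have nn0 : nn n @[n --> \oo] --> 0 by rewrite -(addr0 0); exact: cvgD.
rewrite -/d Xe; split=> [c|[vrE viE rc ic]].
  have cauchy e : 0 < e -> exists M : nat, forall n m, (M <= n)%N -> (M <= m)%N ->
      Er (n, m) + Ei (n, m) <= e.
    (* With both L^2 distances below this, the perturbation is at most (K + 1) 4 dl = e / 2; the
       form itself takes the other half. *)
    move=> e0; pose dl := e / (8 * (K + 1)).
    have K1 : 0 < 8 * (K + 1) by rewrite mulr_gt0// ltr_wpDl.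
    have dl0 : 0 < dl by rewrite divr_gt0.
    have e2 : 0 < (e / 2) ^+ 2 by rewrite exprn_gt0// divr_gt0.
    have /cvgrPdist_le/(_ _ e2) := c; case=> -[/= P Q] [[M1 _ h1] [M2 _ h2]] h.
    have /cvgrPdist_le/(_ _ dl0)[M3 _ h3] := nn0.
    exists (maxn M1 (maxn M2 M3)) => n m; rewrite !geq_max => /and3P[n1 n2 n3] /and3P[m1 m2 m3].
    have /= hX := h (n, m) (conj (h1 n n1) (h2 m m2)).
    have hn := h3 n n3; have hm := h3 m m3.
    have nn_ge0 k : 0 <= nn k by rewrite addr_ge0// nr_ge0.
    rewrite /= !sub0r !normrN in hX hn hm.
    rewrite ger0_norm ?sqr_ge0// in hX; rewrite ger0_norm// in hn; rewrite ger0_norm// in hm.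
    have hX' : `|X (n, m)| <= e / 2.
      by rewrite -(@ler_pXn2r _ 2)// ?nnegrE ?divr_ge0 ?(ltW e0)// real_normK ?num_real.
    have hK : K * (2 * nn n + 2 * nn m) <= e / 2.
      apply: le_trans (_ : (K + 1) * (4 * dl) <= _).
        apply: ler_pM => //; [by rewrite addr_ge0// mulr_ge0|by rewrite lerDl|lra].
      by rewrite le_eqVlt; apply/orP; left; apply/eqP; rewrite /dl; field; rewrite gt_eqF// ltr_wpDl.
    have := XE (n, m); rewrite /= distrC => h'.
    have : Er (n, m) + Ei (n, m) <= `|X (n, m)| + `|Er (n, m) + Ei (n, m) - X (n, m)|.
      apply: le_trans (_ : X (n, m) + (Er (n, m) + Ei (n, m) - X (n, m)) <= _).
        by rewrite [leRHS]addrC subrK.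
      by apply: lerD; exact: ler_norm.
    by move: h' hX' hK; move: (K * _) (X _) (Er _ + Ei _) `|_ - _| => A D F G; lra.
  have Er0 k : 0 <= Er k by exact: EE_ge0.
  have Ei0 k : 0 <= Ei k by exact: EE_ge0.
  have [vrE rc] : dE (re v) /\ EE (fun x => re (u n) x - re v x) (fun x => re (u n) x - re v x) @[n --> \oo] --> 0.
    apply: energy_cauchy => // e /cauchy[M h]; exists M => n m nM mM.
    by rewrite -reB; apply: le_trans (h n m nM mM); rewrite lerDl.
  have [viE ic] : dE (im v) /\ EE (fun x => im (u n) x - im v x) (fun x => im (u n) x - im v x) @[n --> \oo] --> 0.
    apply: energy_cauchy => // e /cauchy[M h]; exists M => n m nM mM.
    by rewrite -imB; apply: le_trans (h n m nM mM); rewrite lerDr.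
  by [].
(* One quantity per index, so that |X (n, m)| <= rho n + rho m and the double limit reduces to
   single ones. *)
pose rho n := 2 * EE (fun x => re (u n) x - re v x) (fun x => re (u n) x - re v x)
  + 2 * EE (fun x => im (u n) x - im v x) (fun x => im (u n) x - im v x) + K * (2 * nn n).
have rho0 : rho n @[n --> \oo] --> 0.
  rewrite [X in _ --> X](_ : 0 = 2 * 0 + 2 * 0 + K * (2 * 0)); last by ring.
  apply: cvgD; first by apply: cvgD; apply: cvgM => //; exact: cvg_cst.
  by apply: cvgM; [exact: cvg_cst|apply: cvgM => //; exact: cvg_cst].
apply: (@squeeze_cvgr _ _ _ _ (fun=> 0) (fun k : nat * nat => (rho k.1 + rho k.2) * (rho k.1 + rho k.2))).
- apply: nearW => k; rewrite sqr_ge0/= -expr2 -(real_normK (num_real (X k))).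
  have h : `|X k| <= rho k.1 + rho k.2.
    have -> : X k = (X k - (Er k + Ei k)) + (Er k + Ei k) by rewrite subrK.
    apply: le_trans (ler_normD _ _) _.
    rewrite (ger0_norm (addr_ge0 (EE_ge0 _) (EE_ge0 _))).
    have h1 := EE_tri (rL k.1) vrL (rL k.2) (rE k.1) vrE (rE k.2).
    have h2 := EE_tri (iL k.1) viL (iL k.2) (iE k.1) viE (iE k.2).
    have h3 := XE k; apply: le_trans (lerD h3 (lerD _ _)) _.
    + by rewrite /Er /d reB; exact: h1.
    + by rewrite /Ei /d imB; exact: h2.
    + rewrite /rho; move: (EE _ _) (EE _ _) (EE _ _) (EE _ _) (nn _) (nn _) => A1 A2 A3 A4 A5 A6; lra.
  by rewrite lerXn2r// ?nnegrE// (le_trans _ h).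
- exact: cvg_cst.
- have h : rho k.1 + rho k.2 @[k --> (\oo, \oo)] --> 0.
    by rewrite -(addr0 0); apply: cvgD; [exact: (@cvg_comp _ _ _ (fun k : nat * nat => k.1) rho _ _ _ cvg_fst rho0)|exact: (@cvg_comp _ _ _ (fun k : nat * nat => k.2) rho _ _ _ cvg_snd rho0)].
  by rewrite -(mulr0 0); exact: cvgM.
Qed.

(** An element of the form domain is reached by the test functions of [approx_test]. As for the
    values, the bounded part is continuous in L^2 and the energy along energy convergence, so every
    choice of sequences leads to [QW]. *)
Lemma opB_closure : is_form_closure a B (QWa a).
Proof.
split=> [v|v w u u' /opB_form_cvg[uH vD uv rc ic] /opB_form_cvg[u'H wD u'w rc' ic']].
  split=> [vD|[u /opB_form_cvg[]//]].
  have [vL [rE iE]] := (fdom_QWa a v).1 vD; have [vr vi] := (L2P a v).1 vL.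
  have vrL := L2a_L2r vr; have viL := L2a_L2r vi.
  have [p [pT pL pc pe]] := approx_test a0 (L2r_cut a vrL) (@suppin_cut R a (re v)).
  have [q [qT qL qc qe]] := approx_test a0 (L2r_cut a viL) (@suppin_cut R a (im v)).
  have [pE {}pe] := pe ((dE_cut vr).1 rE); have [qE {}qe] := qe ((dE_cut vi).1 iE).
  have uH n : H10 a (fun x => Complex (p n x) (q n x)).
    by apply: test_H10 => //; apply/test_functionP; split; [exact: pT|exact: qT].
  exists (fun n x => Complex (p n x) (q n x)); apply/opB_form_cvg; split=> //.
  - apply/(@cvgL2P R (fun n x => Complex (p n x) (q n x)) v pL qL vrL viL).
    by split; apply: nr_cvg_cut.
  - exact: (EE_cvg_cut (fun n => rtest_L2a (pT n)) vr pe).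
  - exact: (EE_cvg_cut (fun n => rtest_L2a (qT n)) vi qe).
have [vL [vrE viE]] := (fdom_QWa a v).1 vD; have [vr vi] := (L2P a v).1 vL.
have [wL [wrE wiE]] := (fdom_QWa a w).1 wD; have [wr wi] := (L2P a w).1 wL.
have uL n : L2 a (u n) by have [] := H10_dE (uH n).
have u'L n : L2 a (u' n) by have [] := H10_dE (u'H n).
have rE n : dE (re (u n)) by have [] := H10_dE (uH n).
have iE n : dE (im (u n)) by have [] := H10_dE (uH n).
have rE' n : dE (re (u' n)) by have [] := H10_dE (u'H n).
have iE' n : dE (im (u' n)) by have [] := H10_dE (u'H n).
have rL n : L2a a (re (u n)) by have /L2P[] := uL n.
have iL n : L2a a (im (u n)) by have /L2P[_] := uL n.
have rL' n : L2a a (re (u' n)) by have /L2P[] := u'L n.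
have iL' n : L2a a (im (u' n)) by have /L2P[_] := u'L n.
have [ruv iuv] := (cvgL2P (fun n => L2a_L2r (rL n)) (fun n => L2a_L2r (iL n)) (L2a_L2r vr) (L2a_L2r vi)).1 uv.
have [ruw iuw] := (cvgL2P (fun n => L2a_L2r (rL' n)) (fun n => L2a_L2r (iL' n)) (L2a_L2r wr) (L2a_L2r wi)).1 u'w.
(* Finite energy of v and w makes the Weil functional a convergent expression, equal to the same
   [cform] as on H^1_0. *)
rewrite [fval (QWa a) v w](QWE a0 (Nmax_ge a) vr vi wr wi vrE viE wrE wiE).
have q_cvg (x y : nat -> R -> R) p r : (forall n, L2a a (x n)) -> (forall n, L2a a (y n)) ->
    L2a a p -> L2a a r -> (forall n, dE (x n)) -> (forall n, dE (y n)) -> dE p -> dE r ->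
    nr (fun z => x n z - p z) @[n --> \oo] --> 0 -> nr (fun z => y n z - r z) @[n --> \oo] --> 0 ->
    EE (fun z => x n z - p z) (fun z => x n z - p z) @[n --> \oo] --> 0 ->
    EE (fun z => y n z - r z) (fun z => y n z - r z) @[n --> \oo] --> 0 ->
    qform N (x n) (y n) @[n --> \oo] --> qform N p r.
  move=> xL yL pL rL0 xE yE pE rE0 xp yr xpE yrE.
  rewrite (qform_cut N pL rL0); under eq_fun do rewrite (qform_cut N (xL _) (yL _)).
  have cutE f g : (forall n, L2a a (f n)) -> L2a a g ->
      EE (fun z => f n z - g z) (fun z => f n z - g z) @[n --> \oo] --> 0 ->
      EE (fun z => cut a (f n) z - cut a g z) (fun z => cut a (f n) z - cut a g z) @[n --> \oo] --> 0.
    move=> fL gL; apply: cvg_extn => n; rewrite (EE_cut (L2aB (fL n) gL)) cutB//.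
  have cL w0 : L2a a w0 -> L2r (cut a w0) by move=> /L2a_L2r; exact: L2r_cut.
  have cE w0 : L2a a w0 -> dE w0 -> dE (cut a w0) by move=> w0L /(dE_cut w0L).
  have h := (@qform_cvg R a a0 N (fun n => cut a (x n)) (fun n => cut a (y n)) (cut a p) (cut a r) (fun n => cL _ (xL n)) (fun n => @suppin_cut _ a (x n)) (fun n => cE _ (xL n) (xE n))
    (fun n => cL _ (yL n)) (fun n => @suppin_cut _ a (y n)) (fun n => cE _ (yL n) (yE n))
    (cL _ pL) (@suppin_cut _ a p) (cE _ pL pE) (cL _ rL0) (@suppin_cut _ a r) (cE _ rL0 rE0)
    (nr_cut_cvg a (fun n => L2a_L2r (xL n)) (L2a_L2r pL) xp) (nr_cut_cvg a (fun n => L2a_L2r (yL n)) (L2a_L2r rL0) yr)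
    (cutE _ _ xL pL xpE) (cutE _ _ yL rL0 yrE)).
  exact: h.
have c1 := q_cvg _ _ _ _ rL rL' vr wr rE rE' vrE wrE ruv ruw rc rc'.
have c2 := q_cvg _ _ _ _ iL iL' vi wi iE iE' viE wiE iuv iuw ic ic'.
have c3 := q_cvg _ _ _ _ iL rL' vi wr iE rE' viE wrE iuv ruw ic rc'.
have c4 := q_cvg _ _ _ _ rL iL' vr wi rE iE' vrE wiE ruv iuw rc ic'.
have sq (f : nat -> R) l : f n @[n --> \oo] --> l -> (f n - l) ^+ 2 @[n --> \oo] --> 0.
  move=> fl; have h : f n - l @[n --> \oo] --> 0 by apply/subr_cvg0.
  by rewrite -(mulr0 0); exact: (cvgM h h).
rewrite -(addr0 0).
apply: cvg_extn (cvgD (sq _ _ (cvgD c1 c2)) (sq _ _ (cvgB c3 c4))) => n.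
by rewrite opB_form.
Qed.

End Friedrichs.

Theorem theorem1p1 (R : realType) (a : R) (ha : 0 < a) :
  odom (opB a) = H10 a /\ is_friedrichs_extension a (opA a) (opB a).
Proof.
split; first exact: odom_opB.
split; [exact: opB_dense|exact: opB_symmetric|exact: opB_lower_bounded|].
(* [opA a] is by definition the operator of the form [QWa a], so the closure of the form of B_a is
   all that remains. *)
by exists (QWa a) => //; exact: opB_closure.
Qed.
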